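(* Fix non-negative integers $n_\bullet, n_\circ, n_{{\bullet\!\!\!\bigcirc}}, n_{{\circ\!\!\!\bigcirc}}$. Then $$\sum_{\mathcal T}(-1)^{n(\mathcal T)} \;=\; \#\{\text{rooted planar bicubic maps with hard particles } \mathcal M\} \;=\; \#\{\text{rooted good trees}\},$$ where: the left sum runs over all rooted admissible trees $\mathcal T$ having exactly $n_\bullet$ black-empty, $n_\circ$ white-empty, $n_{{\bullet\!\!\!\bigcirc}}$ black-occupied and $n_{{\circ\!\!\!\bigcirc}}$ white-occupied inner vertices, and $n(\mathcal T)$ is the number of NHP inner edges of $\mathcal T$; the middle count is over rooted planar bicubic maps with hard particles having $n_\bullet+1$ black-empty, $n_\circ$ white-empty, $n_{{\bullet\!\!\!\bigcirc}}$ black-occupied and $n_{{\circ\!\!\!\bigcirc}}$ white-occupied vertices; the right count is over rooted good trees with the same vertex numbers as in the left sum.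
   Context: A planar bicubic map with hard particles is a planar map (considered up to orientation-preserving homeomorphism of the sphere) all of whose vertices have degree 3, each vertex being coloured black or white, every edge joining a black to a white vertex, and each vertex being either empty or occupied by a particle, such that no edge has both endpoints occupied. It is rooted if it has a marked oriented edge (the root edge) whose origin (the root vertex) is a black-empty vertex. A blossom tree is a plane tree whose inner vertices are black or white, all of degree 3, whose inner edges all join a black to a white inner vertex, and whose remaining (degree-one) ends are of two kinds: buds, attached only to black inner vertices and given charge $-1$, and leaves, attached only to white inner vertices and given charge $+1$; the total charge (#leaves $-$ #buds) is $3$. Removing an inner edge $e$ splits the tree into two parts; let $q_\circ$ (resp. $q_\bullet$) be the total charge of buds and leaves in the part containing the white (resp. black) endpoint of $e$; then $q_\circ+q_\bullet=3$, $q_\circ\equiv 2 \bmod 3$. The edge $e$ is regular if $q_\circ\ge 0$ and $q_\bullet\le 1$ (equivalently $q_\circ\ge 2$), and non-regular otherwise. Closing procedure: walking counterclockwise around the tree gives a cyclic sequence of buds and leaves; repeatedly join each bud that is immediately followed (among not yet matched buds and leaves) by a leaf into a new edge (drawn without crossings), until no such pair remains. Exactly three leaves remain unmatched; connect them to a new black vertex placed in the outer face. The result is a planar bicubic map. A rooted blossom tree is one with a distinguished leaf among the three unmatched ones; its closing is rooted at the edge from the new black vertex to this leaf's endpoint. Trees with particles: each inner vertex of a blossom tree may additionally be empty or occupied; an inner edge is HP if at most one of its endpoints is occupied and NHP if both are. When closing, the occupancy of vertices is kept and the new black vertex is empty. An admissible tree is a blossom tree with particles in which every HP inner edge is regular and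 every NHP inner edge is non-regular. A good tree is a blossom tree with particles in which every inner edge is HP and regular and whose closing produces a map with no edge having both endpoints occupied. *)

(* Defs.v *)
(* Combinatorial-map (rotation system) encoding of planar
   bicubic maps with hard particles and of blossom trees with particles. *)
From mathcomp Require Import all_boot all_fingroup all_algebra.
Set Implicit Arguments. Unset Strict Implicit. Unset Printing Implicit Defensive.
Import GRing.Theory Num.Theory.
Local Open Scope ring_scope.

(* A structure on a finite set of darts T:
   (sigma, alpha, black, occupied, root dart)
   - sigma : counterclockwise rotation of the darts around their vertex
             (vertices = sigma-orbits);
   - alpha : involution pairing the two darts (half-edges) of an edge; for a
             blossom tree, the fixed points of alpha are the degree-one ends
             (buds at black vertices, leaves at white vertices);
   - black x / occ x : colour / occupancy of the vertex of dart x;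
   - root : root dart (origin of the root edge / distinguished leaf). *)
Definition dstruct (T : finType) :=
  ({perm T} * {perm T} * {ffun T -> bool} * {ffun T -> bool} * T)%type.

Section Struct.
Variable T : finType.
Implicit Types X Y : dstruct T.

Definition sg X : {perm T} := X.1.1.1.1.
Definition al X : {perm T} := X.1.1.1.2.
Definition blk X : {ffun T -> bool} := X.1.1.2.
Definition occ X : {ffun T -> bool} := X.1.2.
Definition rt X : T := X.2.

Definition iso X Y : bool :=
  [exists p : {perm T},
    [forall x, [&& p (sg X x) == sg Y (p x), p (al X x) == al Y (p x),
                   blk Y (p x) == blk X x & occ Y (p x) == occ X x]]
    && (p (rt X) == rt Y)].

Definition iso_classes (P : pred (dstruct T)) : {set {set dstruct T}} :=
  [set [set Y | P Y && iso X Y] | X : dstruct T & P X].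

Definition vcount (s : {perm T}) (P : pred T) : nat :=
  #|[set porbit s x | x : T & P x]|.

Definition vcounts X (nb nw nbo nwo : nat) : bool :=
  [&& vcount (sg X) (fun x => blk X x && ~~ occ X x) == nb,
      vcount (sg X) (fun x => ~~ blk X x && ~~ occ X x) == nw,
      vcount (sg X) (fun x => blk X x && occ X x) == nbo &
      vcount (sg X) (fun x => ~~ blk X x && occ X x) == nwo].

Definition step X : rel T := fun y z => (z == sg X y) || (z == al X y).

Definition step_wo X (x : T) : rel T :=
  fun y z => (z == sg X y) || [&& z == al X y, y != x & y != al X x].

Definition connected X : bool := [forall x, forall y, connect (step X) x y].

Definition inner X (x : T) : bool := al X x != x.
Definition isBud X (y : T) : bool := (al X y == y) && blk X y.
Definition isLeaf X (y : T) : bool := (al X y == y) && ~~ blk X y.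

Definition HP X (x : T) : bool := ~~ (occ X x && occ X (al X x)).

Definition is_blossom X : bool :=
  [&& [forall x, (sg X x != x) && (sg X (sg X (sg X x)) == x)],
      [forall x, al X (al X x) == x],
      [forall x, (blk X (sg X x) == blk X x) && (occ X (sg X x) == occ X x)],
      [forall x, inner X x ==> (blk X (al X x) != blk X x)],
      connected X,
      [forall x, inner X x ==> ~~ connect (step_wo X x) x (al X x)]
    & (#|[set y | isLeaf X y]|%:Z - #|[set y | isBud X y]|%:Z == 3)].

Definition qpart X (x start : T) : int :=
  \sum_(y : T | connect (step_wo X x) start y && (al X y == y))
     (if blk X y then -1 else 1).

Definition regular X (x : T) : bool :=
  let w := if blk X x then al X x else x in
  let k := al X w in
  (0 <= qpart X x w) && (qpart X x k <= 1).

(* cyclic sequence of buds and leaves met walking counterclockwise around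
   the tree (contour step: y |-> sigma (alpha y)) *)
Definition contour X : seq T :=
  if enum T is x0 :: _ then
    filter (fun y => al X y == y) (traject (fun y => sg X (al X y)) x0 #|T|)
  else [::].

(* closing procedure on a cyclic word: repeatedly match a bud immediately
   followed (cyclically) by a leaf; returns matched pairs and unmatched ends *)
Fixpoint close_aux (bud leaf : pred T) (fuel : nat) (s : seq T)
  : seq (T * T) * seq T :=
  if fuel is f.+1 then
    let i := find (fun p => bud p.1 && leaf p.2) (zip s (rot 1 s)) in
    if (i < size s)%N then
      match rot i s with
      | b :: l :: rest =>
          let r := close_aux bud leaf f rest in ((b, l) :: r.1, r.2)
      | _ => ([::], s)
      end
    else ([::], s)
  else ([::], s).

Definition closing X : seq (T * T) * seq T :=
  close_aux (isBud X) (isLeaf X) (size (contour X)) (contour X).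

Definition rooted_tree X : bool := isLeaf X (rt X) && (rt X \in (closing X).2).

Definition admissible X : bool :=
  is_blossom X &&
  [forall x, inner X x ==> (if HP X x then regular X x else ~~ regular X x)].

(* closing has no edge with both endpoints occupied: inner edges, new
   bud-leaf edges (the edges to the new empty black vertex are always fine) *)
Definition good X : bool :=
  [&& is_blossom X,
      [forall x, inner X x ==> HP X x && regular X x]
    & all (fun p => ~~ (occ X p.1 && occ X p.2)) (closing X).1].

Definition nNHP X : nat := (#|[set x | inner X x && ~~ HP X x]|)./2.

Definition is_bicubic_hp X : bool :=
  [&& [forall x, (sg X x != x) && (sg X (sg X (sg X x)) == x)],
      [forall x, (al X x != x) && (al X (al X x) == x)],
      [forall x, (blk X (sg X x) == blk X x) && (occ X (sg X x) == occ X x)],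
      [forall x, blk X (al X x) != blk X x],
      [forall x, HP X x],
      connected X,
      (* planarity: Euler formula V + F = E + 2, faces = orbits of alpha;sigma *)
      #|porbits (sg X)| + #|porbits (al X * sg X)%g| == #|porbits (al X)| + 2
    & blk X (rt X) && ~~ occ X (rt X)]%N.

End Struct.

Definition tree_darts (nb nw nbo nwo : nat) := 'I_(3 * (nb + nw + nbo + nwo)).
Definition map_darts (nb nw nbo nwo : nat) := 'I_(3 * (nb.+1 + nw + nbo + nwo)).

Definition adm_tree (nb nw nbo nwo : nat) : pred (dstruct (tree_darts nb nw nbo nwo)) :=
  fun X => [&& admissible X, rooted_tree X & vcounts X nb nw nbo nwo].

Definition good_tree (nb nw nbo nwo : nat) : pred (dstruct (tree_darts nb nw nbo nwo)) :=
  fun X => [&& good X, rooted_tree X & vcounts X nb nw nbo nwo].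

Definition bicubic_map (nb nw nbo nwo : nat) : pred (dstruct (map_darts nb nw nbo nwo)) :=
  fun X => is_bicubic_hp X && vcounts X nb.+1 nw nbo nwo.

Definition class_sign (T : finType) (C : {set dstruct T}) : int :=
  if [pick X in C] is Some X then (-1) ^+ nNHP X else 0.

Arguments adm_tree nb nw nbo nwo : clear implicits.
Arguments good_tree nb nw nbo nwo : clear implicits.
Arguments bicubic_map nb nw nbo nwo : clear implicits.

(* Main.v *)
(* Remove the root vertex of a bicubic map and colour-orient its dual.  A blossom
   tree closing to the map is then a spanning arborescence of the dual rooted at
   the outer face: the bud-leaf edges are the arcs of the arborescence, and the
   partial sums of charges along the contour of the tree (the heights) are minus
   the depths of the faces.  An inner edge is regular exactly when its dual arc
   does not improve on the arborescence, ties being broken by the contour order,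
   so for every set S of edges that may not be cut there is exactly one tree
   keeping S and regular off S if all faces can be reached without crossing S,
   and none otherwise.  Hence, for a map with set N of non-hard edges, the
   signed sum over the admissible trees closing to it is the sum over the subsets
   S of N of (-1)^|S| [all faces are reachable without crossing S].  If N is not
   empty, some edge of N leads to a face that is reachable without crossing N;
   adding or removing it from S cancels the sum.  If N is empty the sum is 1, and
   the single tree is the good tree. *)

(* The obstacle is that trees and maps live on different dart sets. Both are compared with an
   intermediate object, the map without its root vertex, which has the darts of the tree: closing
   then changes only the involution, and opening an edge is composition with a transposition. On a
   fixed dart set everything is counted for labelled structures; a connected rooted structure has no
   automorphism, so every isomorphism class has the same number of labellings, the factorial of
   [#|T|]. The root vertex is put back last, and Euler's formula forces the cyclic order of its
   three edges. For a given S, a tree regular off S has the greatest heights among all openings that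
   do not cut S. Two such trees thus have equal heights, and the first difference between their
   contours contradicts regularity. Existence is a breadth-first search that opens the highest
   available edge, the leftmost among equals. The search only controls q >= 0; since a sum over
   whole cubic vertices is a multiple of 3, this already means q >= 2. *)
Require Import Defs.
From mathcomp Require Import all_boot all_order all_fingroup all_algebra zify.
Set Implicit Arguments. Unset Strict Implicit. Unset Printing Implicit Defensive.
Import GRing.Theory Num.Theory.
Local Open Scope ring_scope.

(* [lia] does not identify [size] and [index] terms whose types are only
   convertible; generalising them first does. *)
Ltac revert_arith :=
  repeat match goal with
  | H : is_true (leq _ _) |- _ => revert H
  | H : is_true (andb (leq _ _) (leq _ _)) |- _ => revert H
  | H : is_true (Order.le _ _) |- _ => revert H
  | H : is_true (Order.lt _ _) |- _ => revert H
  | H : @eq bool (leq _ _) _ |- _ => revert H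
  | H : @eq nat _ _ |- _ => revert H
  | H : @eq int _ _ |- _ => revert H
  end.

Ltac seqlia :=
  revert_arith;
  repeat match goal with
  | |- context [index ?y ?s] => let i := fresh "i" in move: (index y s) => i
  | |- context [size ?s] => let n := fresh "n" in move: (size s) => n
  end;
  clear; lia.

(** * Cycles of a function, written as sequences *)

Section FunctionCycles.
Variable T : eqType.
Implicit Types (f g : T -> T) (s V W : seq T).

Lemma eq_in_fpath f g x s :
  {in belast x s, f =1 g} -> fpath f x s = fpath g x s.
Proof.
elim: s x => //= y s IH x h; rewrite (h x) ?mem_head // IH // => z zs.
by apply: h; rewrite inE zs orbT.
Qed.

(** Composition with a transposition splits a cycle or merges two; this is its form on sequences.
    [g] is [f] with the images of [b] and of the last entry of [V] exchanged, so [V] closes up on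
    itself and [b] is followed by [W]. *)
Lemma fcycle_exchange f g b V W :
    V != [::] -> uniq (b :: V ++ W) ->
    {in V ++ W, forall y, y != last b V -> g y = f y} ->
    g b = f (last b V) -> g (last b V) = f b ->
  fcycle f (b :: V ++ W) = fcycle g (b :: W) && fcycle g V.
Proof.
case: V => // v V _ /= /andP[bN /andP[vN uN]] h gb gl.
move: bN; rewrite !inE !mem_cat !negb_or => /and3P[bv bV bW].
move: vN; rewrite mem_cat negb_or => /andP[vV vW].
move: uN; rewrite cat_uniq => /and3P[uV /hasPn VW uW].
have lV : last v V \in v :: V by exact: mem_last.
have fgV : {in belast v V, f =1 g}.
  move=> y yV; rewrite h //.
    by rewrite -cat_cons mem_cat (mem_belast yV).
  apply: contraTneq yV => ->.
  suff: uniq (rcons (belast v V) (last v V)) by rewrite rcons_uniq => /andP[].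
  by rewrite -lastI /= vV.
have fgW : {in W, f =1 g}.
  move=> y yW; rewrite h //; first by rewrite -cat_cons mem_cat yW orbT.
  apply: contraTneq yW => ->; move: lV; rewrite inE => /orP[/eqP->//|lV].
  by apply/negP => /VW /=; rewrite lV.
rewrite rcons_cat cat_path [fpath g v (rcons V v)]rcons_path (eq_in_fpath fgV) /=.
rewrite gl.
have -> : fpath f (last v V) (rcons W b) = fpath g b (rcons W b).
  case: W fgW {h uW vW bW VW} => [|w W] fgW /=; first by rewrite gb.
  rewrite gb; congr (_ && _); apply: eq_in_fpath => y.
  by rewrite belast_rcons; exact: fgW.
by case: (_ == v); case: (fpath g v V); case: (fpath g b _).
Qed.

Lemma fcycle_rotate f A B : fcycle f (A ++ B) = fcycle f (B ++ A).
Proof. by rewrite -[LHS](rot_cycle (size A)) rot_size_cat. Qed.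

Lemma fcycle_insert f g A b V B :
    V != [::] -> uniq (A ++ b :: V ++ B) ->
    {in A ++ V ++ B, forall y, y != last b V -> g y = f y} ->
    g b = f (last b V) -> g (last b V) = f b ->
  fcycle f (A ++ b :: V ++ B) = fcycle g (A ++ b :: B) && fcycle g V.
Proof.
move=> V0 u h gb gl; rewrite fcycle_rotate [in RHS]fcycle_rotate /= -catA.
apply: fcycle_exchange => //.
  by rewrite catA -cat_cons uniq_catC.
by move=> y; rewrite !mem_cat => yI; apply: h; rewrite !mem_cat; case/or3P: yI => ->; rewrite ?orbT.
Qed.

Lemma fcycle_closed f s x : fcycle f s -> x \in s -> f x \in s.
Proof. by move=> fs xs; rewrite (eqP (next_cycle fs xs)) mem_next. Qed.

Lemma fcycle_nth f s x0 i : fcycle f s -> (i.+1 < size s)%N ->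
  nth x0 s i.+1 = f (nth x0 s i).
Proof.
case: s => //= x s /(pathP x0) /(_ i); rewrite size_rcons !ltnS => h lt_i.
have /eqP := h (ltnW lt_i); rewrite -rcons_cons !nth_rcons /= ltnS lt_i ltnW //.
Qed.

Lemma index_fcycle f s x0 y : uniq s -> fcycle f s -> y \in s -> y != last x0 s ->
  index (f y) s = (index y s).+1.
Proof.
move=> us cs ys yl; have iy : (index y s < size s)%N by rewrite index_mem.
have iS : ((index y s).+1 < size s)%N.
  rewrite ltn_neqAle iy andbT; apply: contra yl => /eqP e.
  by rewrite -nth_last -e /= nth_index.
by rewrite -{1}(nth_index x0 ys) -(fcycle_nth x0 cs iS) index_uniq.
Qed.

End FunctionCycles.

(** * Charges, heights, and the insertion of a face into a contour *)

Section Opening.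
Variables (T : finType) (sg : {perm T}) (blk : pred T) (rt : T).
Implicit Types (al m : {perm T}) (L : seq T).

(** The same function as the permutation [al * sg], whose orbits are the faces. *)
Definition face_step al : T -> T := fun y => sg (al y).

Definition dart_charge al y : int := if al y == y then (if blk y then -1 else 1) else 0.

(** Written with a transposition so that its effect on the number of faces is given by
    [porbits_mul_tperm]. *)
Definition cut al b : {perm T} := (tperm b (al b) * al)%g.

(** The dart's own charge is left out, so a bud still has the height of the face it belongs to, and
    the face inserted behind it is one lower. *)
Definition height al L y : int := \sum_(z <- take (index y L) L) dart_charge al z.

(** The edges of a bicubic map without its black root vertex: a fixed point is what remains of a
    root edge, hence white. *)
Definition edge_perm m :=
  [/\ involutive m, forall x, m x != x -> blk (m x) = ~~ blk x
    & forall x, m x = x -> ~~ blk x].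

Lemma cutE al b : involutive al ->
  cut al b =1 fun y => if (y == b) || (y == al b) then y else al y.
Proof.
move=> alK y; rewrite permM; case: tpermP => [->|->|/eqP/negPf-> /eqP/negPf->//].
  by rewrite eqxx alK.
by rewrite eqxx orbT.
Qed.

Lemma cut_involutive al b : involutive al -> involutive (cut al b).
Proof.
move=> alK y; rewrite !cutE //.
have [->|nb] /= := eqVneq y b; first by rewrite eqxx.
have [->|nl] /= := eqVneq y (al b); first by rewrite eqxx orbT.
by rewrite (inj_eq perm_inj) (can2_eq alK alK) (negPf nb) (negPf nl) /= alK.
Qed.

Lemma phi_inj al : injective (face_step al).
Proof. by move=> x y /perm_inj/perm_inj. Qed.

Lemma ht_next f al L x0 y : uniq L -> fcycle f L -> y \in L -> y != last x0 L ->
  height al L (f y) = height al L y + dart_charge al y.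
Proof.
move=> uL cL yL yl; rewrite /height (index_fcycle uL cL yL yl).
by rewrite (take_nth y) ?index_mem // big_rcons /= nth_index // addrC.
Qed.

Section Insertion.
Variables (A B V : seq T) (b : T).
Let L := A ++ b :: B.
Let L' := A ++ b :: V ++ B.
Hypothesis uL : uniq L'.

Let perm_LV : perm_eq L' (L ++ V).
Proof.
by rewrite /L' /L -catA cat_cons perm_cat2l perm_cons perm_catC.
Qed.

Lemma mem_insert y : (y \in L') = (y \in L) || (y \in V).
Proof. by rewrite (perm_mem perm_LV) mem_cat. Qed.

Lemma uniq_insert : [/\ uniq L, uniq V & {in V, forall y, y \notin L}].
Proof.
move: uL; rewrite (perm_uniq perm_LV) cat_uniq => /and3P[-> /hasPn h ->].
by split.
Qed.

Lemma index_insert_self : index b L = size A.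
Proof.
have [] := uniq_insert; rewrite /L cat_uniq /= => /and3P[_ + _] _ _.
by rewrite negb_or index_cat => /andP[/negPf-> _]; rewrite /= eqxx addn0.
Qed.

Lemma index_insert_old y : y \in L ->
  index y L' = (if index y L <= size A then index y L else index y L + size V)%N.
Proof.
have [uL0 _ dV] := uniq_insert.
rewrite /L' /L mem_cat inE !index_cat /= => yL.
case: ifP yL => [yA _|yA /=]; first by rewrite (ltnW _) // index_mem.
case: eqVneq => [-> _|yb /= yB]; first by rewrite !addn0 leqnn.
rewrite index_cat; case: ifP => [/dV|_].
  by rewrite /L mem_cat inE yB !orbT.
by rewrite ifF; seqlia.
Qed.

Lemma index_insert_new y : y \in V -> (size A < index y L' <= size A + size V)%N.
Proof.
have [_ _ dV] := uniq_insert => yV; have := dV y yV.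
rewrite /L mem_cat inE !negb_or => /and3P[/negPf yA /negPf yb _].
rewrite /L' index_cat yA /= eq_sym yb index_cat yV.
by have := index_mem y V; rewrite yV; seqlia.
Qed.

Variable al : {perm T}.
Hypotheses (alK : involutive al) (alb : al b != b) (lV : last b V = al b).
Hypotheses (bb : blk b) (wl : ~~ blk (al b)) (Vfix : {in V, forall y, al y != y}).

Let V_rcons : exists V', V = rcons V' (al b).
Proof.
case/lastP: V lV => [/= e|V' x]; first by move: alb; rewrite -e eqxx.
by rewrite last_rcons => ->; exists V'.
Qed.

Let charge_old y : y \in L -> dart_charge (cut al b) y = dart_charge al y - (y == b)%:Z.
Proof.
have [V' eV] := V_rcons; have [_ _ dV] := uniq_insert.
have lL : al b \notin L by apply: dV; rewrite eV mem_rcons mem_head.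
move=> yL; rewrite /dart_charge cutE //; case: (eqVneq y b) => [->|yb] /=.
  by rewrite eqxx (negPf alb) bb.
case: (eqVneq y (al b)) => [e|_]; last by rewrite subr0.
by move: lL; rewrite -e yL.
Qed.

Let charge_new y : y \in V -> dart_charge (cut al b) y = (y == al b)%:Z.
Proof.
have [_ _ dV] := uniq_insert => yV; rewrite /dart_charge cutE //.
case: (eqVneq y b) => [e|yb] /=.
  by have := dV y yV; rewrite e /L mem_cat mem_head orbT.
case: (eqVneq y (al b)) => [->|_]; first by rewrite eqxx (negPf wl).
by rewrite (negPf (Vfix yV)).
Qed.

Let sum_charge_old s : {subset s <= L} -> b \notin s ->
  \sum_(z <- s) dart_charge (cut al b) z = \sum_(z <- s) dart_charge al z.
Proof.
move=> sL bs; apply: eq_big_seq => z zs.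
by rewrite charge_old ?sL // (negPf (memPn bs z zs)) subr0.
Qed.

Let sum_charge_new : \sum_(z <- V) dart_charge (cut al b) z = 1.
Proof.
have [V' eV] := V_rcons; have [_ uV _] := uniq_insert.
rewrite (eq_big_seq _ charge_new) eV big_rcons /= eqxx big_seq big1 // => z zV.
case: (eqVneq z (al b)) => // e.
by move: uV; rewrite eV rcons_uniq -e zV.
Qed.

(** The new bud [b] contributes -1 and the stretch [V], whose only end is the new leaf [al b],
    contributes +1; behind [V] nothing has changed. *)
Lemma ht_insert_old y : y \in L -> height (cut al b) L' y = height al L y.
Proof.
have [V' eV] := V_rcons; have [uL0 uV dV] := uniq_insert.
have AL : {subset A <= L} by move=> z zA; rewrite mem_cat zA.
have BL : {subset B <= L} by move=> z zA; rewrite mem_cat inE zA !orbT.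
move: (uL0); rewrite cat_uniq /= negb_or => /and3P[_ /andP[bA /hasPn AB] /andP[bB _]].
rewrite /height /L' /L mem_cat inE !index_cat /= => yL.
case: ifP yL => [yA _|yA /=].
  have iA : (index y A < size A)%N by rewrite index_mem.
  rewrite !takel_cat; [|exact: ltnW iA|exact: ltnW iA].
  apply: sum_charge_old => [z /mem_take/AL//|].
  by apply: contra bA => /mem_take.
case: eqVneq => [-> _|yb /= yB].
  by rewrite !addn0 !take_size_cat // sum_charge_old.
rewrite index_cat; case: ifP => [/dV|_]; first by rewrite BL.
rewrite take_cat [in RHS]take_cat !ltnNge !leq_addr /=.
rewrite !addKn /= take_cat ifF; last by seqlia.
rewrite addKn !big_cat /= !big_cons big_cat /= charge_old ?mem_cat ?mem_head ?orbT //.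
rewrite eqxx sum_charge_new.
rewrite sum_charge_old // [\sum_(z <- take _ _) _]sum_charge_old //; first by rewrite [_ - _ + _]addrA subrK.
  by move=> z /mem_take/BL.
by apply: contra bB => /mem_take.
Qed.

(** The new leaf comes last in [V], so all of [V] is read after the -1 of [b] and before the +1. *)
Lemma ht_insert_new y : y \in V -> height (cut al b) L' y = height al L b - 1.
Proof.
have [V' eV] := V_rcons; have [uL0 uV dV] := uniq_insert => yV.
move: (uL0); rewrite cat_uniq /= negb_or => /and3P[_ /andP[bA _] _].
have AL : {subset A <= L} by move=> z zA; rewrite mem_cat zA.
have := dV y yV; rewrite mem_cat inE !negb_or => /and3P[/negPf yA /negPf yb _].
rewrite /height index_insert_self /L' /L index_cat yA /= eq_sym yb index_cat yV.
rewrite take_cat ifF; last by seqlia.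
rewrite addKn /= [in RHS]take_size_cat // takel_cat ?index_size //.
rewrite big_cat big_cons /= sum_charge_old // charge_old ?mem_cat ?mem_head ?orbT //.
have -> : \sum_(z <- take (index y V) V) dart_charge (cut al b) z = 0.
  rewrite big_seq big1 // => z zV; rewrite charge_new ?(mem_take zV) //; case: (eqVneq z (al b)) => // e.
  have := index_mem z (take (index y V) V); rewrite zV size_takel ?index_size //.
  have -> : index z (take (index y V) V) = index z V.
    by rewrite -[in RHS](cat_take_drop (index y V) V) index_cat zV.
  have: (index y V < size V)%N by rewrite index_mem.
  suff -> : index z V = (size V).-1 by seqlia.
  rewrite e eV -cats1 index_cat /= eqxx size_cat /=.
  by move: uV; rewrite eV rcons_uniq => /andP[/negPf->]; seqlia.
by rewrite eqxx /dart_charge (negPf alb) addr0 sub0r.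
Qed.

End Insertion.
End Opening.

Ltac htlia :=
  revert_arith;
  repeat match goal with
  | |- context [height ?k ?a ?l ?y] => let h := fresh "h" in move: (height k a l y) => h
  end;
  seqlia.

(** * Openings of a map and heights *)

Section Opens.
Variables (T : finType) (sg : {perm T}) (blk : pred T) (rt : T).
Implicit Types (al m : {perm T}) (L : seq T).
Local Notation phi := (face_step sg).
Local Notation charge := (dart_charge blk).
Local Notation ht := (height blk).

(* [L] lists the outer face, ending with the root leaf; opening the edge of
   the black dart [b] of [L] inserts after [b] the face lying across it. *)
Inductive opening m : {perm T} -> seq T -> Prop :=
| Opens0 L of uniq L & fcycle (phi m) L & rt \in L & last rt L = rt & m rt = rt
    & (forall x, m x = x -> x \in L) & count (fun x => m x == x) L = 3%N :
    opening m m L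
| OpensS al A b B V of opening m al (A ++ b :: B) & blk b & al b != b
    & fcycle (phi al) V & last b V = al b & uniq (A ++ b :: V ++ B) :
    opening m (cut al b) (A ++ b :: V ++ B).

Record opened m al L : Prop := Opened {
  op_uniq : uniq L;
  op_cycle : fcycle (phi al) L;
  op_root : rt \in L;
  op_last : last rt L = rt;
  op_inv : involutive al;
  op_sub : forall y, al y = y \/ al y = m y;
  op_fix : forall y, al y = y -> y \in L;
  op_mroot : m rt = rt }.

Lemma fcycle_cut al A b V B : involutive al -> al b != b -> last b V = al b ->
    uniq (A ++ b :: V ++ B) ->
  fcycle (phi (cut al b)) (A ++ b :: V ++ B)
    = fcycle (phi al) (A ++ b :: B) && fcycle (phi al) V.
Proof.
move=> alK alb lV u; apply: fcycle_insert; rewrite ?lV //.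
- by apply: contra alb => /eqP V0; rewrite -lV V0.
- move=> y yI yl; rewrite /face_step cutE // (negPf yl) orbF.
  case: eqVneq yI => // ->; move: u.
  rewrite cat_uniq /= negb_or !mem_cat negb_or.
  by move=> /and3P[_ /andP[/negPf-> _] /andP[/andP[/negPf-> /negPf->] _]].
- by rewrite /face_step cutE // eqxx orbT.
- by rewrite /face_step cutE // eqxx alK.
Qed.

Lemma opensP m al L : edge_perm blk m -> opening m al L -> opened m al L.
Proof.
case=> mK mblk _; elim=> {al L} [L uL cL rL lL mr fL _|al A b B V _ IH bb alb cV lV u].
  by split=> // y; right.
case: IH => uL cL rL lL alK alm alf mr.
have [_ uV dV] := uniq_insert u.
have memL y : y \in A ++ b :: B -> y \in A ++ b :: V ++ B.
  by rewrite (mem_insert A B V b) => ->.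
have lVin : al b \in V.
  by rewrite -lV; case: (V) lV => [e|v V' _ /=]; [rewrite -e eqxx in alb | exact: mem_last].
split=> //.
- by rewrite fcycle_cut // cL.
- exact: memL.
- move: lL; rewrite !last_cat /=; rewrite last_cat; case: (B) => [|c B'] //= e; case/negP: alb.
  by rewrite e; case: (alm rt) => ->; rewrite ?mr.
- exact: cut_involutive.
- by move=> y; rewrite cutE //; case: ifP => _; [left | exact: alm].
- move=> y; rewrite cutE //; case: ifP => [/orP[/eqP-> _|/eqP-> _]|_ /alf/memL//].
    by apply: memL; rewrite mem_cat mem_head orbT.
  by rewrite (mem_insert A B V b) lVin orbT.
Qed.

Lemma opens_root m al L : opening m al L -> edge_perm blk m -> al rt = rt.
Proof.
move=> o em; have [_ _ _ _ _ alm _ mr] := opensP em o.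
by case: (alm rt) => // ->.
Qed.

Section Step.
Variables (m al : {perm T}) (A B V : seq T) (b : T).
Hypothesis em : edge_perm blk m.
Hypothesis o : opening m al (A ++ b :: B).
Hypotheses (bb : blk b) (alb : al b != b) (cV : fcycle (phi al) V).
Hypotheses (lV : last b V = al b) (u : uniq (A ++ b :: V ++ B)).
Let L := A ++ b :: B.
Let L' := A ++ b :: V ++ B.

Lemma step_new_inner : {in V, forall y, al y != y}.
Proof.
have [_ _ dV] := uniq_insert u.
move=> y yV; apply: contra (dV _ yV) => /eqP; exact: op_fix (opensP em o) _.
Qed.

Lemma step_mate : al b = m b.
Proof. by case: (op_sub (opensP em o) b) => // e; move: alb; rewrite e eqxx. Qed.

Lemma step_leaf_white : ~~ blk (al b).
Proof.
by have [mK mblk _] := em; rewrite step_mate mblk ?bb // -step_mate.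
Qed.

Lemma step_leaf_in : al b \in V.
Proof.
by move: alb; rewrite -lV; case: (V) => [|v V'] /=; rewrite ?eqxx ?mem_last.
Qed.

Lemma step_new_mate y : y \in V -> al y = m y.
Proof.
by move=> /step_new_inner; case: (op_sub (opensP em o) y) => // ->; rewrite eqxx.
Qed.

Lemma step_ht_old y : y \in L -> ht (cut al b) L' y = ht al L y.
Proof.
apply: ht_insert_old => //; first exact: op_inv (opensP em o).
  exact: step_leaf_white.
exact: step_new_inner.
Qed.

Lemma step_ht_new y : y \in V -> ht (cut al b) L' y = ht al L b - 1.
Proof.
apply: ht_insert_new => //; first exact: op_inv (opensP em o).
  exact: step_leaf_white.
exact: step_new_inner.
Qed.

End Step.

(** Before any opening all ends are white, so the height just counts the root leaves already
    passed. *)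
Lemma ht0E m L : edge_perm blk m ->
  forall y, ht m L y = (count (fun x => m x == x) (take (index y L) L))%:Z.
Proof.
case=> _ _ mw y; rewrite /height; elim: (take _ _) => [|z s IH]; first by rewrite big_nil.
rewrite big_cons IH /dart_charge /=; case: eqVneq => [/mw/negPf->|_]; last by rewrite add0r.
by rewrite PoszD.
Qed.

Lemma ht0_mono m L y z : edge_perm blk m -> (index y L <= index z L)%N ->
  ht m L y <= ht m L z.
Proof.
move=> em yz; rewrite !ht0E //; apply: leq_count_subseq.
rewrite -(take_takel L yz); exact: take_subseq.
Qed.

(** One of the three ends, the root leaf, comes last and is never among those passed. *)
Lemma ht0_le2 m L y : edge_perm blk m -> y \in L -> last rt L = rt -> m rt = rt ->
  count (fun x => m x == x) L = 3%N -> 0 <= ht m L y <= 2.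
Proof.
move=> em yL lL mr; rewrite ht0E // -[in count _ L](cat_take_drop (index y L) L).
rewrite count_cat.
have iy : (index y L < size L)%N by rewrite index_mem.
have : (0 < count (fun x => m x == x) (drop (index y L) L))%N.
  rewrite -has_count; apply/hasP; exists rt; last by rewrite mr.
  rewrite -{1}lL -[in last rt L](cat_take_drop (index y L) L) last_cat.
  case: (drop _ _) (size_drop (index y L) L) => [/= e|x s _ /=]; last exact: mem_last.
  by move: iy; rewrite -subn_gt0 -e.
by lia.
Qed.

(** The bracket structure of the contour. Along a face of [m] the height changes only past a fixed
    point of [m]; a bud is matched with the first later leaf that brings the height back to its own;
    the bound 2 is what keeps the root leaf unmatched. *)
Record opened_ht m al L : Prop := OpenedHt {
  oh_le2 : {in L, forall y, ht al L y <= 2};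
  oh_face : {in L, forall y, m y != y ->
     phi m y \in L /\ ht al L (phi m y) = ht al L y};
  oh_bud : forall y, blk y -> al y = y ->
    [/\ m y \in L, (index y L < index (m y) L)%N, ht al L (m y) = ht al L y - 1
      & {in L, forall z, (index y L < index z L <= index (m y) L)%N ->
           ht al L z < ht al L y}] }.

Lemma opens_htP m al L : edge_perm blk m -> opening m al L -> opened_ht m al L.
Proof.
move=> em; elim=> {al L} [L uL cL rL lL mr fL c3|al A b B V o IH bb alb cV lV u].
  have [mK mblk mw] := em; split.
  - by move=> y yL; have /andP[] := ht0_le2 em yL lL mr c3.
  - move=> y yL my; split; first exact: fcycle_closed cL yL.
    rewrite (@ht_next _ _ (phi m) _ _ rt) ?lL //; last first.
      by apply: contra my => /eqP ->; rewrite mr.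
    by rewrite /dart_charge (negPf my) addr0.
  - by move=> y by_ /mw; rewrite by_.
have [hle hface hbud] := IH.
have memL y : y \in A ++ b :: B -> y \in A ++ b :: V ++ B.
  by rewrite (mem_insert A B V b) => ->.
have bL : b \in A ++ b :: B by rewrite mem_cat mem_head orbT.
have hold := step_ht_old em o bb alb lV u.
have hnew := step_ht_new em o bb alb lV u.
have iold := index_insert_old u.
have inew := index_insert_new u.
have ib := index_insert_self u.
have mb := step_mate em o alb.
have ub := mem_insert A B V b.
split.
- move=> y; rewrite ub => /orP[yL|yV]; first by rewrite hold ?hle.
  by rewrite hnew //; have := hle b bL; lia.
- move=> y; rewrite ub => /orP[yL|yV] my.
    by have [pL pe] := hface y yL my; rewrite memL // !hold.
  have pV : phi m y \in V.
    rewrite /face_step -(step_new_mate em o u yV).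
    exact: (fcycle_closed cV yV).
  by rewrite ub pV orbT !hnew.
move=> y by_; rewrite cutE; last exact: op_inv (opensP em o).
have lVin := step_leaf_in alb lV.
case: eqVneq => [-> _|yb] /=.
  rewrite -mb ub lVin orbT hnew // hold // iold // ib leqnn.
  have := inew _ lVin; split=> //; first by lia.
  move=> z; rewrite ub => /orP[zL|zV]; last by rewrite hnew // => _; htlia.
  rewrite iold //; case: ifP; seqlia.
case: eqVneq => [e _|_ /[dup] /(op_fix (opensP em o)) yL /(hbud y by_)[mL ilt hm hz]].
  by move: by_; rewrite e (negPf (step_leaf_white em o bb alb)).
rewrite !hold // memL //; split=> //; first by rewrite !iold //; do 2!case: ifP; seqlia.
move=> z; rewrite ub => /orP[zL|zV].
  by rewrite hold // => h; apply: hz => //; move: h; rewrite !iold //; do 3!case: ifP; seqlia.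
(* The new stretch lies between an old bud [y] and its mate only if [b] does, and then [b] is
   already lower than [y]. *)
move=> h; rewrite hnew //; have := inew z zV; move: h; rewrite (iold y yL) (iold (m y) mL).
have [|yb'] := eqVneq (index y (A ++ b :: B)) (size A).
  rewrite -ib => /(congr1 (nth b (A ++ b :: B))); rewrite !nth_index // => e.
  by rewrite e eqxx in yb.
move=> h1 h2; suff: ht al (A ++ b :: B) b < ht al (A ++ b :: B) y by htlia.
apply: hz => //; rewrite ib; move: yb' h1; do 2!case: ifP; seqlia.
Qed.

End Opens.

Lemma fcycle_iter (T : eqType) (f : T -> T) s r i : fcycle f s -> r \in s ->
  last r s = r -> (i < size s)%N -> nth r s i = iter i f (f r).
Proof.
move=> cs rs ls; elim: i => [|i IH] lt_i; last by rewrite (fcycle_nth _ cs) // IH ?iterS // ltnW.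
case: s cs rs ls {lt_i} => //= x s; rewrite rcons_path => /andP[_ /eqP fx] _ lx.
by rewrite -[in RHS]lx fx.
Qed.

Lemma fcycle_unique (T : finType) (f : T -> T) s1 s2 r : uniq s1 -> uniq s2 ->
  fcycle f s1 -> fcycle f s2 -> r \in s1 -> r \in s2 -> last r s1 = r ->
  last r s2 = r -> s1 = s2.
Proof.
move=> u1 u2 c1 c2 r1 r2 l1 l2.
have e12 : s1 =i s2 by move=> y; rewrite -(fconnect_cycle c1 r1) (fconnect_cycle c2 r2).
have sz : size s1 = size s2 by apply/eqP; rewrite eq_sym -(uniq_size_uniq u1 e12).
apply: (@eq_from_nth _ r) => // i lt_i.
by rewrite !(@fcycle_iter _ f) // -?sz.
Qed.

Lemma fcycle_const (T : finType) (R : Type) (f : T -> T) (g : T -> R) s x y :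
  fcycle f s -> {in s, forall z, g (f z) = g z} -> x \in s -> y \in s -> g x = g y.
Proof.
move=> cs gf xs ys; have /iter_findex <- : fconnect f x y by rewrite (fconnect_cycle cs).
elim: (findex f x y) => //= n ->; rewrite gf //.
by rewrite -(fconnect_cycle cs xs) fconnect_iter.
Qed.

(** * The closing is determined by the tree, and heights are maximal for regular trees *)

Section Uniqueness.
Variables (T : finType) (sg : {perm T}) (blk : pred T) (rt : T).
Implicit Types (al m : {perm T}) (L : seq T).
Local Notation phi := (face_step sg).
Local Notation charge := (dart_charge blk).
Local Notation ht := (height blk).
Local Notation opens := (opening sg blk rt).

(** Recovers the outer face from which the opening started; its heights survive all openings. *)
Lemma opens_base m al L : edge_perm blk m -> opens m al L ->
  exists2 L0, opens m m L0 & {in L0, forall y, y \in L /\ ht al L y = ht m L0 y}.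
Proof.
move=> em; elim=> {al L} [L *|al A b B V o [L0 o0 h0] bb alb cV lV u].
  by exists L => //; apply: Opens0.
exists L0 => // y /h0[yL <-]; split; first by rewrite (mem_insert A B V b) yL.
exact: step_ht_old em o bb alb lV u _ yL.
Qed.

Lemma opens_m_unique m L L' : edge_perm blk m -> opens m m L -> opens m m L' -> L = L'.
Proof.
move=> em /(opensP em) o /(opensP em) o'.
exact: (fcycle_unique (op_uniq o) (op_uniq o') (op_cycle o) (op_cycle o')
         (op_root o) (op_root o') (op_last o) (op_last o')).
Qed.

Lemma bud_mate m al L y : edge_perm blk m -> opens m al L -> blk y -> al y = y ->
  m y != y /\ al (m y) = m y.
Proof.
move=> em o by_ fy; have [mK mblk mw] := em; have op := opensP em o.
have my : m y != y by apply: contraTneq by_ => /mw.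
split=> //; case: (op_sub op (m y)) => // e.
by move: (op_inv op (m y)); rewrite e mK fy => e2; rewrite -e2 eqxx in my.
Qed.

Lemma leaf_mate m al L y : edge_perm blk m -> opens m al L -> m y != y -> al y = y ->
  al (m y) = m y.
Proof.
move=> em o my fy; have [mK mblk mw] := em; have op := opensP em o.
case: (op_sub op (m y)) => // e.
by move: (op_inv op (m y)); rewrite e mK fy => e2; rewrite -e2 eqxx in my.
Qed.

(** Right behind the earlier mate the height is again that of the bud, whereas the later mate would
    require it to be still lower there. *)
Lemma opens_bud_unique m m' al L y : edge_perm blk m -> edge_perm blk m' ->
    opens m al L -> opens m' al L -> blk y -> al y = y ->
  (index (m y) L < index (m' y) L)%N -> False.
Proof.
move=> em em' o o' by_ fy lt_i; have op := opensP em o.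
have [mL iL hL _] := oh_bud (opens_htP em o) by_ fy.
have [mL' _ _ hz] := oh_bud (opens_htP em' o') by_ fy.
have [my fm] := bud_mate em o by_ fy.
have ml : m y != last rt L.
  have iL' : (index (m' y) L < size L)%N by rewrite index_mem.
  apply/eqP => e; move: lt_i; rewrite e -nth_last index_uniq ?(op_uniq op) //; seqlia.
have hn := @ht_next _ blk (phi al) al L rt (m y) (op_uniq op) (op_cycle op) mL ml.
have iS := index_fcycle (op_uniq op) (op_cycle op) mL ml.
have := hz (phi al (m y)) (fcycle_closed (op_cycle op) mL).
rewrite iS hn hL /dart_charge fm eqxx; have [_ mb _] := em; rewrite (mb _ my) by_ /=.
have i3 : (index y L < (index (m y) L).+1 <= index (m' y) L)%N by rewrite ltnS (ltnW iL).
by move/(_ i3); rewrite subrK Order.POrderTheory.ltxx.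
Qed.

(** A tree has only one closing. With this, [closed_map] is identified by exhibiting an opening
    instead of running the matching procedure. *)
Lemma opens_mate_unique m m' al L L' : edge_perm blk m -> edge_perm blk m' ->
    opens m al L -> opens m' al L' -> m = m'.
Proof.
move=> em em' o o'; have op := opensP em o; have op' := opensP em' o'.
have eL : L = L'.
  exact: (fcycle_unique (op_uniq op) (op_uniq op') (op_cycle op) (op_cycle op')
         (op_root op) (op_root op') (op_last op) (op_last op')).
subst L'.
have bud y : blk y -> al y = y -> m y = m' y.
  move=> by_ fy; have [mL _ _ _] := oh_bud (opens_htP em o) by_ fy.
  have [mL' _ _ _] := oh_bud (opens_htP em' o') by_ fy.
  case: (ltngtP (index (m y) L) (index (m' y) L)).
  - by move/(opens_bud_unique em em' o o' by_ fy).
  - by move/(opens_bud_unique em' em o' o by_ fy).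
  - by move/(congr1 (nth rt L)); rewrite !nth_index.
have [mK mb mw] := em; have [mK' mb' mw'] := em'.
apply/permP => y; have [fy|nfy] := eqVneq (al y) y; last first.
  by case: (op_sub op y) (op_sub op' y) nfy => ->; [rewrite eqxx | case=> -> //; rewrite eqxx].
have [/bud-> //|wy] := boolP (blk y).
have [e|my] := eqVneq (m y) y; last first.
  have := bud (m y); rewrite mb // wy (leaf_mate em o my fy) mK => /(_ isT erefl) e.
  by rewrite {2}e mK'.
have [e'|my'] := eqVneq (m' y) y; first by rewrite e'.
have := bud (m' y); rewrite mb' // wy (leaf_mate em' o' my' fy) mK' => /(_ isT erefl) e'.
by move: (mK (m' y)); rewrite e' e => e2; rewrite -e2 eqxx in my'.
Qed.

(** For a black dart [x] this is q >= 2 on the white side: q is the height of [m x] minus that of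
    [x], plus 3 if the white side wraps around the end of the contour. *)
Definition regular_edge m al L x :=
  if (index x L < index (m x) L)%N then ht al L x + 2 <= ht al L (m x)
  else ht al L x - 1 <= ht al L (m x).

(** In the first tree, crossing an edge off [S] from its black dart lowers the height by at most 1.
    The second opening loses exactly 1 at each opened edge, so induction along it gives the
    comparison. *)
Lemma opens_ht_le m al1 L1 al2 L2 (S : pred T) : edge_perm blk m ->
    opens m al1 L1 -> (forall y, y \in L1) ->
    (forall x, blk x -> al1 x != x -> ~~ S x -> regular_edge m al1 L1 x) ->
    opens m al2 L2 -> (forall x, blk x -> S x -> al2 x != x) ->
  {in L2, forall y, ht al2 L2 y <= ht al1 L1 y}.
Proof.
move=> em o1 full1 r1; have h1 := opens_htP em o1.
elim=> {al2 L2} [L uL cL rL lL mr fL c3 _|al A b B V o IH bb alb cV lV u Scut] y yL.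
  have [L0 o0 h0] := opens_base em o1.
  have o0' : opens m m L by apply: Opens0.
  by move: yL; rewrite (opens_m_unique em o0' o0) => /h0[_ ->].
have op := opensP em o.
have {}IH : {in A ++ b :: B, forall y, ht al (A ++ b :: B) y <= ht al1 L1 y}.
  apply: IH => x bx Sx; have := Scut x bx Sx; rewrite cutE; last exact: op_inv op.
  by case: ifP; rewrite ?eqxx.
move: yL; rewrite (mem_insert A B V b) => /orP[yL|yV].
  by rewrite (step_ht_old em o bb alb lV u yL) IH.
rewrite (step_ht_new em o bb alb lV u yV).
have hb := IH b; rewrite mem_cat mem_head orbT in hb; have {}hb := hb isT.
have mb : al b = m b := step_mate em o alb.
have lVin := step_leaf_in alb lV.
(* [V] is a whole face of [m] without fixed point, so the first tree has a single height on it as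
   well. *)
have cst z : z \in V -> ht al1 L1 z = ht al1 L1 (m b).
  rewrite -mb => zV; apply: (fcycle_const cV) => // x xV.
  have mx : al x = m x := step_new_mate em o u xV.
  have := oh_face h1 (full1 x); rewrite -mx => /(_ (step_new_inner em o u xV))[_ <-].
  by rewrite /face_step mx.
rewrite cst //.
have nS : ~~ S b.
  by apply/negP => /(Scut b bb); rewrite cutE ?eqxx //; exact: op_inv op.
have [f1|n1] := eqVneq (al1 b) b.
  have [_ _ -> _] := oh_bud h1 bb f1; lia.
have := r1 b bb n1 nS; rewrite /regular_edge; case: ifP => _; htlia.
Qed.

End Uniqueness.

(** * Exactly one opening for each reachable set of uncut edges *)

Section Existence.
Variables (T : finType) (sg : {perm T}) (blk : pred T) (rt : T).
Implicit Types (al m : {perm T}) (L : seq T) (S : pred T).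
Local Notation phi := (face_step sg).
Local Notation charge := (dart_charge blk).
Local Notation ht := (height blk).
Local Notation opens := (opening sg blk rt).
Local Notation reg_edge := (regular_edge blk).

Lemma fix_mate m al L y : edge_perm blk m -> opens m al L -> m y != y ->
  (al (m y) == m y) = (al y == y).
Proof.
move=> em o my; have [mK _ _] := em.
apply/eqP/eqP => [f|]; last exact: leaf_mate em o my.
by have := leaf_mate em o _ f; rewrite mK; apply; rewrite eq_sym.
Qed.

(** Suppose only the first tree cuts at position [i]. A white end has its bud earlier, in the common
    prefix. Across a black end the height drops by 1, which regularity in the second tree allows
    only if the other side comes earlier, again in the common prefix. *)
Lemma opens_first_cut m al1 L1 al2 L2 S i : edge_perm blk m ->
    opens m al1 L1 -> (forall y, y \in L1) ->
    opens m al2 L2 -> (forall y, y \in L2) -> ht al1 L1 =1 ht al2 L2 ->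
    (forall x, blk x -> S x -> al1 x != x) ->
    (forall x, blk x -> al2 x != x -> ~~ S x -> reg_edge m al2 L2 x) ->
    (forall j, (j < i)%N -> al1 (nth rt L1 j) = al2 (nth rt L2 j) /\ nth rt L1 j = nth rt L2 j) ->
    nth rt L1 i = nth rt L2 i -> (i < size L1)%N ->
    al1 (nth rt L1 i) = nth rt L1 i -> al2 (nth rt L2 i) = nth rt L2 i.
Proof.
move=> em o1 full1 o2 full2 eh S1 r2 agree e_i lt_i; rewrite -e_i; set x := nth rt L1 i => f1.
have [mK mb mw] := em; have op1 := opensP em o1; have op2 := opensP em o2.
have sz : size L1 = size L2.
  by apply/eqP; rewrite eq_sym -(uniq_size_uniq (op_uniq op1)) ?(op_uniq op2) // => y; rewrite full1 full2.
apply/eqP; apply: contraT => n2.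
have mx : m x != x.
  by apply: contra n2 => /eqP mx; case: (op_sub op2 x) => ->; rewrite ?mx.
have ix1 : index x L1 = i by rewrite index_uniq // (op_uniq op1).
have ix2 : index x L2 = i by rewrite /x e_i index_uniq ?(op_uniq op2) // -sz.
(* A mate in the common prefix is an end in the first tree, hence also in the second. *)
have early : (index (m x) L1 < i)%N \/ (index (m x) L2 < i)%N -> al2 x = x.
  move=> h; suff [j jlt ej] : exists2 j, (j < i)%N & nth rt L1 j = m x.
    have [e1 e2] := agree j jlt; move: e1; rewrite -e2 ej.
    have f1' : al1 (m x) == m x by rewrite (fix_mate em o1 mx) f1.
    rewrite (eqP f1') => e; apply/eqP; rewrite -(fix_mate em o2 mx); exact/eqP.
  case: h => h; [exists (index (m x) L1) | exists (index (m x) L2)] => //.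
    by rewrite nth_index.
  by have [_ ->] := agree _ h; rewrite nth_index.
have [bx|wx] := boolP (blk x); last first.
  have bm : blk (m x) by rewrite mb.
  have fm : al1 (m x) = m x by apply/eqP; rewrite (fix_mate em o1 mx) f1.
  have [_] := oh_bud (opens_htP em o1) bm fm; rewrite mK ix1 => h _ _.
  by rewrite early ?eqxx // in n2; left.
have nS : ~~ S x by apply/negP => /(S1 x bx); rewrite f1 eqxx.
have := r2 x bx n2 nS; rewrite /regular_edge ix2 -!eh.
have [_ _ -> _] := oh_bud (opens_htP em o1) bx f1.
case: ltnP => [_|]; first by htlia.
rewrite leq_eqVlt => /orP[/eqP e|h]; last by rewrite early ?eqxx // in n2; right.
have := nth_index rt (full2 (m x)); rewrite e -e_i => e2.
by rewrite -/x in e2; rewrite -e2 eqxx in mx.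
Qed.

(** Comparing heights both ways makes them equal. Both contours are then walked in parallel from the
    root, since the next dart depends only on whether the present one is cut. *)
Lemma opens_unique m al1 L1 al2 L2 S : edge_perm blk m ->
    opens m al1 L1 -> (forall y, y \in L1) ->
    opens m al2 L2 -> (forall y, y \in L2) ->
    (forall x, blk x -> S x -> al1 x != x) ->
    (forall x, blk x -> S x -> al2 x != x) ->
    (forall x, blk x -> al1 x != x -> ~~ S x -> reg_edge m al1 L1 x) ->
    (forall x, blk x -> al2 x != x -> ~~ S x -> reg_edge m al2 L2 x) ->
  al1 = al2.
Proof.
move=> em o1 full1 o2 full2 S1 S2 r1 r2.
have eh : ht al1 L1 =1 ht al2 L2.
  move=> y; apply/eqP; rewrite Order.POrderTheory.eq_le.
  by rewrite (opens_ht_le em o2 full2 r2 o1 S1 (full1 y)) (opens_ht_le em o1 full1 r1 o2 S2 (full2 y)).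
have op1 := opensP em o1; have op2 := opensP em o2.
have sz : size L1 = size L2.
  by apply/eqP; rewrite eq_sym -(uniq_size_uniq (op_uniq op1)) ?(op_uniq op2) // => y; rewrite full1 full2.
have ag i : (i < size L1)%N -> al1 (nth rt L1 i) = al2 (nth rt L2 i) /\ nth rt L1 i = nth rt L2 i.
  elim/ltn_ind: i => i IH lt_i.
  have e_i : nth rt L1 i = nth rt L2 i.
    case: i IH lt_i => [|i] IH lt_i.
      rewrite (fcycle_iter (op_cycle op1)) ?(op_root op1) ?(op_last op1) //.
      rewrite (fcycle_iter (op_cycle op2)) ?(op_root op2) ?(op_last op2) -?sz // /=.
      by rewrite /face_step (opens_root o1 em) (opens_root o2 em).
    rewrite (fcycle_nth _ (op_cycle op1)) // (fcycle_nth _ (op_cycle op2)) -?sz //.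
    by rewrite /face_step; have [-> _] := IH i (ltnSn i) (ltnW lt_i).
  split=> //.
  have ag' j : (j < i)%N -> al1 (nth rt L1 j) = al2 (nth rt L2 j) /\ nth rt L1 j = nth rt L2 j.
    by move=> ji; apply: IH => //; apply: ltn_trans lt_i.
  have h12 := opens_first_cut em o1 full1 o2 full2 eh S1 r2 ag' e_i lt_i.
  have h21 : al2 (nth rt L2 i) = nth rt L2 i -> al1 (nth rt L1 i) = nth rt L1 i.
    apply: (opens_first_cut em o2 full2 o1 full1 (fsym eh) S2 r1) => //; last by rewrite -sz.
    by move=> j /ag'[-> ->].
  case: (op_sub op1 (nth rt L1 i)) => e1; first by rewrite e1 h12.
  case: (op_sub op2 (nth rt L2 i)) => e2; first by rewrite e2 h21.
  by rewrite e1 e2 e_i.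
apply/permP => y.
have iy : (index y L1 < size L1)%N by rewrite index_mem full1.
by have := ag _ iy; rewrite nth_index // => -[-> <-].
Qed.

(* Only the first half of regularity is maintained; the second follows
   because the charges on the two sides of an edge are fixed modulo 3. *)
Definition weak_edge m al L x :=
  if (index x L < index (m x) L)%N then ht al L x <= ht al L (m x)
  else ht al L x - 3 <= ht al L (m x).

Definition avail m S L b := [&& b \in L, blk b, ~~ S b & m b \notin L].

(** [gr_after] and [gr_all] bound the contour from below by the edges still to be opened. They are
    what gives [gr_weak] for an edge leading from a newly inserted face back to the old contour. *)
Record greedy m S al L : Prop := Greedy {
  gr_cut : forall x, blk x -> S x -> al x != x;
  gr_weak : forall x, blk x -> al x != x -> ~~ S x -> x \in L -> m x \in L ->
    weak_edge m al L x;
  gr_after : forall b z, avail m S L b -> z \in L -> (index b L < index z L)%N ->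
    ht al L b - 1 <= ht al L z;
  gr_all : forall b z, avail m S L b -> z \in L -> ht al L b - 3 <= ht al L z }.

Lemma greedy_base m S L : edge_perm blk m -> opens m m L -> greedy m S m L.
Proof.
move=> em o; have [mK mb mw] := em.
have bnd y : y \in L -> 0 <= ht m L y <= 2.
  move=> yL; have op := opensP em o; apply: (ht0_le2 em yL (op_last op) (op_mroot op)).
  (* [OpensS] cannot end in [m] itself, as it makes a black dart fixed. *)
  inversion o as [|al A b B V o' bb alb cV lV u e1 e2] => //.
  rewrite e1 in o'; have alK := op_inv (opensP em o').
  have : m b = b by rewrite -[in LHS]e1 (cutE _ alK) eqxx.
  by move/mw; rewrite bb.
split.
- by move=> x bx _; apply: contraTneq bx => /mw.
- move=> x bx mx nS xL mxL; rewrite /weak_edge; case: ifP => h.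
    by apply: ht0_mono => //; exact: ltnW.
  by have := bnd _ xL; have := bnd _ mxL; htlia.
- move=> b z /and4P[bL _ _ _] zL h.
  by have := ht0_mono em (ltnW h); htlia.
- move=> b z /and4P[bL _ _ _] zL.
  by have := bnd _ bL; have := bnd _ zL; htlia.
Qed.

(** Highest first, leftmost among equals, is breadth-first search with the contour order as
    tie-break. Only an edge between the old contour and the new face is critical: from old to new
    the choice of [b] decides, from new to old the lower bounds of the invariant. *)
Lemma greedy_step m S al A b B V : edge_perm blk m -> opens m al (A ++ b :: B) ->
    greedy m S al (A ++ b :: B) -> avail m S (A ++ b :: B) b ->
    (forall c, avail m S (A ++ b :: B) c ->
       ht al (A ++ b :: B) c <= ht al (A ++ b :: B) b) ->
    (forall c, avail m S (A ++ b :: B) c ->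
       ht al (A ++ b :: B) c = ht al (A ++ b :: B) b ->
       (index b (A ++ b :: B) <= index c (A ++ b :: B))%N) ->
    al b != b -> fcycle (phi al) V -> last b V = al b -> uniq (A ++ b :: V ++ B) ->
  greedy m S (cut al b) (A ++ b :: V ++ B).
Proof.
move=> em o [gcut gweak gafter gall] av maxb minb alb cV lV u.
have [mK mblk mw] := em; have op := opensP em o.
have /and4P[bL bb nSb mbL] := av.
have hold := step_ht_old em o bb alb lV u.
have hnew := step_ht_new em o bb alb lV u.
have iold := index_insert_old u.
have inew := index_insert_new u.
have ib := index_insert_self u.
have mb := step_mate em o alb.
have ub := mem_insert A B V b.
have avail_old c : c \in A ++ b :: B -> avail m S (A ++ b :: V ++ B) c ->
    avail m S (A ++ b :: B) c.
  by move=> cL /and4P[_ bc nS]; rewrite ub negb_or => /andP[mc _]; rewrite /avail cL bc nS mc.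
split.
- move=> x bx Sx; rewrite cutE; last exact: op_inv op.
  case: ifP => [|_]; last exact: gcut.
  case/orP => /eqP e; first by rewrite -e Sx in nSb.
  by rewrite e (negPf (step_leaf_white em o bb alb)) in bx.
- move=> x bx; rewrite cutE; last exact: op_inv op.
  case: ifP => [_|nb nf nS]; first by rewrite eqxx.
  rewrite !ub /weak_edge => /orP[xL|xV] /orP[mL|mV].
  + have := gweak x bx nf nS xL mL; rewrite /weak_edge !hold //.
    congr (is_true (if _ then _ else _)).
    by rewrite !iold //; do 2!case: ifP; htlia.
  + have dV : m x \notin A ++ b :: B by have [_ _ dV] := uniq_insert u; exact: dV.
    have ax : avail m S (A ++ b :: B) x by rewrite /avail xL bx nS.
    have := maxb x ax; have := minb x ax; rewrite hold // hnew // iold // ib.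
    move: (inew _ mV) => im h1 h2; case: ifP => h3; last by htlia.
    (* At equal height [x] is not to the left of [b]; being to the left of the new stretch it would
       be [b], whose edge is now cut. *)
    suff: ht al (A ++ b :: B) x != ht al (A ++ b :: B) b by htlia.
    apply/eqP => /h1; move: h3; case: ifP => h4 h3 h5; last by htlia.
    have e : index x (A ++ b :: B) = index b (A ++ b :: B) by rewrite ib; htlia.
    move/(congr1 (nth rt (A ++ b :: B))): e; rewrite !nth_index // => e.
    by rewrite e eqxx in nb.
  + rewrite hnew // hold // (iold _ mL); move: (inew _ xV) => ix.
    case: ifP => h; last by have := gall b (m x) av mL; htlia.
    apply: (gafter b (m x) av mL); rewrite ib; move: h; case: ifP; htlia.
  + by rewrite !hnew //; case: ifP => _; htlia.
- move=> c z ac; rewrite ub => zL'; have /and4P[] := ac.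
  rewrite ub => /orP[cL _ _ _|cV' _ _ _].
    have ac' := avail_old c cL ac; case/orP: zL' => [zL|zV].
      rewrite !hold // !iold // => h; apply: gafter => //.
      by move: h; do 2!case: ifP; htlia.
    by move=> _; rewrite hold // hnew //; have := maxb c ac'; htlia.
  case/orP: zL' => [zL|zV]; last by move=> _; rewrite !hnew //; htlia.
  rewrite hnew // hold // (iold _ zL); have := inew c cV' => i1 i2.
  suff: ht al (A ++ b :: B) b - 1 <= ht al (A ++ b :: B) z by htlia.
  apply: gafter => //; rewrite ib; move: i2; case: ifP; htlia.
- move=> c z ac; rewrite ub => zL'; have /and4P[] := ac.
  rewrite ub => /orP[cL _ _ _|cV' _ _ _].
    have ac' := avail_old c cL ac; case/orP: zL' => [zL|zV]; first by rewrite !hold // gall.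
    by rewrite hold // hnew //; have := maxb c ac'; htlia.
  case/orP: zL' => [zL|zV]; last by rewrite !hnew //; htlia.
  by rewrite hnew // hold //; have := gall b z av zL; htlia.
Qed.

(* A dart stands for its orbit under [face_step m], that is, for a face. *)
Definition dual_step m S : rel T :=
  fun u v => (v == phi m u) || [&& blk u, ~~ S u & v == m u].

Lemma greedy_next m S al L b0 : edge_perm blk m -> opens m al L -> greedy m S al L ->
  avail m S L b0 ->
  exists al' L', [/\ opens m al' L', greedy m S al' L' & (size L < size L')%N].
Proof.
move=> em o g av0; have op := opensP em o; have [mK mb mw] := em.
pose b1 := [arg max_(b > b0 | avail m S L b) ht al L b]%O.
have [b1av b1max] : avail m S L b1 /\ forall c, avail m S L c -> ht al L c <= ht al L b1.
  by rewrite /b1; case: Order.TotalTheory.arg_maxP.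
pose P := [pred c | avail m S L c && (ht al L c == ht al L b1)].
have P1 : P b1 by rewrite /= b1av eqxx.
pose b := [arg min_(c < b1 | P c) index c L]%N.
have [bP bmin] : P b /\ forall c, P c -> (index b L <= index c L)%N.
  by rewrite /b; case: arg_minnP.
have /andP[bav /eqP hb] := bP.
have /and4P[bL bb nSb mbL] := bav.
(* Were [b] already a bud, its mate would lie on the contour. *)
have alb : al b != b.
  by apply: contra mbL => /eqP f; have [] := oh_bud (opens_htP em o) bb f.
have ab : al b = m b by case: (op_sub op b) => // e; rewrite e eqxx in alb.
(* Listed from [sg b], the face across the edge ends with [al b], as [OpensS] requires. *)
pose V := fingraph.orbit (phi al) (sg b).
have cV : fcycle (phi al) V by apply: cycle_orbit; exact: phi_inj.
have sV : sg b \in V by exact: in_orbit.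
have pb : phi al (al b) = sg b by rewrite /face_step (op_inv op).
have lV : last b V = al b.
  apply: (@phi_inj _ sg al); rewrite pb; move: cV.
  rewrite /V /fingraph.orbit; case: (fingraph.order _ _) (fingraph.order_gt0 (phi al) (sg b)) => //= n _.
  by rewrite rcons_path => /andP[_ /eqP].
have disj y : y \in V -> y \notin L.
  move=> yV; apply: contra mbL => yL; rewrite -ab -(fconnect_cycle (op_cycle op) yL).
  rewrite (fconnect_cycle cV yV) -lV; case: (V) sV => //= v s _; exact: mem_last.
have [A [B eL]] : exists A B, L = A ++ b :: B.
  by case/splitPr: bL => A B; exists A, B.
have u : uniq (A ++ b :: V ++ B).
  have : perm_eq (A ++ b :: V ++ B) (L ++ V).
    by rewrite eL -catA cat_cons perm_cat2l perm_cons perm_catC.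
  move=> /perm_uniq->; rewrite cat_uniq (op_uniq op) orbit_uniq andbT /=.
  by apply/hasPn => y /disj.
clearbody b; subst L.
exists (cut al b), (A ++ b :: V ++ B); split.
- exact: OpensS.
- apply: greedy_step => // c; first by move=> /b1max; rewrite hb.
  by move=> ac hc; apply: bmin; rewrite /= ac hc hb eqxx.
- rewrite !size_cat /= size_cat; suff: (0 < size V)%N by htlia.
  by case: (V) sV.
Qed.

Lemma opens_exists m L0 S : edge_perm blk m -> opens m m L0 ->
    (forall y, connect (dual_step m S) rt y) ->
  exists al L, [/\ opens m al L, forall y, y \in L,
    forall x, blk x -> S x -> al x != x
    & forall x, blk x -> al x != x -> ~~ S x -> weak_edge m al L x].
Proof.
move=> em o0 reach.
have [n le_n] := ubnP (#|T| - size L0).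
have [al [L [o g lt_n]]] : exists al L, [/\ opens m al L, greedy m S al L & (#|T| - size L < n)%N].
  by exists m, L0; split=> //; apply: greedy_base.
elim: n al L {le_n} o g lt_n => // n IH al L o g lt_n; have op := opensP em o.
have [b0 av0|noav] := pickP (avail m S L).
  have [al' [L' [o' g' sz]]] := greedy_next em o g av0.
  have : (size L' <= #|T|)%N by rewrite -(card_uniqP (op_uniq (opensP em o'))); exact: max_card.
  by move=> le; apply: (IH al' L') => //; htlia.
(* Without an available edge the contour is closed under dual steps, hence contains all that the
   root reaches. *)
have full y : y \in L.
  have /connectP[p] := reach y; elim: p rt (op_root op) => [|w p IHp] x xL /=.
    by move=> _ ->.
  move=> /andP[st pw]; apply: IHp => //; case/orP: st => [/eqP->|/and3P[bx nS /eqP->]].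
    have [mx|mx] := eqVneq (m x) x; last by have [] := oh_face (opens_htP em o) xL mx.
    have := fcycle_closed (op_cycle op) xL; rewrite /face_step mx.
    by case: (op_sub op x) => ->; rewrite ?mx.
  by have := noav x; rewrite /avail xL bx nS /= => /negbFE.
exists al, L; split=> //; first exact: gr_cut g.
by move=> x bx ax nS; apply: (gr_weak g).
Qed.

(** Each opened edge is itself a dual step off [S], so the history of the opening contains a path to
    every face. *)
Lemma opens_reach m al L S : edge_perm blk m -> opens m al L ->
    (forall x, blk x -> S x -> al x != x) ->
  {in L, forall y, connect (dual_step m S) rt y}.
Proof.
move=> em; elim=> {al L} [L uL cL rL lL mr fL c3 _|al A b B V o IH bb alb cV lV u Scut] y.
  rewrite -(fconnect_cycle cL rL); apply: connect_sub => x z /= /eqP <-.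
  by apply: connect1; rewrite /dual_step eqxx.
have op := opensP em o.
have {}IH : {in A ++ b :: B, forall y, connect (dual_step m S) rt y}.
  apply: IH => x bx Sx; have := Scut x bx Sx; rewrite cutE; last exact: op_inv op.
  by case: ifP; rewrite ?eqxx.
rewrite (mem_insert A B V b) => /orP[/IH//|yV].
have bL : b \in A ++ b :: B by rewrite mem_cat mem_head orbT.
apply: connect_trans (IH b bL) _.
have nS : ~~ S b.
  by apply/negP => /(Scut b bb); rewrite cutE ?eqxx //; exact: op_inv op.
have mb : al b = m b := step_mate em o alb.
apply: (connect_trans (connect1 (_ : dual_step m S b (m b)))).
  by rewrite /dual_step bb nS eqxx orbT.
have lVin := step_leaf_in alb lV; rewrite -mb.
have : fconnect (phi al) (al b) y by rewrite (fconnect_cycle cV).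
move=> /iter_findex <-; elim: (findex _ _ _) => //= n h; apply: connect_trans h (connect1 _).
have nV : iter n (phi al) (al b) \in V by rewrite -(fconnect_cycle cV lVin) fconnect_iter.
by rewrite /dual_step {1 3}/face_step (step_new_mate em o u nV) eqxx.
Qed.

End Existence.

(** * Forests and Euler's formula *)

Section Permutations.
Variable T : finType.
Implicit Types s : {perm T}.

Lemma porbit_fconnect s x y : (y \in porbit s x) = fconnect s x y.
Proof.
apply/porbitP/idP => [[i ->]|/iter_findex <-]; first by rewrite permX fconnect_iter.
by exists (findex s x y); rewrite permX.
Qed.

Lemma porbit_closed s (P : pred T) x y :
  (forall z, P z -> P (s z)) -> P x -> y \in porbit s x -> P y.
Proof.
move=> sP Px /porbitP[i ->]; rewrite permX.
by elim: i => //= i; exact: sP.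
Qed.

Lemma porbit_trans s x y z : y \in porbit s x -> z \in porbit s y -> z \in porbit s x.
Proof. by rewrite -!eq_porbit_mem => /eqP-> /eqP->. Qed.

Lemma card_porbits_transitive s : (forall x y, y \in porbit s x) -> (#|porbits s| <= 1)%N.
Proof.
move=> tr; apply/card_le1P => A /imsetP[x _ ->] B.
apply/imsetP/eqP => [[y _ ->]|->]; last by exists x.
by apply/esym/eqP; rewrite eq_porbit_mem porbit_sym.
Qed.

Lemma card_porbits_gt0 s (x : T) : (0 < #|porbits s|)%N.
Proof. by apply/card_gt0P; exists (porbit s x); apply: imset_f. Qed.

Lemma card_porbits1 s : #|porbits s| = 1%N -> forall x y, y \in porbit s x.
Proof.
move=> /eqP/cards1P[A eA] x y.
have : porbit s x \in porbits s by apply: imset_f.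
have : porbit s y \in porbits s by apply: imset_f.
rewrite eA !inE => /eqP ey /eqP ex.
by rewrite ex -ey porbit_id.
Qed.

End Permutations.

Section Graphs.
Variables (T : finType) (sg : {perm T}) (blk : pred T).
Implicit Types al : {perm T}.

Definition gstep al : rel T := fun y z => (z == sg y) || (z == al y).

(** In a bipartite graph each edge has one black dart; buds are excluded because they are not
    edges. *)
Definition nedges al : nat := #|[set x | (al x != x) && blk x]|.

Definition bipartite al := forall x, al x != x -> blk (al x) = ~~ blk x.

Definition forest al :=
  forall x, al x != x -> ~~ connect (gstep (cut al x)) x (al x).

Lemma gconnect_sub al1 al2 : (forall w, al1 w = w \/ al1 w = al2 w) ->
  subrel (connect (gstep al1)) (connect (gstep al2)).
Proof.
move=> h; apply: connect_sub => y z /orP[/eqP->|/eqP->].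
  by apply: connect1; rewrite /gstep eqxx.
by case: (h y) => ->; [exact: connect0 | apply: connect1; rewrite /gstep eqxx orbT].
Qed.

Lemma gconnect_sym al : involutive al -> connect_sym (gstep al).
Proof.
move=> alK; apply: symmetric_from_pre => y z.
have inv u v : gstep al u v -> connect (gstep al) v u.
  case/orP => /eqP ->; last by apply: connect1; rewrite /gstep alK eqxx orbT.
  have : fconnect sg (sg u) u by rewrite fconnect_sym ?fconnect1 //; exact: perm_inj.
  by apply: connect_sub => a b /= /eqP <-; apply: connect1; rewrite /gstep eqxx.
move=> /connectP[p]; elim: p y => [|w p IH] y /=; first by move=> _ ->.
by move=> /andP[yw pw] ez; apply: connect_trans (IH w pw ez) (inv _ _ yw).
Qed.

Lemma porbit_gconnect al y z : z \in porbit (al * sg)%g y -> connect (gstep al) y z.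
Proof.
move=> h; apply: (porbit_closed (P := connect (gstep al) y)) h => // w h.
rewrite permM; apply: connect_trans h _.
apply: (@connect_trans _ _ (al w)); apply: connect1; rewrite /gstep eqxx ?orbT //.
Qed.

Lemma cut_sub al x : involutive al -> forall w, cut al x w = w \/ cut al x w = al w.
Proof. by move=> alK w; rewrite cutE //; case: ifP; [left | right]. Qed.

Lemma cut_bipartite al x : involutive al -> bipartite al -> bipartite (cut al x).
Proof. by move=> alK bip y; case: (cut_sub x alK y) => ->; [rewrite eqxx | exact: bip]. Qed.

Lemma nedges_cut al x : involutive al -> bipartite al -> al x != x ->
  (nedges (cut al x)).+1 = nedges al.
Proof.
move=> alK bip ax; pose z := if blk x then x else al x.
rewrite /nedges (cardsD1 z [set y | (al y != y) && blk y]).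
have -> : z \in [set y | (al y != y) && blk y].
  rewrite inE /z; case: ifP => bx; first by rewrite ax bx.
  by rewrite alK eq_sym ax bip // bx.
rewrite add1n; congr _.+1; apply: eq_card => y; rewrite !inE cutE //.
case: (eqVneq y x) => [->|yx] /=.
  by rewrite eqxx ax /= /z; case: ifP => bx; rewrite ?eqxx ?andbF.
case: (eqVneq y (al x)) => [->|yax].
  rewrite eqxx alK [x == _]eq_sym ax /= /z bip //; case: ifP => bx; first by rewrite andbF.
  by rewrite eqxx.
by rewrite /z; case: ifP; rewrite ?yx ?yax.
Qed.

Lemma nedges0 al : involutive al -> bipartite al -> nedges al = 0%N -> al = 1%g.
Proof.
move=> alK bip /eqP; rewrite cards_eq0 => /eqP e; apply/permP => x; rewrite perm1.
apply/eqP; apply: contraT => ax; have [bx|wx] := boolP (blk x).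
  have : x \in [set x | (al x != x) && blk x] by rewrite inE ax.
  by rewrite e inE.
have : al x \in [set x | (al x != x) && blk x] by rewrite inE alK eq_sym ax bip.
by rewrite e inE.
Qed.

(** Degree-one ends are not vertices here, so a tree has one face and one vertex more than edges,
    and this is added up over the components. The second part says that a component has a single
    face. Both go by induction on the edges. *)
Lemma forest_count al : involutive al -> bipartite al -> forest al ->
  #|porbits sg| = (#|porbits (al * sg)%g| + nedges al)%N
  /\ forall y z, gstep al y z -> z \in porbit (al * sg)%g y.
Proof.
have [n] := ubnP (nedges al); elim: n al => // n IH al lt_n alK bip fo.
have [e0|] := posnP (nedges al).
  rewrite e0 (nedges0 alK bip e0) mul1g addn0; split=> // y z.
  rewrite /gstep perm1 => /orP[/eqP->|/eqP->]; last exact: porbit_id.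
  exact: (mem_porbit sg 1 y).
case/card_gt0P => x; rewrite inE => /andP[ax bx].
have nE := nedges_cut alK bip ax.
have [] := IH (cut al x); first by move: lt_n; rewrite -nE ltnS.
- exact: cut_involutive.
- exact: cut_bipartite.
- move=> y ay; have cK := cut_involutive x alK.
  have ey : cut al x y = al y by case: (cut_sub x alK y) ay => ->; rewrite ?eqxx.
  rewrite ey in ay *; apply: contra (fo y ay); apply: gconnect_sub => w.
  rewrite (cutE y cK) ey (cutE y alK); case: ifP => _; [by left | exact: cut_sub].
set phi := (al * sg)%g; have -> : (cut al x * sg)%g = (tperm x (al x) * phi)%g.
  by rewrite /cut mulgA.
set phi' := (tperm x (al x) * phi)%g => cnt st.
(* The ends of the removed edge lie in different components, hence on different faces, which putting
   it back merges. *)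
have xN : x \notin porbit phi' (al x).
  rewrite porbit_sym; apply: contra (fo x ax) => h; apply: porbit_gconnect.
  by rewrite /cut -mulgA.
have c1 := porbits_mul_tperm phi' x (al x); rewrite /= xN eq_sym ax in c1.
have tt : (tperm x (al x) * phi')%g = phi by rewrite /phi' mulgA tperm2 mul1g.
rewrite tt in c1.
have xin : x \in porbit phi (al x).
  apply: contraT => h; have := porbits_mul_tperm phi x (al x).
  by rewrite /= h eq_sym ax -/phi' /=; move: c1 => /=; lia.
split; first by rewrite cnt -nE; move: c1 => /=; lia.
have sub y z : z \in porbit phi' y -> z \in porbit phi y.
  move=> h; apply: (porbit_closed (P := [pred z | z \in porbit phi y])) h.
    move=> w /= h; have -> : phi' w = phi (tperm x (al x) w) by rewrite permM.
    apply: porbit_trans (mem_porbit phi 1 _).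
    by case: tpermP => [e|e|] //; apply: porbit_trans h _; rewrite e // porbit_sym.
  exact: porbit_id.
move=> y z /orP[/eqP->|/eqP->]; first by apply: sub; apply: st; rewrite /gstep eqxx.
have [->|yx] := eqVneq y x; first by rewrite porbit_sym.
have [->|yax] := eqVneq y (al x); first by rewrite alK.
apply: sub; apply: st; rewrite /gstep cutE // (negPf yx) (negPf yax) eqxx orbT //.
Qed.

Definition gconnected al := forall y z, connect (gstep al) y z.

Lemma cut_connected al x : involutive al -> gconnected al ->
  connect (gstep (cut al x)) x (al x) -> gconnected (cut al x).
Proof.
move=> alK co h y z; have := co y z; apply: connect_sub => {y z} y z.
case/orP => /eqP->; first by apply: connect1; rewrite /gstep eqxx.
have [->//|yx] := eqVneq y x.
have [->|yax] := eqVneq y (al x).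
  by rewrite alK gconnect_sym //; exact: cut_involutive.
by apply: connect1; rewrite /gstep cutE // (negPf yx) (negPf yax) eqxx orbT.
Qed.

Lemma forest_transitive al : involutive al -> bipartite al -> forest al ->
  gconnected al -> forall y z, z \in porbit (al * sg)%g y.
Proof.
move=> alK bip fo co y z; have [_ st] := forest_count alK bip fo.
have /connectP[p] := co y z; elim: p y => [|w p IH] y /=; first by move=> _ ->; exact: porbit_id.
by move=> /andP[/st yw pw] ez; apply: porbit_trans yw (IH _ pw ez).
Qed.

(** Edges on cycles are deleted until a forest is left. Each deletion loses at most one face, and
    the connected forest has at most one. *)
Lemma euler_le al : involutive al -> bipartite al -> gconnected al ->
  (#|porbits sg| + #|porbits (al * sg)%g| <= nedges al + 2)%N.
Proof.
have [n] := ubnP (nedges al); elim: n al => // n IH al lt_n alK bip co.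
have [x /andP[ax cx]|nf] := pickP (fun x => (al x != x) && connect (gstep (cut al x)) x (al x)).
  have nE := nedges_cut alK bip ax.
  have cK := cut_involutive x alK; have cb := cut_bipartite (x := x) alK bip.
  have := IH (cut al x); rewrite -ltnS nE => /(_ lt_n cK cb (cut_connected alK co cx)).
  have := porbits_mul_tperm (al * sg)%g x (al x); rewrite /= eq_sym ax mulgA -/(cut al x).
  rewrite -nE; move: #|porbits (al * sg)%g| #|porbits (cut al x * sg)%g| #|porbits sg| => a b c.
  by case: (_ \in _) => /=; lia.
have fo : forest al by move=> x ax; have := nf x; rewrite ax /= => ->.
have [-> _] := forest_count alK bip fo.
have := card_porbits_transitive (forest_transitive alK bip fo co).
by lia.
Qed.

(** Deleting an edge on a cycle would keep the graph connected and violate the Euler bound by one;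
    [r] provides a face. *)
Lemma euler_forest al (r : T) : involutive al -> bipartite al -> gconnected al ->
  (#|porbits sg| = nedges al + 1)%N -> forest al.
Proof.
move=> alK bip co cnt x ax; apply/negP => cx.
have nE := nedges_cut alK bip ax.
have := euler_le (cut_involutive x alK) (cut_bipartite (x := x) alK bip) (cut_connected alK co cx).
have := card_porbits_gt0 (cut al x * sg)%g r; lia.
Qed.

(** Each opening removes one edge and merges the two faces beside it. *)
Lemma opens_euler rt m al L : edge_perm blk m -> opening sg blk rt m al L ->
  (#|porbits (m * sg)%g| + nedges al = #|porbits (al * sg)%g| + nedges m)%N.
Proof.
move=> em; have [mK mb mw] := em.
elim=> {al L} [//|al A b B V o IH bb alb cV lV u].
have op := opensP em o; have alK := op_inv op.
have bip : bipartite al by move=> x; case: (op_sub op x) => ->; [rewrite eqxx | exact: mb].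
have nE := nedges_cut alK bip alb.
have := porbits_mul_tperm (al * sg)%g b (al b); rewrite /= eq_sym alb mulgA -/(cut al b).
suff -> : b \notin porbit (al * sg)%g (al b).
  move: IH; rewrite -nE.
  move: #|porbits (al * sg)%g| #|porbits (cut al b * sg)%g| #|porbits (m * sg)%g| => i j k.
  by rewrite /=; lia.
rewrite porbit_sym porbit_fconnect.
have -> : fconnect (al * sg)%g b (al b) = fconnect (face_step sg al) b (al b).
  by apply: eq_fconnect => z; rewrite permM.
rewrite (fconnect_cycle (op_cycle op)); last by rewrite mem_cat mem_head orbT.
by have [_ _ dV] := uniq_insert u; apply: dV; exact: step_leaf_in.
Qed.

End Graphs.

(** * The closing procedure *)

Section Words.
Variables (T : eqType).
Implicit Types (s w : seq T) (e : rel T).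

Lemma path_zip e x s z :
  path e x (rcons s z) = all (fun p => e p.1 p.2) (zip (x :: s) (rcons s z)).
Proof. by elim: s x => [|y s IH] x //=; rewrite IH. Qed.

Lemma cycle_zip e s : path.cycle e s = all (fun p => e p.1 p.2) (zip s (rot 1 s)).
Proof. by case: s => // x s; rewrite rot1_cons -path_zip. Qed.

Lemma cycle_trans_all e s : transitive e -> path.cycle e s ->
  {in s &, forall x y, e x y \/ x = y}.
Proof.
move=> tr cy x y xs ys; have [i s' e_s] := rot_to xs.
move: cy ys; rewrite -(rot_cycle i) -(mem_rot i) e_s /= => pth.
rewrite inE => /orP[/eqP->|ys]; first by right.
left; have /allP := order_path_min tr pth; apply.
by rewrite mem_rcons inE ys orbT.
Qed.

Lemma rot_head2 (P : rel T) s b l r : let i := find (fun p => P p.1 p.2) (zip s (rot 1 s)) in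
  (i < size s)%N -> rot i s = b :: l :: r -> P b l.
Proof.
move=> i lt_i e_s; have sz : size (zip s (rot 1 s)) = size s by rewrite size_zip size_rot minnn.
have : has (fun p => P p.1 p.2) (zip s (rot 1 s)) by rewrite has_find sz.
move=> /(nth_find (b, b)); rewrite -/i.
rewrite nth_zip ?size_rot //=.
have nth_i (t : seq T) : size t = size s -> nth b t i = nth b (rot i t) 0.
  by move=> st; rewrite /rot nth_cat size_drop st subn_gt0 lt_i nth_drop addn0.
by rewrite !nth_i ?size_rot // rot_rot e_s rot1_cons.
Qed.

(** The cyclic pair does not straddle the end of the word: the last letter is the root leaf, and [b]
    is not. *)
Lemma rot_linear w j b l r rt : rot j w = b :: l :: r -> rt \in w -> last rt w = rt ->
  b != rt -> exists A B, w = A ++ b :: l :: B /\ r = B ++ A.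
Proof.
move=> e_w rw lw brt; have [lt_j|le_j] := ltnP j (size w); last first.
  rewrite rot_oversize // in e_w.
  by exists [::], r; rewrite cats0 e_w.
have e1 := cat_take_drop j w; have sz := size_drop j w.
have : rot j w = drop j w ++ take j w by [].
move: e1 sz; case: (drop j w) => [|c [|d B]] e1 sz.
- by move: sz => /= sz; move: lt_j; rewrite -subn_gt0 -sz.
- rewrite e_w => -[ebc _]; move: brt; rewrite ebc -[in last _ _ = _]e1 in lw *.
  by rewrite -lw last_cat eqxx.
rewrite e_w => -[eb el er]; exists (take j w), B; rewrite eb el {1}e1; split => //.
Qed.

Lemma rot_rot_ex w i k : exists j, rot i (rot k w) = rot j w.
Proof.
have [lei|/ltnW gti] := leqP i (size w); last first.
  by exists k; rewrite rot_oversize // size_rot.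
have [lek|/ltnW gtk] := leqP k (size w); last first.
  by exists i; rewrite [rot k w]rot_oversize.
by rewrite rot_add_mod //; eexists.
Qed.

Lemma take_index_filter (p : pred T) s y : p y ->
  take (index y (filter p s)) (filter p s) = filter p (take (index y s) s).
Proof.
move=> py; elim: s => //= x s IH; case: (eqVneq x y) => [->|xy].
  by rewrite py /= eqxx.
by rewrite /=; case: ifP => px //=; rewrite (negPf xy) /= IH.
Qed.

(** Lifts a pair adjacent in the word of ends to the contour, where only inner darts lie in
    between. *)
Lemma filter_split (p : pred T) s A b l B : filter p s = A ++ b :: l :: B ->
  exists A' V B', [/\ s = A' ++ b :: rcons V l ++ B', filter p A' = A,
                     filter p B' = B & {in V, forall y, ~~ p y}].
Proof.
have split1 (u : seq T) A1 c B1 : filter p u = A1 ++ c :: B1 ->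
    exists A' B', [/\ u = A' ++ c :: B', filter p A' = A1 & filter p B' = B1].
  elim: u A1 => [|x u IH] [|a A1] //=; case: ifP => px //.
  - by move=> [<- <-]; exists [::], u.
  - by move=> /(IH [::])[A' [B' [-> fA fB]]]; exists (x :: A'), B'; rewrite /= px fA.
  - by move=> [<- /IH[A' [B' [-> fA fB]]]]; exists (x :: A'), B'; rewrite /= px fA.
  - by move=> /(IH (a :: A1))[A' [B' [-> fA fB]]]; exists (x :: A'), B'; rewrite /= px fA.
move=> /split1[A' [B1 [-> fA /(split1 _ [::])[V [B' [-> fV fB]]]]]].
exists A', V, B'; split=> //; first by rewrite cat_rcons.
move=> y yV; apply/negP => py.
have : y \in filter p V by rewrite mem_filter py.
by rewrite fV.
Qed.

End Words.

Section Closing.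
Variables (T : finType) (X : dstruct T).
Let bud := isBud X.
Let leaf := isLeaf X.
Local Notation close := (close_aux bud leaf).
Local Notation phi := (face_step (sg X)).
Local Notation charge := (dart_charge (blk X)).
Local Notation ht := (height (blk X)).

Lemma close_sub n s : {subset (close n s).2 <= s}.
Proof.
elim: n s => [|n IH] s //=; case: ifP => _; last by move=> y.
set i := find _ _; case e_s: (rot i s) => [|b [|l r]] /= y //; move=> /IH yr.
by rewrite -(mem_rot i) e_s !inE yr !orbT.
Qed.

(** If a bud stood immediately before the final root leaf, the height before that bud would be the
    total 3, above the bound 2. Matching any other adjacent pair preserves the hypotheses. *)
Lemma root_unmatched n w k rt : uniq w -> rt \in w -> last rt w = rt -> leaf rt ->
    {in w, forall y, al X y = y} ->
    \sum_(y <- w) charge (al X) y = 3 ->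
    {in w, forall y, \sum_(z <- take (index y w) w) charge (al X) z <= 2} ->
  rt \in (close n (rot k w)).2.
Proof.
elim: n w k => [|n IH] w k uw rw lw leaf_rt fw sw hw /=; first by rewrite mem_rot.
case: ifP => lt_i /=; last by rewrite mem_rot.
set i := find _ _; case e_s: (rot i (rot k w)) => [|b [|l r]] /=; rewrite ?mem_rot //.
have /andP[bb ll] := @rot_head2 _ (fun x y => bud x && leaf y) _ _ _ _ lt_i e_s.
have brt : b != rt.
  by apply: contraTneq bb => ->; rewrite /bud /isBud; case/andP: leaf_rt => -> /negPf->.
have [j e_j] := rot_rot_ex w i k; rewrite e_j in e_s.
have [A [B [ew er]]] := rot_linear e_s rw lw brt.
have cb : charge (al X) b = -1 by case/andP: bb => f b'; rewrite /dart_charge f b'.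
have closed_map : charge (al X) l = 1 by case/andP: ll => f /negPf b'; rewrite /dart_charge f b'.
have lrt : l != rt.
  apply/eqP => lrt; move: uw lw sw hw; rewrite ew lrt => uw lw sw hw.
  have B0 : B = [::].
    case: B uw lw {ew er sw hw} => // c B; rewrite cat_uniq /= last_cat /= => uw lw.
    move: uw => /and3P[_ _ /and3P[_ + _]]; rewrite -{1}lw.
    by rewrite mem_last.
  move: sw; rewrite big_cat /= 2!big_cons cb -lrt closed_map B0 big_nil.
  have /= := hw b; rewrite mem_cat mem_head orbT index_cat => /(_ isT).
  have -> : b \in A = false.
    by move: uw; rewrite cat_uniq /= => /and3P[_]; rewrite negb_or => /andP[/negPf].
  by rewrite /= eqxx addn0 take_size_cat //; move: (\sum_(_ <- A) _) => q; lia.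
rewrite er -rot_size_cat; apply: IH => //.
- apply: subseq_uniq uw; rewrite ew; apply: cat_subseq => //.
  exact: (suffix_subseq [:: b; l] B).
- by move: rw; rewrite ew !mem_cat !inE eq_sym (negPf brt) eq_sym (negPf lrt).
- move: lw; rewrite ew !last_cat /=; case: B {ew er} => //= e.
  by rewrite e eqxx in lrt.
- by move=> y yI; apply: fw; rewrite ew; move: yI; rewrite !mem_cat !inE => /orP[]->; rewrite ?orbT.
- by move: sw; rewrite ew !big_cat /= !big_cons cb closed_map addNKr.
- move=> y yI; have yw : y \in w by rewrite ew; move: yI; rewrite !mem_cat !inE => /orP[]->; rewrite ?orbT.
  have := hw y yw; rewrite ew !index_cat; case: ifP => yA.
    have iA : (index y A < size A)%N by rewrite index_mem.
    by rewrite !takel_cat //; exact: ltnW.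
  have yB : y \in B by move: yI; rewrite mem_cat yA.
  have yb : (b == y) = false /\ (l == y) = false.
    move: uw; rewrite ew cat_uniq => /and3P[_ _ /= /and3P[+ lB _]].
    rewrite inE negb_or => /andP[_ bB].
    by split; apply: contraTF yB => /eqP <-.
  rewrite /= yb.1 yb.2 !take_cat !ltnNge !leq_addr /= !addKn /= !big_cat /= !big_cons.
  by rewrite cb closed_map addNKr.
Qed.

Definition join_pair (al : {perm T}) (p : T * T) : {perm T} := (tperm p.1 p.2 * al)%g.

(** The closing procedure read backwards. Joining the first matched pair gives an involution whose
    contour lacks the stretch from behind the bud to the leaf, and undoing this is one [OpensS].
    Here [al] varies along the induction while charges remain those of [X]. A match consumes two
    letters, so fuel equal to the length suffices. *)
Lemma close_opens n (al : {perm T}) L k rt : involutive al -> (forall y, al y != y -> blk X (al y) = ~~ blk X y) ->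
    (forall y, al y = y -> Defs.al X y = y) ->
    uniq L -> fcycle (phi al) L -> rt \in L -> last rt L = rt -> al rt = rt -> ~~ blk X rt ->
    (forall y, al y = y -> y \in L) ->
    let s := rot k (filter (fun y => al y == y) L) in
    (size s <= n)%N -> \sum_(y <- s) charge (Defs.al X) y = 3 -> rt \in (close n s).2 ->
  let m := foldl join_pair al (close n s).1 in
  [/\ edge_perm (blk X) m, opening (sg X) (blk X) rt m al L,
      forall p, p \in (close n s).1 -> m p.1 = p.2 /\ blk X p.1
    & forall y, blk X y -> al y = y -> exists2 p, p \in (close n s).1 & p.1 = y].
Proof.
elim: n al L k => [|n IH] al L k alK bip fixX uL cL rL lL fr wr fL s.
  rewrite leqn0 size_eq0 => /eqP s0 _.
  have : rt \in s by rewrite mem_rot mem_filter fr eqxx.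
  by rewrite s0.
move=> sz sum /=.
have us : uniq s by rewrite rot_uniq filter_uniq.
have rs : rt \in s by rewrite mem_rot mem_filter fr eqxx.
have sfix y : y \in s -> Defs.al X y = y.
  by rewrite mem_rot mem_filter => /andP[/eqP/fixX].
have sal y : y \in s -> al y = y by rewrite mem_rot mem_filter => /andP[/eqP].
set i := find _ _; have [lt_i|ge_i] := ltnP i (size s); last first.
  move=> _ /=.
  (* When no bud is followed by a leaf, black propagates around the cyclic word; the white root leaf
     then excludes all buds. *)
  have nb y : y \in s -> ~~ blk X y.
    have cy : path.cycle (fun x y => blk X x ==> blk X y) s.
      rewrite cycle_zip; apply/allP => p pz /=.
      have /hasPn /(_ p pz) /= : ~~ has (fun p => bud p.1 && leaf p.2) (zip s (rot 1 s)).
        by rewrite has_find -leqNgt size_zip size_rot minnn.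
      have ps : (p.1 \in s) && (p.2 \in s).
        have := map_f fst pz; have := map_f snd pz.
        by rewrite -/unzip1 -/unzip2 unzip1_zip ?unzip2_zip ?size_rot // mem_rot => -> ->.
      case/andP: ps => /sfix f1 /sfix f2.
      by rewrite /bud /leaf /isBud /isLeaf f1 f2 !eqxx /=; case: (blk X p.1); case: (blk X p.2).
    move=> ys; apply/negP => by_.
    have tr : transitive (fun x y => blk X x ==> blk X y).
      by move=> a b c /implyP h1 /implyP h2; apply/implyP => /h1/h2.
    have [/implyP/(_ by_) h|e] := cycle_trans_all tr cy ys rs; first by rewrite h in wr.
    by rewrite e (negPf wr) in by_.
  have em : edge_perm (blk X) al.
    split=> // x fx; apply: nb; rewrite mem_rot mem_filter fx eqxx; exact: fL.
  split=> //; last by move=> y by_ fy; rewrite (negPf (nb y _)) // mem_rot mem_filter fy eqxx fL in by_.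
  apply: Opens0 => //.
  have -> : count (fun x => al x == x) L = size s by rewrite size_rot size_filter.
  suff : (size s)%:Z = 3 by move=> [].
  rewrite -sum (eq_big_seq (fun=> 1)); first by elim: (s) => [|x u IHu]; rewrite ?big_nil // big_cons -IHu.
  by move=> y ys; rewrite /dart_charge (sfix y ys) eqxx (negPf (nb y ys)).
case e_s: (rot i s) => [|b [|l r]].
- by move: lt_i; rewrite -(size_rot i) e_s.
- move: sum; have ps : perm_eq s [:: b] by rewrite -e_s perm_sym perm_rot.
  rewrite (perm_big _ ps) big_seq1 /dart_charge.
  by case: ifP; [case: ifP|].
have /andP[bb ll] := @rot_head2 _ (fun x y => bud x && leaf y) _ _ _ _ lt_i e_s.
have bl_s : (b \in s) && (l \in s) by rewrite -!(mem_rot i s) e_s !inE !eqxx orbT.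
move=> /= rres; have rr := close_sub rres.
have := us; rewrite -(rot_uniq i) e_s => /= /and3P[+ lr ur].
rewrite inE negb_or => /andP[bl br].
have brt : b != rt by apply: contraNneq br => ->.
have lrt : l != rt by apply: contraNneq lr => ->.
have /andP[/sal fb /sal fl] := bl_s.
pose al0 := join_pair al (b, l).
have [j e_j] := rot_rot_ex (filter (fun y => al y == y) L) i k; rewrite e_j in e_s.
have rw : rt \in filter (fun y => al y == y) L by rewrite mem_filter fr eqxx.
have lw : last rt (filter (fun y => al y == y) L) = rt.
  case/lastP: (L) rL lL => // L' z _; rewrite last_rcons => ->.
  by rewrite filter_rcons fr eqxx last_rcons.
have [A [B [ew er]]] := rot_linear e_s rw lw brt.
have [A' [V [B' [eL fA fB nV]]]] := filter_split ew.
have al0E y : al0 y = if y == b then l else if y == l then b else al y.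
  rewrite /al0 /join_pair permM /=; case: tpermP => [->|->|/eqP/negPf-> /eqP/negPf->] //.
    by rewrite eqxx fl.
  by rewrite [l == b]eq_sym (negPf bl) eqxx fb.
have al0K : involutive al0.
  move=> y; rewrite [al0 y]al0E; case: (eqVneq y b) => [->|yb].
    by rewrite al0E [l == b]eq_sym (negPf bl) eqxx.
  case: (eqVneq y l) => [->|yl]; first by rewrite al0E eqxx.
  rewrite al0E -{1}fb -{2}fl !(inj_eq perm_inj) (negPf yb) (negPf yl); exact: alK.
have cut0 : cut al0 b = al.
  by rewrite /cut al0E eqxx /al0 /join_pair mulgA tperm2 mul1g.
have lV : last b (rcons V l) = al0 b by rewrite last_rcons al0E eqxx.
have al0b : al0 b != b by rewrite al0E eqxx eq_sym.
rewrite eL in uL cL rL lL fL.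
have := fcycle_cut (sg X) al0K al0b lV uL; rewrite cut0 cL => /esym/andP[cL0 cV].
have [uL0 uV dV] := uniq_insert uL.
have bA : b \notin A' ++ B'.
  have := uL0; rewrite -cat1s uniq_catCA /= => /andP[]//.
have lN : l \notin A' ++ b :: B' by apply: dV; rewrite mem_rcons mem_head.
have lA : l \notin A' ++ B' by move: lN; rewrite !mem_cat inE !negb_or => /and3P[-> _ ->].
have inL0 y : y \in A' ++ B' -> y \in A' ++ b :: B'.
  by rewrite !mem_cat inE => /orP[]->; rewrite ?orbT.
have fix0 y : (al0 y == y) = [&& y != b, y != l & al y == y].
  rewrite al0E; case: (eqVneq y b) => [->|yb] /=; first by rewrite eq_sym (negPf bl).
  by case: (eqVneq y l) => [->|yl] //=; rewrite (negPf bl).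
have eF : filter (fun y => al0 y == y) (A' ++ b :: B') = A ++ B.
  rewrite filter_cat /= fix0 eqxx /= -fA -fB; congr (_ ++ _); apply: eq_in_filter => y yI.
    by rewrite fix0 (memPn bA) ?(memPn lA) // mem_cat yI.
  by rewrite fix0 (memPn bA) ?(memPn lA) // mem_cat yI orbT.
have B'0 : B' != [::].
  by apply: contra lrt => /eqP e; move: lL; rewrite e cats0 last_cat /= last_rcons => ->.
have cs : perm_eq s [:: b, l & A ++ B].
  rewrite -(perm_rot i) e_j e_s er !perm_cons; exact: permEl (perm_catC _ _).
have {IH} := IH al0 (A' ++ b :: B') (size A) al0K.
rewrite eF rot_size_cat -er; case=> //.
- move=> y; rewrite al0E; case: (eqVneq y b) => [-> _|yb].
    by case/andP: bb => _ ->; case/andP: ll => _ /negPf.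
  by case: (eqVneq y l) => [-> _|yl /bip//]; case/andP: bb => _ ->; case/andP: ll => _ /negPf->.
- by move=> y /eqP; rewrite fix0 => /and3P[_ _ /eqP/fixX].
- by move: rL; rewrite (mem_insert A' B' (rcons V l) b) mem_rcons inE eq_sym (negPf lrt) /=;
    case/orP=> // /nV; rewrite fr eqxx.
- by move: lL; rewrite !last_cat /= last_cat; case: (B') B'0 => [|c B'']; rewrite ?eqxx.
- by apply/eqP; rewrite fix0 fr eqxx eq_sym brt eq_sym lrt.
- move=> y /eqP; rewrite fix0 => /and3P[yb yl /eqP fy].
  have := fL y fy; rewrite (mem_insert A' B' (rcons V l) b) mem_rcons inE (negPf yl) /=.
  by case/orP=> // /nV; rewrite fy eqxx.
- by move: sz; rewrite (perm_size cs) er /= !size_cat; seqlia.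
- move: sum; rewrite (perm_big _ cs) !big_cons er !big_cat /= /dart_charge.
  case/andP: bb => -> ->; case/andP: ll => -> /negPf->.
  by rewrite addNKr addrC.
rewrite -/(close_aux bud leaf n r) => em o prs bds; split=> //.
- have blb : blk X b by case/andP: bb.
  by have := OpensS o blb al0b cV lV uL; rewrite cut0 -eL.
- move=> p; rewrite inE => /orP[/eqP->|]; last exact: prs.
  split; last by case/andP: bb.
  case: (op_sub (opensP em o) b) => [e|<-]; first by rewrite e eqxx in al0b.
  by rewrite al0E eqxx.
- move=> y by_ fy; have [->|yb] := eqVneq y b; first by exists (b, l); rewrite ?mem_head.
  have yl : y != l by apply: contraTneq by_ => ->; case/andP: ll.
  have /eqP f0 : al0 y == y by rewrite fix0 yb yl fy eqxx.
  by have [p pI ep] := bds y by_ f0; exists p => //; rewrite inE pI orbT.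
Qed.

End Closing.

(** * Sums over whole cubic vertices modulo 3 *)

Section CubicSums.
Variables (T : finType) (sg : {perm T}).
Hypotheses (sg_neq : forall x, sg x != x) (sg3 : forall x, sg (sg (sg x)) = x).

Let first_in y :=
  ((enum_rank y < enum_rank (sg y)) && (enum_rank y < enum_rank (sg (sg y))))%N.

Let first_unique y :
  (first_in y)%:Z + (first_in (sg y))%:Z + (first_in (sg (sg y)))%:Z = 1.
Proof.
have ne (a b : T) : a != b -> (enum_rank a : nat) != enum_rank b.
  by apply: contra => /eqP/val_inj/enum_rank_inj->.
have n1 := ne _ _ (sg_neq y); have n2 := ne _ _ (sg_neq (sg y)).
have n3 := ne _ _ (sg_neq (sg (sg y))); rewrite sg3 in n3.
rewrite /first_in !sg3.
move: (nat_of_ord _) (nat_of_ord _) (nat_of_ord _) n1 n2 n3 => a b c.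
by lia.
Qed.

(** A vertex contributes the same value three times; the witness keeps one dart per vertex, the one
    of least rank. *)
Lemma dvd3_cubic_sum (K : pred T) (f : T -> int) :
    (forall y, K (sg y) = K y) -> (forall y, f (sg y) = f y) ->
  exists t, \sum_(y | K y) f y = 3 * t.
Proof.
move=> Ksg fsg; exists (\sum_(y | K y) f y * (first_in y)%:Z).
have shift g : \sum_(y | K y) f y * g (sg y) = \sum_(y | K y) f y * g y.
  rewrite [RHS](reindex_inj (@perm_inj _ sg)) /=.
  by apply: eq_big => [y|y _]; rewrite ?Ksg ?fsg.
pose g y := (first_in y)%:Z.
rewrite (eq_bigr (fun y => f y * g y + f y * g (sg y) + f y * g (sg (sg y)))).
  rewrite !big_split /= (shift g) (shift (fun y => g (sg y))) (shift g).
  by move: (\sum_(y | K y) f y * g y) => q; lia.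
by move=> y _; rewrite -!mulrDr first_unique mulr1.
Qed.

End CubicSums.

Lemma sum_pred_card (T : finType) (P : pred T) :
  \sum_(y : T) (P y)%:Z = #|[set y | P y]|%:Z.
Proof.
rewrite -sum1dep_card (big_morph Posz PoszD (erefl 0)) [RHS]big_mkcond /=.
by apply: eq_bigr => y _; case: (P y).
Qed.

(** * Trees and maps without root vertex on one dart set *)

Section Frozen.
Variable T : finType.
Implicit Types X M : dstruct T.
Local Notation charge X := (dart_charge (blk X)).
Local Notation ht X := (height (blk X)).

Record cubic X : Prop := Cubic {
  cu_neq : forall x, sg X x != x;
  cu_three : forall x, sg X (sg X (sg X x)) = x;
  cu_inv : involutive (al X);
  cu_blk : forall x, blk X (sg X x) = blk X x;
  cu_occ : forall x, occ X (sg X x) = occ X x;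
  cu_bip : bipartite (blk X) (al X) }.

Definition is_cubic X : bool :=
  [&& [forall x, (sg X x != x) && (sg X (sg X (sg X x)) == x)],
      [forall x, al X (al X x) == x],
      [forall x, (blk X (sg X x) == blk X x) && (occ X (sg X x) == occ X x)]
    & [forall x, inner X x ==> (blk X (al X x) != blk X x)]].

Lemma cubicP X : reflect (cubic X) (is_cubic X).
Proof.
apply: (iffP idP).
  case/and4P => /forallP h1 /forallP h2 /forallP h3 /forallP h4; split=> x.
  - by case/andP: (h1 x).
  - by case/andP: (h1 x) => _ /eqP.
  - exact/eqP.
  - by case/andP: (h3 x) => /eqP.
  - by case/andP: (h3 x) => _ /eqP.
  - by move=> ax; move/implyP: (h4 x) => /(_ ax); case: (blk X _); case: (blk X _).
case=> h1 h2 h3 h4 h5 h6; apply/and4P; split; apply/forallP => x.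
- by rewrite h1 h2 eqxx.
- by rewrite h3.
- by rewrite h4 h5 !eqxx.
- by apply/implyP => ax; rewrite h6 //; case: (blk X x).
Qed.

Lemma connectedP X : reflect (gconnected (sg X) (al X)) (connected X).
Proof.
apply: (iffP forallP) => h x; first by move=> y; move/forallP: (h x).
by apply/forallP => y; exact: h.
Qed.

Lemma connect_step_wo X x : involutive (al X) ->
  connect (step_wo X x) =2 connect (gstep (sg X) (cut (al X) x)).
Proof.
move=> alK y z; apply/idP/idP; apply: connect_sub => {y z} y z.
  case/orP => [/eqP->|/and3P[/eqP-> yx yax]]; apply: connect1; rewrite /gstep ?eqxx //.
  by rewrite cutE // (negPf yx) (negPf yax) eqxx orbT.
case/orP => [/eqP->|/eqP->]; first by apply: connect1; rewrite /step_wo eqxx.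
rewrite cutE //; case: ifP => [_|/negbT]; first exact: connect0.
by rewrite negb_or => /andP[yx yax]; apply: connect1; rewrite /step_wo eqxx yx yax orbT.
Qed.

Lemma sum_charge X :
  \sum_(y : T) charge X (al X) y = #|[set y | isLeaf X y]|%:Z - #|[set y | isBud X y]|%:Z.
Proof.
rewrite -!sum_pred_card -sumrB; apply: eq_bigr => y _.
by rewrite /dart_charge /isLeaf /isBud; case: eqP => //= _; case: (blk X y).
Qed.

Lemma blossomP X : reflect [/\ cubic X, gconnected (sg X) (al X), forest (sg X) (al X)
    & \sum_(y : T) charge X (al X) y = 3] (is_blossom X).
Proof.
have fo : involutive (al X) ->
    reflect (forest (sg X) (al X)) [forall x, inner X x ==> ~~ connect (step_wo X x) x (al X x)].
  move=> alK; apply: (iffP forallP) => h x.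
    by move=> ax; have /implyP/(_ ax) := h x; rewrite connect_step_wo.
  by apply/implyP => ax; rewrite connect_step_wo //; exact: h.
apply: (iffP idP).
  case/and5P => h1 h2 h3 h4 /and3P[/connectedP co f /eqP c].
  have cu : cubic X by apply/cubicP/and4P.
  by split=> //; [exact/(fo (cu_inv cu)) | rewrite sum_charge].
case=> cu co f c; have /cubicP/and4P[h1 h2 h3 h4] := cu.
rewrite /is_blossom h1 h2 h3 h4 -sum_charge c eqxx andbT /=; apply/andP; split; first exact/connectedP.
exact/(fo (cu_inv cu)).
Qed.

(* A bicubic map without its root vertex: the edges to the root vertex have
   become the three fixed points of [al X]. *)
Definition is_tmap X : bool :=
  [&& is_cubic X, connected X, [forall x, (al X x == x) ==> ~~ blk X x],
      #|[set x | al X x == x]| == 3, al X (rt X) == rt X,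
      [forall x, (al X x == x) ==> (x \in porbit (al X * sg X)%g (rt X))]
    & #|porbits (sg X)| + #|porbits (al X * sg X)%g| == nedges (blk X) (al X) + 2]%N.

Record tmap X : Prop := Tmap {
  tm_cubic : cubic X;
  tm_con : gconnected (sg X) (al X);
  tm_white : forall x, al X x = x -> ~~ blk X x;
  tm_fix3 : #|[set x | al X x == x]| = 3%N;
  tm_root : al X (rt X) = rt X;
  tm_face : forall x, al X x = x -> x \in porbit (al X * sg X)%g (rt X);
  tm_euler : (#|porbits (sg X)| + #|porbits (al X * sg X)%g| = nedges (blk X) (al X) + 2)%N }.

Lemma tmapP X : reflect (tmap X) (is_tmap X).
Proof.
apply: (iffP and5P).
  case=> /cubicP cu /connectedP co /forallP wh /eqP c3 /and3P[/eqP rr /forallP fa /eqP eu].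
  by split=> // x fx; [have := wh x | have := fa x]; rewrite fx eqxx.
case=> cu co wh c3 rr fa eu; split; try exact/eqP.
- exact/cubicP.
- exact/connectedP.
- by apply/forallP => x; apply/implyP => /eqP/wh.
- apply/and3P; split; try exact/eqP.
  by apply/forallP => x; apply/implyP => /eqP/fa.
Qed.

Lemma tmap_edge_perm M : tmap M -> edge_perm (blk M) (al M).
Proof. by move=> tm; split; [exact: cu_inv (tm_cubic tm) | exact: cu_bip (tm_cubic tm) | exact: tm_white]. Qed.

Lemma fconnect_phi X y z : fconnect (face_step (sg X) (al X)) y z = (z \in porbit (al X * sg X)%g y).
Proof. by rewrite porbit_fconnect; apply: eq_fconnect => w; rewrite permM. Qed.

Lemma orbit_from_root (f : T -> T) r : injective f ->
  let L := fingraph.orbit f (f r) in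
  [/\ uniq L, fcycle f L, r \in L & last r L = r].
Proof.
move=> fi L; have cL : fcycle f L by apply: cycle_orbit.
have rL : r \in L by rewrite -fconnect_orbit fconnect_sym // fconnect1.
split=> //; first exact: orbit_uniq.
apply: fi; move: cL; rewrite /L /fingraph.orbit.
case: (fingraph.order _ _) (fingraph.order_gt0 f (f r)) => //= n _.
by rewrite rcons_path => /andP[_ /eqP].
Qed.

Lemma size_filter_fix (m : {perm T}) L : uniq L -> (forall x, m x = x -> x \in L) ->
  size (filter (fun x => m x == x) L) = #|[set x | m x == x]|.
Proof.
move=> uL fL; rewrite cardE; apply/perm_size/uniq_perm.
- exact: filter_uniq.
- exact: enum_uniq.
- by move=> x; rewrite mem_enum inE mem_filter; case: eqP => // /fL.
Qed.

Lemma tmap_opens M : tmap M ->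
  exists L, opening (sg M) (blk M) (rt M) (al M) (al M) L.
Proof.
move=> tm; have [uL cL rL lL] := orbit_from_root (rt M) (@phi_inj _ (sg M) (al M)).
set L := fingraph.orbit _ _ in uL cL rL lL; exists L.
have fL x : al M x = x -> x \in L.
  by move=> /(tm_face tm); rewrite -fconnect_phi (fconnect_cycle cL rL).
apply: Opens0 => //; first exact: tm_root tm.
by rewrite -(tm_fix3 tm) -size_filter size_filter_fix.
Qed.

(** [contour] starts at whichever dart is enumerated first; this frees the closing from that choice,
    up to rotation. *)
Lemma contour_rot X L : uniq L -> fcycle (face_step (sg X) (al X)) L -> (forall y, y \in L) ->
  exists k, contour X = rot k (filter (fun y => al X y == y) L).
Proof.
move=> uL cL full; rewrite /contour.
case eT: (enum T) => [|x0 e].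
  have : forall y : T, False by move=> y; have := mem_enum T y; rewrite eT.
  by case: (L) => [_|y s /(_ y)//]; exists 0%N.
have [i L' e_L] := rot_to (full x0).
have szL : size L = #|T| by rewrite -(card_uniqP uL); apply: eq_card => y; rewrite full.
have -> : traject (fun y => sg X (al X y)) x0 #|T| = rot i L.
  move: cL; rewrite -(rot_cycle i) e_L /= rcons_path => /andP[/fpathE -> _].
  by rewrite -szL -(size_rot i) e_L.
exists (size (filter (fun y => al X y == y) (take i L))).
pose p y := al X y == y.
have := rot_size_cat (filter p (take i L)) (filter p (drop i L)).
by rewrite -!filter_cat cat_take_drop => ->.
Qed.

(** The closing without its new black vertex: the three unmatched leaves stay fixed points, so the
    darts are those of the tree. *)
Definition closed_map X : dstruct T :=
  (sg X, foldl (@join_pair T) (al X) (closing X).1, blk X, occ X, rt X).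

Lemma blossom_cycle X : is_blossom X -> let r := rt X in
  exists L, [/\ uniq L, fcycle (face_step (sg X) (al X)) L, r \in L, last r L = r
    & forall y, y \in L].
Proof.
move=> /blossomP[cu co fo c3] r.
have [uL cL rL lL] := orbit_from_root r (@phi_inj _ (sg X) (al X)).
exists (fingraph.orbit (face_step (sg X) (al X)) (face_step (sg X) (al X) r)); split=> // y.
rewrite -(fconnect_cycle cL rL) fconnect_phi.
exact: forest_transitive (cu_inv cu) (cu_bip cu) fo co r y.
Qed.

Lemma sum_full (L : seq T) (f : T -> int) : uniq L -> (forall y, y \in L) ->
  \sum_(y <- L) f y = \sum_y f y.
Proof.
move=> uL full; rewrite big_uniq //=; apply: eq_bigl => y; exact: full.
Qed.

Lemma sum_filter_fix X s :
  \sum_(y <- filter (fun y => al X y == y) s) charge X (al X) y = \sum_(y <- s) charge X (al X) y.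
Proof.
rewrite big_filter big_mkcond; apply: eq_bigr => y _.
by rewrite /dart_charge; case: eqP.
Qed.

(** Replaces the matching procedure by [opening]. The last two clauses keep the link with the
    matched pairs, which the definition of [good] mentions. *)
Lemma rooted_opens X : is_blossom X -> rooted_tree X ->
  exists L, [/\ edge_perm (blk X) (al (closed_map X)), opening (sg X) (blk X) (rt X) (al (closed_map X)) (al X) L,
    forall y, y \in L,
    forall p, p \in (closing X).1 -> al (closed_map X) p.1 = p.2 /\ blk X p.1
    & forall y, blk X y -> al X y = y -> exists2 p, p \in (closing X).1 & p.1 = y].
Proof.
move=> bl /andP[/andP[/eqP fr wr] rc]; have [L [uL cL rL lL full]] := blossom_cycle bl.
have [cu co fo c3] := blossomP _ bl.
have [k ek] := contour_rot uL cL full.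
move: rc; rewrite /closing ek => rc; exists L.
have [//|em o prs bds] := @close_opens _ X (size (rot k (filter (fun y => al X y == y) L)))
  (al X) L k (rt X) (cu_inv cu) (cu_bip cu) (fun _ => id) uL cL rL lL fr wr (fun y _ => full y) (leqnn _) _ rc.
  by rewrite (perm_big _ (permEl (perm_rot _ _))) sum_filter_fix sum_full.
by split=> //; rewrite /closed_map /al /= /closing ek.
Qed.

(** The height bound 2 of an opening is the hypothesis of [root_unmatched]. *)
Lemma opens_rooted X m L : is_blossom X -> edge_perm (blk X) m ->
  opening (sg X) (blk X) (rt X) m (al X) L -> (forall y, y \in L) -> rooted_tree X.
Proof.
move=> bl em o full; have op := opensP em o; have [cu co fo c3] := blossomP _ bl.
have [mK mb mw] := em; have fr := opens_root o em.
have wr : ~~ blk X (rt X) by apply: mw; exact: op_mroot op.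
have lf : isLeaf X (rt X) by rewrite /isLeaf fr eqxx.
have [k ek] := contour_rot (op_uniq op) (op_cycle op) full.
rewrite /rooted_tree lf /closing ek; apply: root_unmatched => //.
- exact: filter_uniq (op_uniq op).
- by rewrite mem_filter fr eqxx full.
- case/lastP: (L) (op_root op) (op_last op) => // L' z _; rewrite last_rcons => ->.
  by rewrite filter_rcons fr eqxx last_rcons.
- by move=> y; rewrite mem_filter => /andP[/eqP].
- by rewrite sum_filter_fix sum_full // (op_uniq op).
- move=> y; rewrite mem_filter => /andP[fy yL]; rewrite take_index_filter // sum_filter_fix.
  exact: oh_le2 (opens_htP em o) _ yL.
Qed.

End Frozen.

Lemma split_index2 (T : eqType) (s : seq T) x y : uniq s -> x \in s -> y \in s ->
  (index x s < index y s)%N -> exists A V C, s = A ++ x :: rcons V y ++ C.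
Proof.
move=> us xs; case/splitPr: xs us => A B; rewrite cat_uniq /= negb_or.
move=> /and3P[_ /andP[xA _] /andP[xB _]]; rewrite mem_cat inE !index_cat (negPf xA) /= eqxx addn0.
case: ifP => [yA _|_ /=]; first by have := index_mem y A; rewrite yA; seqlia.
case: eqVneq => [->|_ /= yB _]; first by rewrite addn0 ltnn.
by case/splitPr: yB => V C; exists A, V, C; rewrite cat_rcons.
Qed.

Lemma ht_split (T : finType) (k : pred T) (a : {perm T}) P y Q : uniq (P ++ y :: Q) ->
  height k a (P ++ y :: Q) y = \sum_(z <- P) dart_charge k a z.
Proof.
rewrite cat_uniq /= negb_or => /and3P[_ /andP[yP _] _].
by rewrite /height index_cat (negPf yP) /= eqxx addn0 take_size_cat.
Qed.

(** * Trees as full openings, and regularity in terms of heights *)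

Section Trees.
Variable T : finType.
Implicit Types X M : dstruct T.
Local Notation charge X := (dart_charge (blk X)).
Local Notation ht X := (height (blk X)).

Definition set_al M (a : {perm T}) : dstruct T := (sg M, a, blk M, occ M, rt M).

Lemma set_al_id X : set_al X (al X) = X.
Proof. by case: X => [[[[? ?] ?] ?] ?]. Qed.

Lemma opens_fixed_count sg blk rt (m al : {perm T}) L : edge_perm blk m ->
  opening sg blk rt m al L -> #|[set x | m x == x]| = 3%N.
Proof.
move=> em; elim=> {al L} // L uL cL rL lL mr fL <-.
by rewrite -size_filter size_filter_fix.
Qed.

Lemma card_porbits_full sg rt (m al : {perm T}) L : opened sg rt m al L ->
  (forall y, y \in L) -> #|porbits (al * sg)%g| = 1%N.
Proof.
move=> op full; apply/eqP; rewrite eqn_leq (card_porbits_gt0 _ rt) andbT.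
apply: card_porbits_transitive => x y; rewrite porbit_fconnect.
have -> : fconnect (al * sg)%g x y = fconnect (face_step sg al) x y.
  by apply: eq_fconnect => z; rewrite permM.
by rewrite (fconnect_cycle (op_cycle op)).
Qed.

(** Euler's formula holds for the tree by [forest_count] and is carried to the closing by
    [opens_euler]. *)
Lemma cl_tmap X : is_blossom X -> rooted_tree X -> tmap (closed_map X).
Proof.
move=> bl ro; have [L [em o full _ _]] := rooted_opens bl ro.
have [cu co fo c3] := blossomP _ bl; have op := opensP em o.
have [mK mb mw] := em; set m := al (closed_map X) in em o op mK mb mw *.
split=> //.
- by split=> //; [exact: cu_neq cu | exact: cu_three cu | exact: cu_blk cu | exact: cu_occ cu].
- by move=> y z; apply: (gconnect_sub (op_sub op)); exact: co.
- exact: opens_fixed_count em o.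
- exact: op_mroot op.
- move=> x fx; have [L0 o0 _] := opens_base em o; have op0 := opensP em o0.
  by rewrite -fconnect_phi (fconnect_cycle (op_cycle op0) (op_root op0)); exact: op_fix op0 _ fx.
- have [cnt _] := forest_count (cu_inv cu) (cu_bip cu) fo.
  have := opens_euler em o; rewrite -/m.
  have := card_porbits_full op full; move: cnt; rewrite /m /closed_map /sg /blk /=.
  rewrite -/(sg X) -/(al X) -/(blk X).
  move: #|porbits (sg X)| #|porbits (al X * sg X)%g| #|porbits _| => a b c; lia.
Qed.

(** The total is the height of the final root leaf plus 1, and openings do not change that
    height. *)
Lemma opens_total sg blk rt (m al : {perm T}) L : edge_perm blk m ->
  opening sg blk rt m al L -> \sum_(y <- L) dart_charge blk al y = 3.
Proof.
move=> em o; have op := opensP em o; have [mK mb mw] := em.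
have fr := opens_root o em; have wr := mw _ (op_mroot op).
have tot (a : {perm T}) s : uniq s -> rt \in s -> last rt s = rt -> a rt = rt ->
    \sum_(y <- s) dart_charge blk a y = height blk a s rt + 1.
  case/lastP: s => // s z us _; rewrite last_rcons => ez ar; rewrite ez in us *.
  rewrite /height big_rcons /= /dart_charge ar eqxx (negPf wr); congr (_ + _).
  move: us; rewrite rcons_uniq => /andP[rs _].
  by rewrite -cats1 index_cat (negPf rs) /= eqxx addn0 take_size_cat.
have [L0 o0 h0] := opens_base em o; have op0 := opensP em o0.
have [_ e] := h0 _ (op_root op0).
rewrite tot ?(op_uniq op) ?(op_root op) ?(op_last op) // e.
rewrite -tot ?(op_uniq op0) ?(op_root op0) ?(op_last op0) ?(op_mroot op) //.
rewrite (eq_bigr (fun y => (m y == y)%:Z)); last first.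
  by move=> y _; rewrite /dart_charge; case: eqP => // /mw/negPf->.
rewrite -(opens_fixed_count em o) -(size_filter_fix (op_uniq op0) (op_fix op0)).
elim: (L0) => [|y s IHs]; first by rewrite big_nil.
by rewrite big_cons IHs /=; case: eqP => _; rewrite ?add0r //= mulrS.
Qed.

(** A single face makes the opened graph connected, and the Euler count then makes it a forest.
    Uniqueness of the closing returns [M]. *)
Lemma opens_tree M a L : tmap M -> opening (sg M) (blk M) (rt M) (al M) a L ->
    (forall y, y \in L) ->
  [/\ is_blossom (set_al M a), rooted_tree (set_al M a) & closed_map (set_al M a) = M].
Proof.
move=> tm o full; have em := tmap_edge_perm tm; have op := opensP em o.
have [mK mb mw] := em; have cu := tm_cubic tm.
have p1 := card_porbits_full op full.
have co : gconnected (sg M) a.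
  by move=> y z; apply: porbit_gconnect; exact: card_porbits1.
have bip : bipartite (blk M) a.
  by move=> x; case: (op_sub op x) => ->; [rewrite eqxx | exact: mb].
have fo : forest (sg M) a.
  apply: (euler_forest (rt M) (op_inv op) bip co).
  have := opens_euler em o; have := tm_euler tm; rewrite p1.
  move: #|porbits (sg M)| #|porbits _| => b c; lia.
have bl : is_blossom (set_al M a).
  apply/blossomP; split=> //.
    split=> //; [exact: cu_neq cu | exact: cu_three cu | exact: op_inv op
                | exact: cu_blk cu | exact: cu_occ cu].
  by rewrite -(sum_full _ (op_uniq op) full); exact: opens_total em o.
have ro : rooted_tree (set_al M a) by apply: (opens_rooted bl em o full).
split=> //; have [L' [em' o' full' _ _]] := rooted_opens bl ro.
have e : al (closed_map (set_al M a)) = al M := opens_mate_unique em' em o' o.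
by rewrite -[RHS]set_al_id -e.
Qed.

Section Regularity.
Variables (X : dstruct T) (L : seq T).
Hypotheses (bl : is_blossom X) (uL : uniq L) (cL : fcycle (face_step (sg X) (al X)) L).
Hypothesis full : forall y, y \in L.
Let cu : cubic X. Proof. by have [] := blossomP _ bl. Qed.
Let alK := cu_inv cu.
Let fo : forest (sg X) (al X). Proof. by have [] := blossomP _ bl. Qed.

Lemma cut_mate x : cut (al X) (al X x) = cut (al X) x.
Proof. by rewrite /cut alK tpermC. Qed.

Lemma qpart_mate x z : qpart X (al X x) z = qpart X x z.
Proof.
apply: eq_bigl => y; rewrite !connect_step_wo // cut_mate //.
Qed.

Lemma qpart_later x : al X x != x -> (index x L < index (al X x) L)%N ->
  qpart X x (al X x) = ht X (al X) L (al X x) - ht X (al X) L x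
  /\ qpart X x x = 3 - (ht X (al X) L (al X x) - ht X (al X) L x).
Proof.
move=> ax lt_i.
have [A [V [C eL]]] := split_index2 uL (full x) (full (al X x)) lt_i.
have u := uL; rewrite eL in u.
have [u0 uV dV] := uniq_insert u.
pose g := face_step (sg X) (cut (al X) x); pose V' := rcons V (al X x).
have /esym/andP[c1 c2] : true = fcycle g (A ++ x :: C) && fcycle g V'.
  rewrite -(@fcycle_insert _ (face_step (sg X) (al X))) -?eL ?cL //.
  - by rewrite -size_eq0 size_rcons.
  - move=> y yI; rewrite last_rcons => yl; rewrite /g /face_step cutE // (negPf yl) orbF.
    case: eqVneq yI => // ->; have := u.
    rewrite cat_uniq /= negb_or => /and3P[_ /andP[/negPf xA _] /andP[/negPf xV _]].
    by rewrite mem_cat xA xV.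
  - by rewrite last_rcons /g /face_step cutE // eqxx alK.
  - by rewrite last_rcons /g /face_step cutE // eqxx orbT.
have con y z s : fcycle g s -> y \in s -> z \in s -> connect (gstep (sg X) (cut (al X) x)) y z.
  move=> cs ys zs; apply: porbit_gconnect; rewrite porbit_fconnect.
  have -> : fconnect (cut (al X) x * sg X)%g y z = fconnect g y z.
    by apply: eq_fconnect => w; rewrite permM.
  by rewrite (fconnect_cycle cs ys).
have axV : al X x \in V' by rewrite mem_rcons mem_head.
have xN : x \in A ++ x :: C by rewrite mem_cat mem_head orbT.
have cK := cut_involutive x alK.
have comp2 y : connect (step_wo X x) (al X x) y = (y \in V').
  rewrite connect_step_wo //; apply/idP/idP => [h|yV]; last exact: con c2 axV yV.
  have := full y; rewrite eL (mem_insert A C V' x) => /orP[yA|//].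
  case/negP: (fo ax); apply: connect_trans (con _ _ _ c1 xN yA) _.
  by rewrite gconnect_sym.
have comp1 y : connect (step_wo X x) x y = (y \notin V').
  rewrite connect_step_wo //; apply/idP/idP => [h|yV].
    apply/negP => yV; case/negP: (fo ax); apply: connect_trans h _.
    exact: con c2 yV axV.
  by apply: (con _ _ _ c1) => //; have := full y; rewrite eL (mem_insert A C V' x) (negPf yV) orbF.
have qE z : qpart X x z = \sum_(y | connect (step_wo X x) z y) charge X (al X) y.
  rewrite /qpart big_mkcondr; apply: eq_bigr => y _; rewrite /dart_charge.
  by case: ifP.
have hV : \sum_(y | y \in V') charge X (al X) y = ht X (al X) L (al X x) - ht X (al X) L x.
  have cx : charge X (al X) x = 0 by rewrite /dart_charge (negPf ax).
  have cax : charge X (al X) (al X x) = 0 by rewrite /dart_charge alK eq_sym (negPf ax).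
  have eL2 : L = (A ++ x :: V) ++ al X x :: C by rewrite eL cat_rcons -catA.
  have u2 := uL; rewrite eL2 in u2.
  rewrite {1}eL2 ht_split // eL ht_split // -big_uniq //= /V' big_rcons /= cax addr0.
  by rewrite big_cat big_cons /= cx add0r addrAC subrr add0r.
rewrite !qE (eq_bigl _ _ comp2) (eq_bigl _ _ comp1) hV; split=> //.
have [_ _ _] := blossomP _ bl; rewrite (bigID (mem V')) /= hV.
by move: (\sum_(_ | _ \notin _) _) => q <-; rewrite addrAC subrr add0r.
Qed.

(** The signs of all darts of the part add up to a multiple of 3. The two darts of an inner edge
    cancel, but of the removed edge only [z] lies in the part. *)
Lemma qpart_mod3 x z : al X x != x -> z = x \/ z = al X x -> exists t,
  qpart X x z = 3 * t - (if blk X z then -1 else 1).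
Proof.
move=> ax zx; pose K := connect (step_wo X x) z.
pose f y : int := if blk X y then -1 else 1.
have sym : connect_sym (step_wo X x).
  by move=> y w; rewrite !connect_step_wo // gconnect_sym //; exact: cut_involutive.
have Ksg y : K (sg X y) = K y.
  have st : connect (step_wo X x) y (sg X y) by apply: connect1; rewrite /step_wo eqxx.
  rewrite /K; apply/idP/idP => h; apply: connect_trans h _ => //.
  by rewrite sym.
have fsg y : f (sg X y) = f y by rewrite /f (cu_blk cu).
have [t et] := dvd3_cubic_sum (cu_neq cu) (cu_three cu) Ksg fsg.
exists t; rewrite -et (bigID (fun y => al X y == y)) /= -/(qpart X x z).
suff -> : \sum_(y | K y && (al X y != y)) f y = f z by rewrite addrK.
have az : al X z != z by case: zx => -> //; rewrite alK eq_sym.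
have zK : K z by exact: connect0.
have notaz : ~~ K (al X z).
  rewrite /K connect_step_wo //; case: zx => ->; first exact: fo.
  by rewrite alK gconnect_sym; [exact: fo | exact: cut_involutive].
have Kal y : K y -> al X y != y -> y != z -> K (al X y).
  move=> Ky ay yz; have yaz : y != al X z by apply: contraNneq notaz => <-.
  apply: connect_trans Ky (connect1 _); rewrite /step_wo eqxx /=.
  suff -> : (y != x) && (y != al X x) by rewrite orbT.
  by case: zx yz yaz => ->; rewrite ?alK => -> ->.
rewrite (bigD1 z) ?zK ?az //=.
set S := \sum_(y | _) _; suff : S = - S by lia.
rewrite {1}/S (reindex_inj (@perm_inj _ (al X))) /= -sumrN; apply: eq_big => y.
  rewrite alK [y == _]eq_sym; have [yz|yz] := eqVneq (al X y) z.
    rewrite andbF; apply/esym/negbTE; rewrite !negb_and.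
    by rewrite -[y]alK yz notaz.
  rewrite andbT; have [ay|ay] := boolP (al X y == y); first by rewrite /= !andbF.
  rewrite /= !andbT; apply/idP/idP => [Ka|/andP[Ky yz']].
    have := Kal _ Ka; rewrite alK [y == _]eq_sym => /(_ ay yz) ->.
    by apply: contraNneq notaz => <-.
  exact: Kal.
move=> /andP[/andP[_ ay] _]; rewrite alK eq_sym in ay.
by rewrite /f (cu_bip cu) //; case: (blk X y).
Qed.

Lemma qpartE x : al X x != x ->
  qpart X x (al X x) = (if (index x L < index (al X x) L)%N then 0 else 3)
                       + ht X (al X) L (al X x) - ht X (al X) L x
  /\ qpart X x x = 3 - qpart X x (al X x).
Proof.
move=> ax; case: ltnP => [lt_i|].
  by have [-> ->] := qpart_later ax lt_i; rewrite add0r.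
rewrite leq_eqVlt => /orP[/eqP e|lt_i].
  by move/(congr1 (nth x L)): e; rewrite !nth_index // => e; rewrite e eqxx in ax.
have := @qpart_later (al X x); rewrite alK eq_sym !qpart_mate => /(_ ax lt_i)[-> ->].
by split; htlia.
Qed.

Lemma regular_mate x : al X x != x -> regular X (al X x) = regular X x.
Proof.
move=> ax; rewrite /regular (cu_bip cu) // !alK !qpart_mate.
by case: (blk X x); rewrite /= ?alK.
Qed.

(** The two charges add up to 3, so the bound 1 on the black side is the bound 2 on the white
    side. *)
Lemma regular_black x : al X x != x -> blk X x -> regular X x = (2 <= qpart X x (al X x)).
Proof.
move=> ax bx; rewrite /regular bx alK; have [_ ->] := qpartE ax.
by move: (qpart _ _ _) => q; lia.
Qed.

Lemma regular_reg_edge (m : {perm T}) x : al X x != x -> blk X x -> al X x = m x ->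
  regular X x = regular_edge (blk X) m (al X) L x.
Proof.
move=> ax bx e; rewrite regular_black // /regular_edge -e; have [-> _] := qpartE ax.
by case: ifP => _; htlia.
Qed.

Lemma weak_regular (m : {perm T}) x : al X x != x -> blk X x -> al X x = m x ->
  weak_edge (blk X) m (al X) L x -> regular X x.
Proof.
move=> ax bx e; rewrite regular_black // /weak_edge -e => h.
have [t et] := qpart_mod3 ax (or_intror (erefl (al X x))).
rewrite (cu_bip cu) // bx /= in et.
have : 0 <= qpart X x (al X x).
  by have [-> _] := qpartE ax; move: h; case: ifP => _; htlia.
by rewrite et; move: t {et} => t; lia.
Qed.

End Regularity.
End Trees.

(** * The trees closing to a given map *)

(** Toggling an element of [B] outside [A] reverses the sign. *)
Lemma signed_interval (T : finType) (A B : {set T}) :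
  \sum_(S : {set T} | (A \subset S) && (S \subset B)) (-1) ^+ #|S|
    = (if A == B then (-1) ^+ #|A| else 0) :> int.
Proof.
have [->|AB] := eqVneq A B.
  by rewrite (big_pred1 B) // => S; rewrite /= eqEsubset andbC.
have [sAB|nAB] := boolP (A \subset B); last first.
  rewrite big_pred0 // => S; apply/negP => /andP[AS SB].
  by case/negP: nAB; exact: subset_trans AS SB.
have /properP[_ [a aB aA]] : A \proper B by rewrite properEneq AB.
pose tog (S : {set T}) := if a \in S then S :\ a else a |: S.
have togK : involutive tog.
  move=> S; rewrite {2}/tog; case: ifP => aS; rewrite /tog !inE eqxx /= ?setD1K //.
  by rewrite setU1K ?aS.
have sgn S : (-1) ^+ #|tog S| = - (-1) ^+ #|S| :> int.
  rewrite /tog; case: ifP => aS; last by rewrite cardsU1 aS /= exprS mulN1r.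
  by rewrite [in RHS](cardsD1 a S) aS /= exprS mulN1r opprK.
set s := \sum_(S | _) _; suff : s = - s by lia.
rewrite {1}/s (reindex_inj (inv_inj togK)) /= -sumrN; apply: eq_big => S; last by rewrite sgn.
rewrite /tog; case: ifP => aS; congr (_ && _).
- by rewrite subsetD1 aA andbT.
- by rewrite -[in RHS](setD1K aS) subUset sub1set aB.
- apply/idP/idP => h; last exact: subset_trans h (subsetU1 _ _).
  by rewrite -[S](@setU1K _ a) ?aS // subsetD1 h.
- by rewrite subUset sub1set aB.
Qed.

Section SignedSum.
Variable T : finType.
Implicit Types (X M : dstruct T) (S N : {set T}).

(** Edges are represented by their black darts, so that a set of edges is a set of darts, shared by
    the tree and its closing. *)
Definition irregular_darts X := [set x | [&& blk X x, al X x != x & ~~ regular X x]].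
Definition nhp_darts X := [set x | [&& blk X x, al X x != x & ~~ HP X x]].
Definition tree X := is_blossom X && rooted_tree X.

Definition reached M S := [set y | connect (dual_step (sg M) (blk M) (al M) (mem S)) (rt M) y].

Section Reach.
Variable M : dstruct T.
Hypothesis tm : tmap M.
Let cu := tm_cubic tm.
Let mK := cu_inv cu.
Let N := nhp_darts M.

Let reached_phi S y : (sg M (al M y) \in reached M S) = (y \in reached M S).
Proof.
rewrite !inE; apply/idP/idP => h; last first.
  by apply: connect_trans h (connect1 _); rewrite /dual_step eqxx.
have : fconnect (face_step (sg M) (al M)) (sg M (al M y)) y.
  by rewrite fconnect_sym ?fconnect1 //; exact: phi_inj.
move=> c; apply: connect_trans h _; move: c; apply: connect_sub => u v /= /eqP <-.
by apply: connect1; rewrite /dual_step eqxx.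
Qed.

Let reached_sg S x : (sg M x \in reached M S) = (al M x \in reached M S).
Proof. by rewrite -[RHS]reached_phi mK. Qed.

Let reached_black S x : blk M x -> x \notin S -> x \in reached M S -> sg M x \in reached M S.
Proof.
move=> bx nS; rewrite reached_sg !inE => h; apply: connect_trans h (connect1 _).
by rewrite /dual_step bx /= nS eqxx orbT.
Qed.

Lemma reached_mono S S' : S \subset S' -> reached M S' \subset reached M S.
Proof.
move=> sS; apply/subsetP => y; rewrite !inE; apply: connect_sub => u v h.
apply: connect1; move: h; rewrite /dual_step /= => /orP[->//|/and3P[-> nS ->]].
by rewrite (contra (subsetP sS u)) ?orbT.
Qed.

(* Around a vertex the faces form a directed triangle, so a boundary of the
   reached set would alternate between arcs leaving it, which are non-hard
   edges, and arcs entering it; the latter then join_pair two particles as well. *)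
Lemma reached_all : (forall a, a \in N -> al M a \notin reached M N) ->
  forall y, y \in reached M N.
Proof.
move=> out; set R := reached M N in out *.
have third (P : pred T) x : P x -> ~~ P (sg M x) ->
    exists y, [/\ ~~ P y, P (sg M y), blk M y = blk M x & occ M y = occ M x].
  move=> Px Ps; have [P2|P2] := boolP (P (sg M (sg M x))).
    by exists (sg M x); rewrite (cu_blk cu) (cu_occ cu).
  by exists (sg M (sg M x)); rewrite (cu_three cu) !(cu_blk cu) !(cu_occ cu).
have bfix x : blk M x -> al M x != x by apply: contraTneq => /(tm_white tm).
have inN x : (x \in N) = [&& blk M x, occ M x & occ M (al M x)].
  by rewrite inE /HP negbK; case: (boolP (blk M x)) => // /bfix ->.
have black x : blk M x -> x \in R -> sg M x \in R.
  move=> bx xR; apply: contraT => sR.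
  have xN : x \in N by apply: contraT => xN; rewrite (reached_black bx xN) in sR.
  have [y [yR syR by_ oy]] := third (mem R) x xR sR.
  rewrite bx in by_; move: xN; rewrite inN => /and3P[_ ox _]; rewrite ox in oy.
  have yN : y \notin N by apply/negP => /out; rewrite -reached_sg -/R; move: syR => /= ->.
  have ow : ~~ occ M (al M y) by move: yN; rewrite inN by_ oy.
  have wR : al M y \in R by rewrite -reached_sg.
  have swR : sg M (al M y) \notin R by rewrite reached_sg mK.
  have [z [zR szR bz oz]] := third (mem R) _ wR swR.
  have nz : al M z \notin N by rewrite inN mK oz (negPf ow) !andbF.
  have wz : ~~ blk M z by rewrite bz (cu_bip cu) ?by_ // bfix.
  have [fz|mz] := eqVneq (al M z) z.
    by move: szR zR; rewrite /= reached_sg fz => ->.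
  have bz' : blk M (al M z) by rewrite (cu_bip cu).
  have := reached_black bz' nz; rewrite -/R -reached_sg => /(_ szR).
  by rewrite reached_phi; move: zR => /= /negPf ->.
have white x : ~~ blk M x -> x \in R -> sg M x \in R.
  move=> wx xR; apply: contraT => sR.
  have mx : al M x != x by apply: contraNneq sR => e; rewrite reached_sg e.
  have by_ : blk M (al M x) by rewrite (cu_bip cu).
  have s1 : sg M (al M x) \in R by rewrite reached_sg mK.
  have s2 : sg M (sg M (al M x)) \in R by apply: black => //; rewrite (cu_blk cu).
  have := black _ _ s2; rewrite !(cu_blk cu) (cu_three cu) => /(_ by_).
  by rewrite -reached_sg (negPf sR).
have sgR x : x \in R -> sg M x \in R by case: (boolP (blk M x)) => [/black|/white]; apply.
move=> y; have /connectP[p] := tm_con tm (rt M) y.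
have : rt M \in R by rewrite inE connect0.
elim: p (rt M) => [|z p IHp] x xR /=; first by move=> _ ->.
case/andP => st pz; apply: IHp => //; case/orP: st => /eqP ->; first exact: sgR.
by rewrite -reached_sg; exact: sgR.
Qed.

(** The arc of [a] leads to a face reached even without crossing [N], so allowing it adds
    nothing. *)
Lemma reached_toggle S a : S \subset N -> a \in S -> al M a \in reached M N ->
  reached M (S :\ a) = reached M S.
Proof.
move=> SN aS aR; apply/eqP; rewrite eqEsubset (reached_mono (subD1set S a)) andbT.
apply/subsetP => y; rewrite inE => /connectP[p].
have : rt M \in reached M S by rewrite inE connect0.
elim: p (rt M) => [|z p IHp] x xR /=; first by move=> _ ->.
case/andP => st pz; apply: IHp => //; case/orP: st => [/eqP->|/and3P[bx nS /eqP->]].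
  by rewrite -[_ \in _]/(sg M (al M x) \in reached M S) reached_phi.
have [->|xa] := eqVneq x a; first exact: subsetP (reached_mono SN) _ aR.
by rewrite -reached_sg; apply: reached_black => //; move: nS; rewrite /= !inE xa.
Qed.

Lemma signed_reach :
  \sum_(S : {set T} | S \subset N) (-1) ^+ #|S| * ([forall y, y \in reached M S])%:Z
    = (N == set0)%:Z.
Proof.
have [a /andP[aN aR]|none] := pickP (fun a => (a \in N) && (al M a \in reached M N)).
  have -> : (N == set0) = false by apply/negP => /eqP N0; rewrite N0 inE in aN.
  pose tog S := if a \in S then S :\ a else a |: S.
  have togK : involutive tog.
    move=> S; rewrite {2}/tog; case: ifP => aS; rewrite /tog !inE eqxx /= ?setD1K //.
    by rewrite setU1K ?aS.
  have togN S : (tog S \subset N) = (S \subset N).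
    rewrite /tog; case: ifP => aS; last by rewrite subUset sub1set aN.
    by rewrite -[in RHS](setD1K aS) subUset sub1set aN.
  have sgn S : (-1) ^+ #|tog S| = - (-1) ^+ #|S| :> int.
    rewrite /tog; case: ifP => aS; last by rewrite cardsU1 aS /= exprS mulN1r.
    by rewrite [in RHS](cardsD1 a S) aS /= exprS mulN1r opprK.
  set s := \sum_(S | _) _; suff : s = - s by lia.
  rewrite {1}/s (reindex_inj (inv_inj togK)) /= -sumrN; apply: eq_big => S; first exact: togN.
  move=> SN; rewrite togN in SN; rewrite sgn mulNr; congr (- (_ * _)); congr (Posz (nat_of_bool _)).
  suff -> : reached M (tog S) = reached M S by [].
  rewrite /tog; case: ifP => aS; first exact: reached_toggle.
  have SN' : a |: S \subset N by rewrite subUset sub1set aN.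
  rewrite -(reached_toggle SN' _ aR) ?setU11 // setU1K ?aS //.
(* If no arc of [N] ends in the reached part, everything is reached; then an arc of [N] would end
   there after all, so [N] is empty. *)
have full : forall y, y \in reached M N.
  by apply: reached_all => a aN; have := none a; rewrite aN /= => ->.
have N0 : N == set0.
  by apply/eqP/setP => a; rewrite [RHS]inE; apply/negP => aN; have := none a; rewrite aN full.
rewrite N0 (eqP N0) (big_pred1 set0) => [|S]; last by rewrite subset0.
rewrite cards0 expr0 mul1r; congr (Posz (nat_of_bool _)); apply/forallP => y.
by rewrite -(eqP N0).
Qed.

(** The two inclusions say that the tree is regular off [S] and does not cut [S]. Such a tree exists
    by [opens_exists], only one exists by [opens_unique], and reachability is necessary by
    [opens_reach]. *)
Lemma tree_count S : S \subset N ->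
  #|[set X | [&& tree X, closed_map X == M, irregular_darts X \subset S
             & S \subset [set x | al X x != x]]]|
  = [forall y, y \in reached M S].
Proof.
move=> SN; have em := tmap_edge_perm tm; have [L0 o0] := tmap_opens tm.
set Q := [set X | _].
have Qopens X : X \in Q -> exists L, [/\ X = set_al M (al X),
    opening (sg M) (blk M) (rt M) (al M) (al X) L, forall y, y \in L,
    forall x, blk M x -> x \in S -> al X x != x
    & forall x, blk M x -> al X x != x -> x \notin S -> regular_edge (blk M) (al M) (al X) L x].
  rewrite inE => /and4P[/andP[bl ro] /eqP eM irr Sin].
  have [L [em' o full _ _]] := rooted_opens bl ro.
  have op := opensP em' o.
  exists L; move: em' o op; rewrite -eM => em' o op; split=> //.
  - by rewrite -[LHS]set_al_id.
  - by move=> x _ /(subsetP Sin); rewrite inE.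
  - move=> x bx ax nS; have mx : al X x = al (closed_map X) x.
      by case: (op_sub op x) => // e; rewrite e eqxx in ax.
    rewrite -(regular_reg_edge bl (op_uniq op) (op_cycle op) full ax bx mx).
    apply: contraNT nS => ir; apply: (subsetP irr); rewrite inE ax ir !andbT; exact: bx.
have [rch|nrch] := boolP [forall y, y \in reached M S]; last first.
  apply/eqP; rewrite cards_eq0; apply/eqP/setP => X; rewrite [RHS]inE; apply/negP => /Qopens.
  case=> L [_ o full Scut _]; case/negP: nrch; apply/forallP => y.
  by rewrite inE; exact: (opens_reach em o Scut (full y)).
have [a [L [o full Scut weak]]] : exists al0 L, [/\ opening (sg M) (blk M) (rt M) (al M) al0 L,
    forall y, y \in L, forall x, blk M x -> x \in S -> al0 x != x
    & forall x, blk M x -> al0 x != x -> x \notin S -> weak_edge (blk M) (al M) al0 L x].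
  apply: (opens_exists em o0 (S := mem S)) => y.
  by move/forallP: rch => /(_ y); rewrite inE.
have [bl ro eM] := opens_tree tm o full; have op := opensP em o.
apply/eqP/cards1P; exists (set_al M a); apply/setP => X; rewrite [RHS]inE.
have aQ : set_al M a \in Q.
  rewrite inE /tree bl ro eM eqxx /=; apply/andP; split; apply/subsetP => x; rewrite !inE.
    case/and3P => bx ax; apply: contraNT => nS.
    apply: (weak_regular bl (op_uniq op) (op_cycle op) full ax bx (m := al M)).
      by case: (op_sub op x) => // e; rewrite -[al _]/a e eqxx in ax.
    exact: weak.
  by move=> xS; apply: Scut => //; have := subsetP SN x xS; rewrite inE => /and3P[].
apply/idP/eqP => [XQ|->//].
have [L1 [eX o1 f1 c1 r1]] := Qopens X XQ; have [L2 [_ o2 f2 c2 r2]] := Qopens _ aQ.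
by rewrite eX (opens_unique (S := mem S) em o1 f1 o2 f2 c1 c2 r1 r2).
Qed.

End Reach.

Lemma HP_mate X x : involutive (al X) -> HP X (al X x) = HP X x.
Proof. by move=> alK; rewrite /HP alK andbC. Qed.

Lemma admissibleE X : is_blossom X -> admissible X = (irregular_darts X == nhp_darts X).
Proof.
move=> bl; rewrite /admissible bl /=; have [L [uL cL _ _ full]] := blossom_cycle bl.
have [cu _ _ _] := blossomP _ bl; have alK := cu_inv cu.
apply/forallP/eqP => [h|/setP h x].
  apply/setP => x; rewrite !inE; have [ax|] := boolP (al X x != x); last by rewrite !andbF.
  by have /implyP/(_ ax) := h x; case: (HP X x) => ->.
apply/implyP => ax.
have blackcase z : blk X z -> al X z != z -> if HP X z then regular X z else ~~ regular X z.
  by move=> bz az; have := h z; rewrite !inE bz az /=; case: (HP X z); case: (regular X z).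
have [bx|wx] := boolP (blk X x); first exact: blackcase.
rewrite -(HP_mate _ alK) -(regular_mate bl ax); apply: blackcase.
  by rewrite (cu_bip cu).
by rewrite alK eq_sym.
Qed.

(** The darts counted by [nNHP] are paired by [al X], one of each colour. *)
Lemma nNHPE X : cubic X -> nNHP X = #|nhp_darts X|.
Proof.
move=> cu; have alK := cu_inv cu; rewrite /nNHP.
rewrite -(cardsID [set x | blk X x]).
set A := [set x | _]; have -> : A :&: [set x | blk X x] = nhp_darts X.
  by apply/setP => x; rewrite !inE andbC.
have -> : A :\: [set x | blk X x] = al X @: nhp_darts X.
  apply/setP => x; apply/idP/imsetP => [|[y + ->]].
    rewrite !inE /inner => /and3P[wx ax hx]; exists (al X x); rewrite ?alK // inE.
    by rewrite (cu_bip cu) // wx alK eq_sym ax HP_mate.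
  by rewrite !inE => /and3P[by_ ay hy]; rewrite (cu_bip cu) // by_ /inner alK eq_sym ay HP_mate.
by rewrite card_imset ?addnn ?doubleK //; exact: perm_inj.
Qed.

Lemma nhp_cl X : tree X -> nhp_darts X = nhp_darts (closed_map X) :&: [set x | al X x != x].
Proof.
move=> /andP[bl ro]; have [L [em o _ _ _]] := rooted_opens bl ro; have op := opensP em o.
have eb : blk (closed_map X) = blk X by []; have eo : occ (closed_map X) = occ X by [].
apply/setP => x; rewrite !inE /HP eb eo; case: (boolP (blk X x)) => bx //.
have [ax|ax] := eqVneq (al X x) x; first by rewrite /= andbF.
have e : al X x = al (closed_map X) x by case: (op_sub op x) => // e; rewrite e eqxx in ax.
by rewrite -e ax /= andbT.
Qed.

Lemma goodE X : tree X -> good X = (irregular_darts X == set0) && (nhp_darts (closed_map X) == set0).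
Proof.
move=> tX; have /andP[bl ro] := tX; have [L [em o full prs bds]] := rooted_opens bl ro.
have op := opensP em o; have [cu _ _ _] := blossomP _ bl; have alK := cu_inv cu.
have [mK mb mw] := em.
rewrite /good bl /=; apply/andP/andP.
  case=> /forallP h /allP hp; split; apply/eqP/setP => x; rewrite !inE.
    by apply/negP => /and3P[bx ax]; have /implyP/(_ ax)/andP[_ ->] := h x.
  apply/negP => /and3P[bx mx /negP[]]; have [fx|ax] := eqVneq (al X x) x.
    have [p pI ep] := bds x bx fx; have := hp p pI; rewrite ep.
    by have [e _] := prs p pI; rewrite -e ep.
  have e : al X x = al (closed_map X) x by case: (op_sub op x) => // e; rewrite e eqxx in ax.
  by have /implyP/(_ ax)/andP[+ _] := h x; rewrite /HP e.
case=> /eqP/setP ir /eqP/setP nh.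
have hpb x : blk X x -> ~~ (occ X x && occ X (al (closed_map X) x)).
  move=> bx; have mx : al (closed_map X) x != x by apply: contraTneq bx => /mw.
  by have := nh x; rewrite !inE bx mx /= => /negbFE.
have blackcase z : blk X z -> al X z != z -> HP X z && regular X z.
  move=> bz az; have := ir z; rewrite !inE bz az /= => /negbFE ->; rewrite andbT /HP.
  by case: (op_sub op z) => [e|->]; [rewrite e eqxx in az | exact: hpb].
split; last by apply/allP => p pI; have [<- bp] := prs p pI; exact: hpb.
apply/forallP => x; apply/implyP => ax.
have [bx|wx] := boolP (blk X x); first exact: blackcase.
rewrite -(HP_mate _ alK) -(regular_mate bl ax); apply: blackcase.
  by rewrite (cu_bip cu).
by rewrite alK eq_sym.
Qed.

(** Admissibility is equality of two sets of darts, which [signed_interval] turns into a signed sum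
    over the sets [S] between them. After exchanging the sums, [tree_count] evaluates the inner
    one. *)
Lemma admissible_sum_cl M : tmap M ->
  \sum_(X : dstruct T | [&& tree X, admissible X & closed_map X == M]) (-1) ^+ nNHP X
    = (nhp_darts M == set0)%:Z.
Proof.
move=> tm; rewrite -(signed_reach tm).
transitivity (\sum_(X : dstruct T | tree X && (closed_map X == M))
    \sum_(S : {set T} | (irregular_darts X \subset S) && (S \subset nhp_darts X)) (-1) ^+ #|S| : int).
  rewrite [RHS](bigID (@admissible T)) /= [X in _ + X]big1 ?addr0 => [|X]; last first.
    case/andP => /andP[/andP[bl _] _]; rewrite admissibleE // signed_interval.
    by move=> /negPf ->.
  apply: eq_big => [X|X]; first by rewrite andbCA andbC.
  case/and3P => /andP[bl _] + _; rewrite admissibleE // signed_interval => e.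
  by rewrite e (eqP e) nNHPE //; have [] := blossomP _ bl.
rewrite (exchange_big_dep (fun S => S \subset nhp_darts M)) /=; last first.
  move=> X S /andP[tX /eqP <-] /andP[_]; rewrite (nhp_cl tX) => h.
  exact: subset_trans h (subsetIl _ _).
apply: eq_bigr => S SN; rewrite -(tree_count tm SN) -natz mulr_natr -sumr_const.
apply: eq_bigl => X; rewrite inE; case: (boolP (tree X)) => tX; last by rewrite !andFb.
case: (eqVneq (closed_map X) M) => [eX|_]; last by rewrite !andbF !andFb.
by rewrite !andTb (nhp_cl tX) eX subsetI SN.
Qed.

Lemma good_count_cl M : tmap M ->
  #|[set X | [&& tree X, good X & closed_map X == M]]| = (nhp_darts M == set0).
Proof.
move=> tm; have [N0|N1] := eqVneq (nhp_darts M) set0; last first.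
  apply/eqP; rewrite cards_eq0; apply/eqP/setP => X; rewrite !inE.
  apply/negP => /and3P[tX + /eqP eX]; rewrite goodE // eX.
  by case/andP => _ /eqP e; rewrite e eqxx in N1.
have := signed_reach tm; rewrite N0 eqxx (big_pred1 set0) => [|S]; last by rewrite /= subset0.
rewrite cards0 expr0 mul1r; have := @tree_count M tm set0 (sub0set _).
case: [forall y, _] => // + _; rewrite /= => <-.
apply: eq_card => X; rewrite [LHS]inE [RHS]inE; case: (boolP (tree X)) => tX; last by rewrite !andFb.
rewrite !andTb goodE // sub0set subset0; case: (eqVneq (closed_map X) M) => [eX|_]; last by rewrite !andbF.
by rewrite eX N0 eqxx !andTb !andbT.
Qed.

End SignedSum.

(** * Summation over all labelled maps, fibre by fibre of the closing *)

Section LabelledSums.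
Variables (T : finType) (v : pred (dstruct T)).
Hypothesis v_cl : forall X, v (closed_map X) = v X.

Definition hp_tmap (M : dstruct T) := is_tmap M && (nhp_darts M == set0).

Lemma labelled_admissible :
  \sum_(X : dstruct T | [&& tree X, admissible X & v X]) (-1) ^+ nNHP X
    = #|[set M | hp_tmap M && v M]|%:Z.
Proof.
rewrite (partition_big (@closed_map T) (fun M => is_tmap M && v M)) /=; last first.
  by move=> X /and3P[/andP[bl ro] _ vX]; rewrite v_cl vX andbT; apply/tmapP; exact: cl_tmap.
rewrite -sum_pred_card big_mkcond; apply: eq_bigr => M _; rewrite /hp_tmap.
case: ifP => [/andP[tm vM]|/negbT]; last first.
  by rewrite negb_and => /orP[]/negPf->; rewrite ?andbF.
rewrite tm vM andbT /= -(admissible_sum_cl (tmapP _ tm)); apply: eq_bigl => X.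
case: (eqVneq (closed_map X) M) => [eX|]; last by rewrite !andbF.
by rewrite -v_cl eX vM !andbT.
Qed.

Lemma labelled_good :
  #|[set X | [&& tree X, good X & v X]]| = #|[set M | hp_tmap M && v M]|.
Proof.
apply/eqP; rewrite -eqz_nat -!sum_pred_card; apply/eqP.
transitivity (\sum_(X : dstruct T | [&& tree X, good X & v X]) 1 : int).
  by rewrite [RHS]big_mkcond; apply: eq_bigr => X _; case: ([&& _, _ & _]).
rewrite (partition_big (@closed_map T) (fun M => is_tmap M && v M)) /=; last first.
  by move=> X /and3P[/andP[bl ro] _ vX]; rewrite v_cl vX andbT; apply/tmapP; exact: cl_tmap.
rewrite big_mkcond; apply: eq_bigr => M _; rewrite /hp_tmap.
case: ifP => [/andP[tm vM]|/negbT]; last first.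
  by rewrite negb_and => /orP[]/negPf->; rewrite ?andbF.
rewrite tm vM andbT /= -(good_count_cl (tmapP _ tm)) -sum1dep_card.
rewrite (big_morph Posz PoszD (erefl 0)); apply: eq_bigl => X.
case: (eqVneq (closed_map X) M) => [eX|]; last by rewrite !andbF.
by rewrite -v_cl eX vM !andbT.
Qed.

End LabelledSums.

Lemma porbit_image (T T' : finType) (i : T -> T') (s : {perm T}) (s' : {perm T'}) x :
  (forall x, i (s x) = s' (i x)) -> porbit s' (i x) = i @: porbit s x.
Proof.
move=> h; have hn n y : i ((s ^+ n)%g y) = (s' ^+ n)%g (i y).
  by elim: n y => [|n IH] y; rewrite ?expg0 ?perm1 // !expgS !permM IH h.
apply/setP => y; apply/porbitP/imsetP => [[n ->]|[z /porbitP[n ->] ->]].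
  by exists ((s ^+ n)%g x); rewrite ?hn // mem_porbit.
by exists n; rewrite hn.
Qed.

Lemma imset_set_inj (T T' : finType) (i : T -> T') :
  injective i -> injective (fun A : {set T} => i @: A).
Proof.
move=> inj A B e; apply/setP => x.
by rewrite -(mem_imset _ _ inj) e (mem_imset _ _ inj).
Qed.

(** * Relabelling *)

Section Relabel.
Variable T : finType.
Implicit Types (X Y M : dstruct T) (p q : {perm T}).

Definition relabel p X : dstruct T :=
  ((sg X ^ p)%g, (al X ^ p)%g, [ffun x => blk X (p^-1%g x)],
   [ffun x => occ X (p^-1%g x)], p (rt X)).

Lemma sg_relabel p X x : sg (relabel p X) (p x) = p (sg X x).
Proof. exact: permJ. Qed.
Lemma al_relabel p X x : al (relabel p X) (p x) = p (al X x).
Proof. exact: permJ. Qed.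
Lemma blk_relabel p X x : blk (relabel p X) (p x) = blk X x.
Proof. by rewrite ffunE permK. Qed.
Lemma occ_relabel p X x : occ (relabel p X) (p x) = occ X x.
Proof. by rewrite ffunE permK. Qed.

Lemma rt_relabel p X : rt (relabel p X) = p (rt X).
Proof. by []. Qed.

Definition relabelE := (sg_relabel, al_relabel, blk_relabel, occ_relabel).

Lemma perm_forall p (P : T -> Prop) : (forall x, P (p x)) -> forall y, P y.
Proof. by move=> h y; rewrite -(permKV p y). Qed.

Lemma isoP X Y : reflect (exists p, Y = relabel p X) (iso X Y).
Proof.
apply: (iffP existsP) => -[p].
  case/andP => /forallP h /eqP r; exists p.
  have e4 x : [/\ p (sg X x) = sg Y (p x), p (al X x) = al Y (p x),
                  blk Y (p x) = blk X x & occ Y (p x) = occ X x].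
    by have /and4P[/eqP ? /eqP ? /eqP ? /eqP ?] := h x.
  case: Y h r e4 => [[[[s a] b] o] z] /= _ er e4; rewrite /relabel er.
  congr (_, _, _, _, _).
  - by apply/permP; apply: (perm_forall (p := p)) => x; rewrite permJ; have [-> _ _ _] := e4 x.
  - by apply/permP; apply: (perm_forall (p := p)) => x; rewrite permJ; have [_ -> _ _] := e4 x.
  - by apply/ffunP; apply: (perm_forall (p := p)) => x; rewrite ffunE permK; have [_ _ <- _] := e4 x.
  - by apply/ffunP; apply: (perm_forall (p := p)) => x; rewrite ffunE permK; have [_ _ _ <-] := e4 x.
move=> ->; exists p; rewrite eqxx andbT; apply/forallP => x.
by rewrite !relabelE !eqxx.
Qed.

Lemma relabelM p q X : relabel q (relabel p X) = relabel (p * q)%g X.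
Proof.
rewrite /relabel /sg /al /blk /occ /rt /=; congr (_, _, _, _, _); rewrite ?conjgM ?permM //.
all: by apply/ffunP => x; rewrite !ffunE invMg permM.
Qed.

Lemma relabel1 X : relabel 1%g X = X.
Proof.
case: X => [[[[s a] b] o] r]; rewrite /relabel /sg /al /blk /occ /rt /= !conjg1 perm1.
by congr (_, _, _, _, _); apply/ffunP => x; rewrite ffunE invg1 perm1.
Qed.

Lemma relabel_inj X p q : gconnected (sg X) (al X) -> relabel p X = relabel q X -> p = q.
Proof.
move=> co e; apply/permP => y; have /connectP[s] := co (rt X) y.
have : p (rt X) = q (rt X) by rewrite -[LHS]/(rt (relabel p X)) e.
elim: s (rt X) => [|z s IH] x px /=; first by move=> _ ->.
case/andP => st pz; apply: IH => //; case/orP: st => /eqP ->.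
  by rewrite -!sg_relabel e px.
by rewrite -!al_relabel e px.
Qed.

Section Classes.
Variables (P : pred (dstruct T)) (w : dstruct T -> int).
Hypothesis P_relabel : forall p X, P X -> P (relabel p X).
Hypothesis P_con : forall X, P X -> gconnected (sg X) (al X).
Hypothesis w_relabel : forall p X, P X -> w (relabel p X) = w X.

Let orb X := [set Y | P Y && iso X Y].

Let orbE X : P X -> orb X = [set relabel p X | p : {perm T}].
Proof.
move=> PX; apply/setP => Y; rewrite inE; apply/andP/imsetP.
  by case=> _ /isoP[p ->]; exists p.
by case=> p _ ->; split; [exact: P_relabel | apply/isoP; exists p].
Qed.

Let orb_id X : P X -> X \in orb X.
Proof. by move=> PX; rewrite inE PX; apply/isoP; exists 1%g; rewrite relabel1. Qed.

Let orb_eq X Y : P X -> (P Y && (orb Y == orb X)) = (Y \in orb X).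
Proof.
move=> PX; apply/idP/idP => [/andP[PY /eqP <-]|]; first exact: orb_id.
rewrite inE => /andP[PY /isoP[p eY]]; rewrite PY /=; apply/eqP/setP => Z.
rewrite !inE; case: (P Z) => //=; apply/isoP/isoP => -[q eZ].
  by exists (p * q)%g; rewrite -relabelM -eY.
by exists (p^-1 * q)%g; rewrite eY relabelM mulKVg.
Qed.

(** By rigidity a class is in bijection with the permutations of [T]. The weight is invariant, so
    the representative picked does not matter. *)
Lemma class_sum :
  (\sum_(C in iso_classes P) (if [pick X in C] is Some X then w X else 0)) * (#|T|`!)%:Z
    = \sum_(X | P X) w X.
Proof.
rewrite (partition_big_imset orb) /= mulr_suml.
have -> : iso_classes P = [set orb X | X in P].
  by apply/setP => C; apply/imsetP/imsetP => -[X]; rewrite ?inE => XP ->; exists X; rewrite ?inE.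
apply: eq_bigr => C /imsetP[X PX ->].
rewrite (eq_bigl _ _ (fun Y => orb_eq Y PX)).
rewrite (eq_bigr (fun=> w X)) => [|Y]; last first.
  by rewrite inE => /andP[_ /isoP[p ->]]; exact: w_relabel.
rewrite sumr_const orbE // card_imset; last by move=> p q; apply: relabel_inj; exact: P_con.
rewrite -orbE //; case: pickP => [Y|/(_ X)]; last by rewrite orb_id.
rewrite inE => /andP[_ /isoP[p ->]]; rewrite w_relabel // -mulr_natr natz; congr (_ * Posz _).
rewrite -[RHS]cardsT -[in LHS](cardsT T) -card_perm; apply: eq_card => q.
by rewrite [RHS]inE; apply/subsetP => x _; rewrite in_setT.
Qed.

End Classes.

Lemma class_card (P : pred (dstruct T)) :
    (forall p X, P X -> P (relabel p X)) -> (forall X, P X -> gconnected (sg X) (al X)) ->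
  (#|iso_classes P| * #|T|`! = #|[set X | P X]|)%N.
Proof.
move=> h1 h2; have := @class_sum P (fun=> 1) h1 h2 (fun _ _ _ => erefl).
move=> e; apply/eqP; rewrite -eqz_nat PoszM; apply/eqP; move: e.
rewrite (eq_bigr (fun=> 1)) => [|C /imsetP[X PX ->]]; last first.
  case: pickP => // /(_ X) /negP[]; rewrite inE; apply/andP; split.
    by rewrite inE in PX.
  by apply/isoP; exists 1%g; rewrite relabel1.
rewrite sumr_const natz => ->; rewrite -sum1dep_card (big_morph Posz PoszD (erefl 0)).
by [].
Qed.

End Relabel.

Lemma connect_homo (T T' : finType) (e : rel T) (e' : rel T') (f : T -> T') x y :
  (forall a b, e a b -> e' (f a) (f b)) -> connect e x y -> connect e' (f x) (f y).
Proof.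
move=> h /connectP[p]; elim: p x => [|z p IH] x /=; first by move=> _ ->; exact: connect0.
by move=> /andP[/h xz pz] ey; apply: connect_trans (connect1 xz) (IH z pz ey).
Qed.

Lemma fcycle_map (T : finType) (f f' : T -> T) (h : T -> T) s :
  (forall x, f' (h x) = h (f x)) -> fcycle f s -> fcycle f' (map h s).
Proof.
move=> hf; case: s => //= x s; rewrite -map_rcons path_map; apply: sub_path => a b /= /eqP <-.
by rewrite hf.
Qed.

(** * Invariance under relabelling *)

Section Invariance.
Variable T : finType.
Implicit Types (X Y M : dstruct T) (p q : {perm T}).

Lemma connect_perm (e e' : rel T) p x y : (forall a b, e' (p a) (p b) = e a b) ->
  connect e' (p x) (p y) = connect e x y.
Proof.
move=> h; apply/idP/idP; last by apply: connect_homo => a b; rewrite h.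
move=> c; rewrite -[x](permK p) -[y](permK p); move: c; apply: connect_homo => a b.
by rewrite -h !permKV.
Qed.

Lemma cut_conj al p b : cut (al ^ p)%g (p b) = (cut al b ^ p)%g.
Proof. by rewrite /cut permJ conjMg tpermJ. Qed.

Lemma gconnect_conj sg al p x y :
  connect (gstep (sg ^ p)%g (al ^ p)%g) (p x) (p y) = connect (gstep sg al) x y.
Proof. by apply: connect_perm => a b; rewrite /gstep !permJ !(inj_eq perm_inj). Qed.

Lemma opens_conj sg (blk blk' : pred T) rt m al L p : (forall x, blk' (p x) = blk x) ->
  opening sg blk rt m al L ->
  opening (sg ^ p)%g blk' (p rt) (m ^ p)%g (al ^ p)%g (map p L).
Proof.
have phiJ (a : {perm T}) x : face_step (sg ^ p)%g (a ^ p)%g (p x) = p (face_step sg a x) by rewrite /face_step !permJ.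
move=> bE; elim=> {al L} [L uL cL rL lL mr fL c3|al A b B V _ IH bb alb cV lV u].
  apply: Opens0.
  - by rewrite map_inj_uniq //; exact: perm_inj.
  - exact: fcycle_map (phiJ m) cL.
  - exact: map_f.
  - by rewrite last_map lL.
  - by rewrite permJ mr.
  - apply: (perm_forall (p := p)) => x; rewrite permJ => /perm_inj/fL xL; exact: map_f.
  - by rewrite count_map -c3; apply: eq_count => x /=; rewrite permJ (inj_eq perm_inj).
rewrite -cut_conj map_cat /= map_cat; apply: OpensS.
- by move: IH; rewrite map_cat.
- by rewrite bE.
- by rewrite permJ (inj_eq perm_inj).
- exact: fcycle_map (phiJ al) cV.
- by rewrite last_map lV permJ.
- by rewrite -map_cat -map_cons -map_cat map_inj_uniq //; exact: perm_inj.
Qed.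

Lemma cubic_relabel p X : cubic X -> cubic (relabel p X).
Proof.
case=> h1 h2 h3 h4 h5 h6; split; apply: (perm_forall (p := p)) => x; rewrite ?relabelE.
- by rewrite (inj_eq perm_inj).
- by rewrite ?relabelE h2.
- by rewrite ?relabelE h3.
- by rewrite h4.
- by rewrite h5.
- by rewrite ?relabelE (inj_eq perm_inj); exact: h6.
Qed.

Lemma gconnected_relabel p X : gconnected (sg X) (al X) ->
  gconnected (sg (relabel p X)) (al (relabel p X)).
Proof.
move=> co; apply: (perm_forall (p := p)) => x; apply: (perm_forall (p := p)) => y.
by rewrite gconnect_conj.
Qed.

Lemma blossom_relabel p X : is_blossom X -> is_blossom (relabel p X).
Proof.
case/blossomP => cu co fo c3; apply/blossomP; split.
- exact: cubic_relabel.
- exact: gconnected_relabel.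
- apply: (perm_forall (p := p)) => x; rewrite al_relabel (inj_eq perm_inj) => ax.
  by rewrite -[al _]/(al X ^ p)%g cut_conj gconnect_conj; exact: fo.
- rewrite (reindex_inj (@perm_inj _ p)) /= -c3; apply: eq_bigr => x _.
  by rewrite /dart_charge !relabelE (inj_eq perm_inj).
Qed.

(** [contour] depends on the enumeration of [T], so the closing is not visibly equivariant. Being an
    opening is, and an opening determines its closing. *)
Lemma tree_relabel p X : tree X ->
  tree (relabel p X) /\ closed_map (relabel p X) = relabel p (closed_map X).
Proof.
case/andP => bl ro; have [L [em o full _ _]] := rooted_opens bl ro.
have o' := opens_conj (blk_relabel p X) o.
have em' : edge_perm (blk (relabel p X)) (al (closed_map X) ^ p)%g.
  have [mK mb mw] := em; split; apply: (perm_forall (p := p)) => x; rewrite ?permJ.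
  - by rewrite mK.
  - by rewrite !relabelE (inj_eq perm_inj); exact: mb.
  - by move/perm_inj; rewrite relabelE; exact: mw.
have full' : forall y, y \in map p L.
  by apply: (perm_forall (p := p)) => x; rewrite map_f.
have bl' := blossom_relabel p bl.
have ro' := opens_rooted bl' em' o' full'.
split; first by rewrite /tree bl' ro'.
have [L2 [em2 o2 _ _ _]] := rooted_opens bl' ro'.
have e : al (closed_map (relabel p X)) = (al (closed_map X) ^ p)%g := opens_mate_unique em2 em' o2 o'.
by rewrite -[LHS]set_al_id e.
Qed.

Lemma HP_relabel p X x : HP (relabel p X) (p x) = HP X x.
Proof. by rewrite /HP !relabelE. Qed.

Lemma qpart_relabel p X x z : qpart (relabel p X) (p x) (p z) = qpart X x z.
Proof.
rewrite /qpart (reindex_inj (@perm_inj _ p)) /=; apply: eq_big => y; last by move=> _; rewrite blk_relabel.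
rewrite relabelE (inj_eq perm_inj); congr (_ && _); apply: connect_perm => a b.
by rewrite /step_wo !relabelE !(inj_eq perm_inj).
Qed.

Lemma regular_relabel p X x : regular (relabel p X) (p x) = regular X x.
Proof.
rewrite /regular !relabelE; case: (blk X x); by rewrite !relabelE !qpart_relabel.
Qed.

Lemma irregular_relabel p X : irregular_darts (relabel p X) = p @: irregular_darts X.
Proof.
apply/setP; apply: (perm_forall (p := p)) => x; rewrite mem_imset; last exact: perm_inj.
by rewrite !inE !relabelE regular_relabel (inj_eq perm_inj).
Qed.

Lemma nhp_relabel p X : nhp_darts (relabel p X) = p @: nhp_darts X.
Proof.
apply/setP; apply: (perm_forall (p := p)) => x; rewrite mem_imset; last exact: perm_inj.
by rewrite !inE !relabelE HP_relabel (inj_eq perm_inj).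
Qed.

Lemma nNHP_relabel p X : cubic X -> nNHP (relabel p X) = nNHP X.
Proof.
move=> cu; rewrite !nNHPE //; last exact: cubic_relabel.
by rewrite nhp_relabel card_imset //; exact: perm_inj.
Qed.

Lemma vcount_image (T' : finType) (i : T -> T') (s : {perm T}) (s' : {perm T'})
    (P : pred T) (P' : pred T') :
    injective i -> (forall x, i (s x) = s' (i x)) -> (forall x, P' (i x) = P x) ->
    (forall y, P' y -> exists x, y = i x) ->
  vcount s' P' = vcount s P.
Proof.
move=> inj is_ PE Pi; rewrite /vcount -(card_imset _ (imset_set_inj inj)).
apply: eq_card => C; apply/imsetP/imsetP.
  case=> y; rewrite inE => Py ->; have [x ex] := Pi y Py; exists (porbit s x).
    by apply: imset_f; rewrite inE -PE -ex.
  by rewrite ex (porbit_image _ is_).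
case=> D /imsetP[x]; rewrite inE => Px -> ->; exists (i x); first by rewrite inE PE.
by rewrite (porbit_image _ is_).
Qed.

Lemma vcounts_relabel p X a b c d : vcounts (relabel p X) a b c d = vcounts X a b c d.
Proof.
have vE P P' : (forall x, P' (p x) = P x) -> vcount (sg (relabel p X)) P' = vcount (sg X) P.
  move=> PE; apply: (vcount_image (i := p)) PE _; first exact: perm_inj.
    by move=> x; rewrite relabelE.
  by move=> y; exists (p^-1%g y); rewrite permKV.
by rewrite /vcounts; do 3?congr (_ && _); congr (_ == _); apply: vE => x; rewrite !relabelE.
Qed.

Lemma card_porbits_conj (s : {perm T}) p : #|porbits (s ^ p)%g| = #|porbits s|.
Proof.
have e (t : {perm T}) : #|porbits t| = vcount t predT.
  by apply: eq_card => C; apply/imsetP/imsetP => -[x _ ->]; exists x; rewrite ?inE.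
rewrite !e; apply: (vcount_image (i := p)) => //; first exact: perm_inj.
  by move=> x; rewrite permJ.
by move=> y; exists (p^-1%g y); rewrite permKV.
Qed.

Lemma tmap_relabel p M : tmap M -> tmap (relabel p M).
Proof.
case=> cu co wh c3 rr fa eu; split.
- exact: cubic_relabel.
- exact: gconnected_relabel.
- by apply: (perm_forall (p := p)) => x; rewrite !relabelE => /perm_inj/wh.
- rewrite -c3 -(card_imset [set x | al M x == x] (@perm_inj _ p)); apply: eq_card.
  apply: (perm_forall (p := p)) => x; rewrite mem_imset; last exact: perm_inj.
  by rewrite !inE relabelE (inj_eq perm_inj).
- exact: etrans (al_relabel p M (rt M)) (congr1 p rr).
- apply: (perm_forall (p := p)) => x; rewrite relabelE => /perm_inj/fa xr.
  have -> : rt (relabel p M) = p (rt M) by [].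
  rewrite (@porbit_image _ _ p (al M * sg M)%g).
    by rewrite mem_imset //; exact: perm_inj.
  by move=> y; rewrite [in LHS]permM [in RHS]permM !relabelE.
- rewrite -[sg _]/(sg M ^ p)%g -[al _]/(al M ^ p)%g -conjMg !card_porbits_conj eu.
  congr (_ + _)%N; rewrite /nedges -(card_imset [set x | (al M x != x) && blk M x] (@perm_inj _ p)).
  apply: eq_card; apply: (perm_forall (p := p)) => x; rewrite mem_imset; last exact: perm_inj.
  by rewrite !inE permJ relabelE (inj_eq perm_inj).
Qed.

Lemma imset_eq0_inj (f : T -> T) (A : {set T}) : (f @: A == set0) = (A == set0).
Proof. by rewrite -!subset0 sub_imset_pre preimset0 subset0. Qed.

Lemma admissible_relabel p X : admissible X -> admissible (relabel p X).
Proof.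
move=> ad; have bl : is_blossom X by case/andP: ad.
move: ad; rewrite !admissibleE ?blossom_relabel // irregular_relabel nhp_relabel => /eqP->.
exact: eqxx.
Qed.

Lemma good_relabel p X : tree X -> good X -> good (relabel p X).
Proof.
move=> tX; have [tY eY] := tree_relabel p tX; rewrite !goodE // eY.
by rewrite irregular_relabel nhp_relabel !imset_eq0_inj.
Qed.

Lemma hp_tmap_relabel p M : hp_tmap M -> hp_tmap (relabel p M).
Proof.
case/andP => /tmapP tm N0; apply/andP; split; first by apply/tmapP; exact: tmap_relabel.
by rewrite nhp_relabel imset_eq0_inj.
Qed.

End Invariance.

Section TreeClasses.
Variables (nb nw nbo nwo : nat).
Local Notation TD := (tree_darts nb nw nbo nwo).

Definition hp_tmap_v : pred (dstruct TD) := fun M => hp_tmap M && vcounts M nb nw nbo nwo.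

Lemma adm_treeE X : adm_tree nb nw nbo nwo X = [&& tree X, admissible X & vcounts X nb nw nbo nwo].
Proof.
rewrite /adm_tree /tree /admissible; case: (is_blossom X) => //=.
by rewrite andbCA.
Qed.

Lemma good_treeE X : good_tree nb nw nbo nwo X = [&& tree X, good X & vcounts X nb nw nbo nwo].
Proof.
rewrite /good_tree /tree /good; case: (is_blossom X) => //=.
by rewrite -!andbA; do !bool_congr.
Qed.

Lemma tree_con (T : finType) (X : dstruct T) : tree X -> gconnected (sg X) (al X).
Proof. by case/andP => /blossomP[]. Qed.

Lemma tmap_classes : #|iso_classes (good_tree nb nw nbo nwo)| = #|iso_classes hp_tmap_v|.
Proof.
apply/eqP; rewrite -(eqn_pmul2r (fact_gt0 #|TD|)) !class_card.
- rewrite -(@labelled_good TD (fun X => vcounts X nb nw nbo nwo)) //; apply/eqP.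
  by apply: eq_card => X; rewrite !inE good_treeE.
- by move=> p X /andP[hX vX]; rewrite /hp_tmap_v hp_tmap_relabel ?vcounts_relabel.
- by move=> X /andP[/andP[/tmapP tm _] _]; exact: tm_con.
- move=> p X; rewrite !good_treeE => /and3P[tX gX vX].
  by rewrite good_relabel // vcounts_relabel vX andbT; have [->] := tree_relabel p tX.
- by move=> X; rewrite good_treeE => /and3P[/tree_con].
Qed.

Lemma admissible_classes :
  \sum_(C in iso_classes (adm_tree nb nw nbo nwo)) class_sign C = #|iso_classes hp_tmap_v|%:Z.
Proof.
have f0 : (#|TD|`!)%:Z != 0 by rewrite eqz_nat -lt0n fact_gt0.
apply: (mulIf f0); rewrite -PoszM class_card.
- rewrite class_sum.
  + rewrite -(@labelled_admissible TD (fun X => vcounts X nb nw nbo nwo)) //.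
    by apply: eq_bigl => X; rewrite adm_treeE.
  + move=> p X; rewrite !adm_treeE => /and3P[tX aX vX].
    by rewrite admissible_relabel // vcounts_relabel vX andbT; have [->] := tree_relabel p tX.
  + by move=> X; rewrite adm_treeE => /and3P[/tree_con].
  + move=> p X; rewrite adm_treeE => /and3P[/andP[bl _] _ _].
    by rewrite nNHP_relabel //; have [] := blossomP _ bl.
- by move=> p X /andP[hX vX]; rewrite /hp_tmap_v hp_tmap_relabel ?vcounts_relabel.
- by move=> X /andP[/andP[/tmapP tm _] _]; exact: tm_con.
Qed.

End TreeClasses.

(** * Removing the root vertex *)

Lemma vcount_extend (T T' : finType) (i : T -> T') (s : {perm T}) (s' : {perm T'})
    (P : pred T) (P' : pred T') r :
    injective i -> (forall x, i (s x) = s' (i x)) -> (forall x, P' (i x) = P x) ->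
    P' r -> (forall x, r != i x) -> (forall y, y \in porbit s' r \/ exists x, y = i x) ->
  vcount s' P' = (vcount s P).+1.
Proof.
move=> inj is_ PE Pr ri cov; rewrite /vcount -(card_imset _ (imset_set_inj inj)).
pose B := [set i @: (C : {set T}) | C in [set porbit s x | x : T & P x]]; rewrite -/B.
set A := [set porbit s' y | y : T' & P' y].
have rB : porbit s' r \notin B.
  apply/imsetP => -[C /imsetP[x _ ->]] /setP/(_ r); rewrite porbit_id => /esym/imsetP[z _ e].
  by have := ri z; rewrite -e eqxx.
suff -> : A = porbit s' r |: B by rewrite cardsU1 rB.
apply/setP => C; rewrite in_setU1; apply/imsetP/orP.
  case=> y; rewrite inE => Py ->; case: (cov y) => [yr|[x ex]].
    by left; rewrite eq_porbit_mem.
  right; apply/imsetP; exists (porbit s x).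
    by apply: imset_f; rewrite inE -PE -ex.
  by rewrite ex (porbit_image _ is_).
case=> [/eqP->|/imsetP[D /imsetP[x]]]; first by exists r; rewrite ?inE.
by rewrite inE => Px -> ->; exists (i x); rewrite ?inE ?PE // (porbit_image _ is_).
Qed.

Lemma vcountT (T : finType) (t : {perm T}) : vcount t predT = #|porbits t|.
Proof. by apply: eq_card => C; apply/imsetP/imsetP => -[x _ ->]; exists x; rewrite ?inE. Qed.

Section Bicubic.
Variable T : finType.
Implicit Types Y : dstruct T.

Record bicubic Y : Prop := Bicubic {
  bc_cubic : cubic Y;
  bc_inner : forall x, al Y x != x;
  bc_hp : forall x, HP Y x;
  bc_con : gconnected (sg Y) (al Y);
  bc_euler : (#|porbits (sg Y)| + #|porbits (al Y * sg Y)%g| = nedges (blk Y) (al Y) + 2)%N;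
  bc_rblk : blk Y (rt Y);
  bc_rocc : ~~ occ Y (rt Y) }.

(** Matches the edge count in the definition of a bicubic map with [nedges]: each orbit has exactly
    one dart satisfying [b]. *)
Lemma card_porbits_involution (a : {perm T}) (b : pred T) : involutive a ->
  (forall x, b (a x) = ~~ b x) -> #|porbits a| = nedges b a.
Proof.
move=> aK ba; have po x y : (y \in porbit a x) = (y == x) || (y == a x).
  apply/idP/orP => [|[/eqP->|/eqP->]]; [|exact: porbit_id|exact: (mem_porbit a 1)].
  move=> h; apply/orP; apply: (porbit_closed (P := fun y => (y == x) || (y == a x))) h.
    by move=> z /orP[/eqP->|/eqP->]; rewrite ?aK eqxx ?orbT.
  by rewrite eqxx.
have na x : a x != x by apply/eqP => e; have := ba x; rewrite e; case: (b x).
rewrite /nedges -(card_in_imset (f := porbit a)); last first.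
  move=> x y; rewrite !inE => /andP[_ bx] /andP[_ b_y] /setP/(_ x).
  rewrite porbit_id po => /esym/orP[/eqP//|/eqP e].
  by move: bx; rewrite e ba b_y.
apply: eq_card => C; apply/imsetP/imsetP => -[x _ ->]; last by exists x.
have [bx|wx] := boolP (b x); first by exists x; rewrite // inE na.
exists (a x); first by rewrite inE na ba.
by apply/eqP; rewrite eq_porbit_mem porbit_sym po eqxx orbT.
Qed.

Lemma bicubicP Y : reflect (bicubic Y) (is_bicubic_hp Y).
Proof.
apply: (iffP idP).
  case/and5P => h1 /forallP h2 h3 /forallP h4 /and4P[/forallP h5 /connectedP h6 /eqP h7 /andP[h8 h9]].
  have cu : cubic Y.
    apply/cubicP/and4P; split=> //; first by apply/forallP => x; case/andP: (h2 x).
    by apply/forallP => x; apply/implyP.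
  have fi x : al Y x != x by case/andP: (h2 x).
  split=> //; rewrite h7 (@card_porbits_involution _ (blk Y)) //; first exact: cu_inv cu.
  by move=> x; exact: cu_bip cu _ (fi x).
case=> cu fi hp co eu rb ro; have /cubicP/and4P[h1 /forallP h2 h3 /forallP h4] := cu.
apply/and5P; split=> //.
- by apply/forallP => x; rewrite fi h2.
- by apply/forallP => x; move/implyP: (h4 x) => /(_ (fi x)).
- apply/and4P; split; [exact/forallP | exact/connectedP | | by rewrite rb].
  rewrite eu (@card_porbits_involution _ (blk Y)) //; first exact: cu_inv cu.
  by move=> x; exact: cu_bip cu _ (fi x).
Qed.

Definition rdart Y y := [|| y == rt Y, y == sg Y (rt Y) | y == sg Y (sg Y (rt Y))].

Lemma rdart_sg Y y : cubic Y -> rdart Y (sg Y y) = rdart Y y.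
Proof.
move=> cu; have e z : (sg Y y == z) = (y == sg Y (sg Y z)).
  by rewrite -[in LHS](cu_three cu z) (inj_eq perm_inj).
by rewrite /rdart !e !(cu_three cu) orbC -orbA orbA orbC orbA [_ || (y == rt Y)]orbC -orbA.
Qed.

Lemma rdart_blk Y y : cubic Y -> rdart Y y -> blk Y y = blk Y (rt Y) /\ occ Y y = occ Y (rt Y).
Proof. by move=> cu /or3P[]/eqP->; rewrite ?(cu_blk cu) ?(cu_occ cu). Qed.

Lemma rdart_porbit Y y : rdart Y y -> y \in porbit (sg Y) (rt Y).
Proof.
case/or3P => /eqP->; first exact: porbit_id.
  exact: (mem_porbit (sg Y) 1).
exact: porbit_trans (mem_porbit (sg Y) 1 _) (mem_porbit (sg Y) 1 _).
Qed.

End Bicubic.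

Section Embedding.
Variables T T' : finType.
Implicit Types (X : dstruct T) (Y : dstruct T').

(* [X] is the map [Y] with its root vertex removed. *)
Record emb (i : T -> T') X Y : Prop := Emb {
  em_inj : injective i;
  em_nroot : forall x, ~~ rdart Y (i x);
  em_cover : forall y, ~~ rdart Y y -> exists x, y = i x;
  em_sg : forall x, i (sg X x) = sg Y (i x);
  em_blk : forall x, blk Y (i x) = blk X x;
  em_occ : forall x, occ Y (i x) = occ X x;
  em_al : forall x, al X x != x -> al Y (i x) = i (al X x);
  em_leaf : forall x, al X x = x -> rdart Y (al Y (i x));
  em_root : al Y (rt Y) = i (rt X) }.

Section Counts.
Variables (i : T -> T') (X : dstruct T) (Y : dstruct T').
Hypotheses (em : emb i X Y) (cuY : cubic Y).
Hypothesis innerY : forall y, al Y y != y.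
Hypothesis rbY : blk Y (rt Y).
Hypothesis whX : forall x, al X x = x -> ~~ blk X x.

Let alK := cu_inv cuY.
Let inj := em_inj em.

Lemma rdart_mate y : rdart Y y -> exists2 x, al X x = x & al Y y = i x.
Proof.
move=> ry; have [by_ _] := rdart_blk cuY ry.
have : ~~ rdart Y (al Y y).
  by apply/negP => /(rdart_blk cuY)[+ _]; rewrite (cu_bip cuY) ?innerY // by_ rbY.
case/(em_cover em) => x ex; exists x => //; apply/eqP; apply: contraT => nx.
by have := em_al em nx; rewrite -ex alK => e; move: ry; rewrite e (negPf (em_nroot em _)).
Qed.

Lemma root_neq x : rt Y != i x.
Proof. by apply: contraNneq (em_nroot em x) => <-; rewrite /rdart eqxx. Qed.

Lemma emb_dichotomy y : y \in porbit (sg Y) (rt Y) \/ exists x, y = i x.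
Proof. by have [/rdart_porbit|/(em_cover em)] := boolP (rdart Y y); [left | right]. Qed.

Lemma emb_vertices : #|porbits (sg Y)| = #|porbits (sg X)|.+1.
Proof.
rewrite -!vcountT; apply: (vcount_extend (i := i) (r := rt Y)) => //.
- exact: em_sg em.
- exact: root_neq.
- exact: emb_dichotomy.
Qed.

Lemma root_distinct : [/\ rt Y != sg Y (rt Y), rt Y != sg Y (sg Y (rt Y))
  & sg Y (rt Y) != sg Y (sg Y (rt Y))].
Proof.
split; [by rewrite eq_sym (cu_neq cuY)| |by rewrite (inj_eq perm_inj) eq_sym (cu_neq cuY)].
by rewrite -{1}(cu_three cuY (rt Y)) (cu_neq cuY).
Qed.

Lemma card_rdart : #|[set y | rdart Y y]| = 3%N.
Proof.
have [n1 n2 n3] := root_distinct.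
have -> : [set y | rdart Y y] = [set rt Y; sg Y (rt Y); sg Y (sg Y (rt Y))].
  by apply/setP => y; rewrite !inE -orbA.
by rewrite setUC cardsU1 cards2 !inE n1 ![sg Y (sg Y _) == _]eq_sym (negPf n2) (negPf n3).
Qed.

Lemma emb_edges : nedges (blk Y) (al Y) = (nedges (blk X) (al X) + 3)%N.
Proof.
rewrite /nedges -card_rdart -(card_imset [set x | (al X x != x) && blk X x] inj) -cardsUI.
rewrite [X in (_ + X)%N](_ : _ = 0%N) ?addn0.
  apply: eq_card => y; rewrite !inE innerY /=.
  have [ry|/(em_cover em)[x ->]] := boolP (rdart Y y).
    by have [-> _] := rdart_blk cuY ry; rewrite rbY orbT.
  rewrite (mem_imset _ _ inj) inE (em_blk em) orbF.
  by have [/whX/negPf->|] := eqVneq (al X x) x; rewrite ?andbF.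
apply/eqP; rewrite cards_eq0; apply/eqP/setP => y; rewrite !inE.
by apply/negP => /andP[/imsetP[x _ ->]]; exact/negP/(em_nroot em).
Qed.

Section Faces.
Variables ra rb rc : T'.
Hypothesis rE : forall y, rdart Y y = [|| y == ra, y == rb | y == rc].
Hypotheses (nab : ra != rb) (nac : ra != rc) (nbc : rb != rc).

(** The three root edges are cut one after the other. In [a3] the root vertex is isolated, so the
    faces are those of [X] and one more. *)
Let a1 := cut (al Y) ra.
Let a2 := cut a1 rb.
Let a3 := cut a2 rc.
Let ra_r : rdart Y ra. Proof. by rewrite rE eqxx. Qed.
Let rb_r : rdart Y rb. Proof. by rewrite rE eqxx orbT. Qed.
Let rc_r : rdart Y rc. Proof. by rewrite rE eqxx !orbT. Qed.

Let mate_neq r r' : rdart Y r -> rdart Y r' -> r == al Y r' = false.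
Proof.
move=> rr /rdart_mate[x _ ->]; apply/negP => /eqP e.
by move: rr; rewrite e (negPf (em_nroot em x)).
Qed.

Let a1K : involutive a1 := cut_involutive ra alK.
Let a2K : involutive a2 := cut_involutive rb a1K.

Let a1b : a1 rb = al Y rb.
Proof. by rewrite /a1 cutE // eq_sym (negPf nab) mate_neq. Qed.
Let a1c : a1 rc = al Y rc.
Proof. by rewrite /a1 cutE // eq_sym (negPf nac) mate_neq. Qed.
Let a2c : a2 rc = al Y rc.
Proof. by rewrite /a2 cutE // a1b a1c eq_sym (negPf nbc) mate_neq. Qed.

Let a3_root y : rdart Y y -> a3 y = y.
Proof.
rewrite rE /a3 cutE // a2c => /or3P[]/eqP->; rewrite ?eqxx // /a2 cutE // a1b ?eqxx /=.
  by rewrite (negPf nac) (negPf nab) !mate_neq //= /a1 cutE // eqxx.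
by rewrite (negPf nbc) mate_neq.
Qed.

Let a3_old x : a3 (i x) = i (al X x).
Proof.
have nr r : rdart Y r -> (i x == r) = false.
  by move=> rr; apply/negP => /eqP e; have := em_nroot em x; rewrite e rr.
rewrite /a3 cutE // a2c /a2 cutE // a1b /a1 cutE // (nr ra) // (nr rb) // (nr rc) //=.
have [fx|nx] := eqVneq (al X x) x.
  have := em_leaf em fx; rewrite rE fx => /or3P[]/eqP e.
  - by rewrite -e alK eqxx; case: ifP => //; case: ifP.
  - by rewrite -e alK eqxx; case: ifP.
  - by rewrite -e alK eqxx.
have nl r : rdart Y r -> (i x == al Y r) = false.
  move=> rr; apply/negP => /eqP e; have := em_al em nx; rewrite e alK => e2.
  by move: rr; rewrite e2 (negPf (em_nroot em _)).
by rewrite !nl // (em_al em nx).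
Qed.

Let F3 : #|porbits (a3 * sg Y)%g| = #|porbits (al X * sg X)%g|.+1.
Proof.
rewrite -!vcountT; apply: (vcount_extend (i := i) (r := rt Y)) => //.
- by move=> x; rewrite [in LHS]permM [in RHS]permM a3_old (em_sg em).
- exact: root_neq.
move=> y; have [ry|/(em_cover em)] := boolP (rdart Y y); last by right.
left; have r0 : rdart Y (rt Y) by rewrite /rdart eqxx.
have st z : rdart Y z -> (a3 * sg Y)%g z = sg Y z by move=> rz; rewrite permM a3_root.
have r1 : rdart Y (sg Y (rt Y)) by rewrite rdart_sg.
case/or3P: ry => /eqP->; first exact: porbit_id.
  by rewrite -st //; exact: (mem_porbit _ 1).
rewrite -(st (sg Y (rt Y))) //; apply: porbit_trans (mem_porbit _ 1 _).
by rewrite -st //; exact: (mem_porbit _ 1).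
Qed.

Let Fcut (a : {perm T'}) x : a x != x ->
  (#|porbits (cut a x * sg Y)%g| + (x \notin porbit (a * sg Y)%g (a x)).*2
     = #|porbits (a * sg Y)%g|.+1)%N.
Proof.
move=> ax; have := porbits_mul_tperm (a * sg Y)%g x (a x).
by rewrite /= eq_sym ax mulgA addn1.
Qed.

Let Fjoin (a : {perm T'}) x : a x != x ->
  (#|porbits (a * sg Y)%g| + (x \notin porbit (cut a x * sg Y)%g (a x)).*2
     = #|porbits (cut a x * sg Y)%g|.+1)%N.
Proof.
move=> ax; have := porbits_mul_tperm (cut a x * sg Y)%g x (a x).
by rewrite /= eq_sym ax addn1 /cut !mulgA tperm2 mul1g.
Qed.

(** Putting back one root edge merges the face around the isolated root vertex with a face of
    [X]. *)
Let F2 : #|porbits (a2 * sg Y)%g| = #|porbits (al X * sg X)%g|.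
Proof.
have n2 : a2 rc != rc by rewrite a2c innerY.
have := Fjoin n2; rewrite -/a3 F3.
suff -> : rc \notin porbit (a3 * sg Y)%g (a2 rc).
  by move: #|porbits (a2 * sg Y)%g| #|porbits (al X * sg X)%g| => u v /=; lia.
rewrite porbit_sym; apply/negP => h.
have : rdart Y (a2 rc).
  apply: (porbit_closed (P := rdart Y)) h => // z rz.
  by rewrite permM a3_root // rdart_sg.
by rewrite a2c; have [x _ ->] := rdart_mate rc_r; exact/negP/(em_nroot em).
Qed.

(** Each of the two other root edges adds at most one face. *)
Lemma faces_le : (#|porbits (al Y * sg Y)%g| <= #|porbits (al X * sg X)%g| + 2)%N.
Proof.
have n1 : a1 rb != rb by rewrite a1b innerY.
have := Fcut (innerY ra); have := Fcut n1; rewrite -/a1 -/a2 F2.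
move: #|porbits (al Y * sg Y)%g| #|porbits (al X * sg X)%g| #|porbits (a1 * sg Y)%g| => u v w.
by do 2!case: (_ \in _) => /=; clear; lia.
Qed.

(** To attain the bound, both of these edges must split a face: the edge of [ra] has different faces
    on its sides, and the edge of [rb] joins two darts of one face. *)
Lemma faces_split : (#|porbits (al Y * sg Y)%g| = #|porbits (al X * sg X)%g| + 2)%N ->
  ra \notin porbit (al Y * sg Y)%g (al Y ra)
  /\ rb \in porbit (a2 * sg Y)%g (al Y rb).
Proof.
have n1 : a1 rb != rb by rewrite a1b innerY.
have := Fcut (innerY ra); have := Fjoin n1; have := Fcut n1; rewrite -/a1 -/a2 F2 a1b.
move: #|porbits (al Y * sg Y)%g| #|porbits (al X * sg X)%g| #|porbits (a1 * sg Y)%g| => u v w.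
by case: (ra \in _); case: (rb \in porbit (a2 * sg Y)%g _); case: (_ \in _) => /=; clear; lia.
Qed.

(** When only the edge at [rc] is present, the face around the root vertex is the face of [X]
    through [xc]; the invariant [Z] encloses it. *)
Lemma faces_same xb xc :
  (#|porbits (al Y * sg Y)%g| = #|porbits (al X * sg X)%g| + 2)%N ->
  al Y rb = i xb -> al Y rc = i xc -> xb \in porbit (al X * sg X)%g xc.
Proof.
move=> /faces_split[_]; rewrite porbit_sym => h eb ec.
pose Z y := rdart Y y || [exists x, (y == i x) && (x \in porbit (al X * sg X)%g xc)].
have : Z (al Y rb).
  apply: (porbit_closed (P := Z)) h; last by rewrite /Z rb_r.
  have fxc : al X xc = xc.
    by have [x fx e] := rdart_mate rc_r; move: e; rewrite ec => /inj->.
  have Zi x : x \in porbit (al X * sg X)%g xc -> Z (i (sg X (al X x))).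
    move=> xo; rewrite /Z; apply/orP; right; apply/existsP; exists (sg X (al X x)).
    rewrite eqxx -[sg X _]permM /=; exact: porbit_trans xo (mem_porbit _ 1 _).
  move=> z Zz; rewrite permM.
  have [->|zc] := eqVneq z rc.
    by rewrite a2c ec -(em_sg em) -{1}fxc; apply: Zi; exact: porbit_id.
  have [->|zl] := eqVneq z (a2 rc); first by rewrite a2K /Z rdart_sg ?rc_r.
  have -> : a2 z = a3 z by rewrite /a3 cutE // (negPf zc) (negPf zl).
  case/orP: Zz => [rz|/existsP[x /andP[/eqP-> xo]]].
    by rewrite a3_root // /Z rdart_sg // rz.
  by rewrite a3_old -(em_sg em); exact: Zi.
by rewrite eb /Z (negPf (em_nroot em _)) /= => /existsP[x /andP[/eqP/inj-> ]].
Qed.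

Lemma faces_eq : ra \notin porbit (al Y * sg Y)%g (al Y ra) ->
    rb \notin porbit (cut (al Y) ra * sg Y)%g (al Y rb) ->
  (#|porbits (al Y * sg Y)%g| = #|porbits (al X * sg X)%g| + 2)%N.
Proof.
move=> h1 h2; have n1 : a1 rb != rb by rewrite a1b innerY.
have := Fcut (innerY ra); have := Fcut n1; rewrite -/a1 -/a2 F2 a1b h1 h2.
move: #|porbits (al Y * sg Y)%g| #|porbits (al X * sg X)%g| #|porbits (a1 * sg Y)%g| => u v w /=.
by clear; lia.
Qed.

End Faces.
End Counts.
End Embedding.

Section RootRemoval.
Variables (T T' : finType) (i : T -> T') (X : dstruct T) (Y : dstruct T').
Hypotheses (em : emb i X Y) (bc : bicubic Y).
Let cuY := bc_cubic bc.
Let alK := cu_inv cuY.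
Let inj := em_inj em.
Let innerY := bc_inner bc.

Lemma emb_white x : al X x = x -> ~~ blk X x.
Proof.
move=> /(em_leaf em)/(rdart_blk cuY)[+ _].
by rewrite (cu_bip cuY) ?innerY // (em_blk em) (bc_rblk bc).
Qed.

Lemma emb_cubic : cubic X.
Proof.
split.
- by move=> x; rewrite -(inj_eq inj) (em_sg em) (cu_neq cuY).
- by move=> x; apply: inj; rewrite !(em_sg em) (cu_three cuY).
- move=> x; have [e|nx] := eqVneq (al X x) x; first by rewrite !e.
  have ex := em_al em nx; have [e|nx'] := eqVneq (al X (al X x)) (al X x).
    by have := em_leaf em e; rewrite -ex alK (negPf (em_nroot em x)).
  by apply: inj; rewrite -(em_al em nx') -ex alK.
- by move=> x; rewrite -!(em_blk em) (em_sg em) (cu_blk cuY).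
- by move=> x; rewrite -!(em_occ em) (em_sg em) (cu_occ cuY).
- by move=> x nx; rewrite -!(em_blk em) -(em_al em nx) (cu_bip cuY).
Qed.
Let cuX := emb_cubic.

Lemma emb_fixed_card : #|[set x | al X x == x]| = 3%N.
Proof.
rewrite -(card_rdart cuY) -(card_imset [set y | rdart Y y] (@perm_inj _ (al Y))).
rewrite -(card_imset [set x | al X x == x] inj); apply: eq_card => y.
apply/imsetP/imsetP => -[x]; rewrite inE.
  by move=> /eqP/(em_leaf em) rx ->; exists (al Y (i x)); rewrite ?inE ?alK.
by case/(rdart_mate em cuY innerY (bc_rblk bc)) => z fz ez ->; exists z; rewrite ?inE ?fz.
Qed.

(* A component of the map without its root vertex has as many white as black
   darts modulo 3, so it contains 0 or 3 of the three edges to the root. *)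
Lemma emb_connected : gconnected (sg X) (al X).
Proof.
have alXK := cu_inv cuX; have sym := gconnect_sym (sg X) alXK.
suff tort x : connect (gstep (sg X) (al X)) x (rt X).
  by move=> y z; apply: connect_trans (tort y) _; rewrite sym.
pose K := connect (gstep (sg X) (al X)) x.
have Ksg y : K (sg X y) = K y.
  have st : connect (gstep (sg X) (al X)) y (sg X y) by apply: connect1; rewrite /gstep eqxx.
  by rewrite /K; apply/idP/idP => h; apply: connect_trans h _ => //; rewrite sym.
have Kal y : K (al X y) = K y.
  have st : connect (gstep (sg X) (al X)) y (al X y) by apply: connect1; rewrite /gstep eqxx orbT.
  by rewrite /K; apply/idP/idP => h; apply: connect_trans h _ => //; rewrite sym.
pose f y : int := if blk X y then -1 else 1.
have fsg y : f (sg X y) = f y by rewrite /f (cu_blk cuX).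
have [t et] := dvd3_cubic_sum (cu_neq cuX) (cu_three cuX) Ksg fsg.
have cnt : \sum_(y | K y) f y = #|[set y | K y && (al X y == y)]|%:Z.
  rewrite (bigID (fun y => al X y == y)) /=.
  set s := (X in _ + X); have -> : s = 0.
    suff : s = - s by lia.
    rewrite {1}/s (reindex_inj (@perm_inj _ (al X))) /= -sumrN; apply: eq_big => y.
      by rewrite Kal alXK eq_sym.
    by case/andP => _; rewrite alXK eq_sym => ay; rewrite /f (cu_bip cuX) //; case: (blk X y).
  rewrite addr0 -sum_pred_card [RHS](bigID (fun y => K y && (al X y == y))) /=.
  rewrite [X in _ + X]big1 ?addr0 => [|y /negPf-> //].
  apply: eq_bigr => y /andP[-> /eqP fy]; rewrite fy eqxx /f.
  by rewrite (negPf (emb_white fy)).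
have Ksub : [set y | K y && (al X y == y)] \subset [set y | al X y == y].
  by apply/subsetP => y; rewrite !inE => /andP[].
have [K0|[z]] := set_0Vmem [set y | K y && (al X y == y)]; last first.
  move=> zK; have Kpos : (0 < #|[set y | K y && (al X y == y)]|)%N by apply/card_gt0P; exists z.
  have := subset_leq_card Ksub; rewrite emb_fixed_card => le3.
  have e3 : #|[set y | K y && (al X y == y)]| = 3%N.
    by move: et cnt Kpos le3 => ->; move: #|_| => n; lia.
  have : [set y | K y && (al X y == y)] == [set y | al X y == y].
    by rewrite eqEcard Ksub e3 emb_fixed_card.
  move=> /eqP/setP/(_ (rt X)); rewrite !inE.
  have -> : al X (rt X) == rt X.
    apply: contraT => nx; have := em_al em nx; rewrite -(em_root em) alK => e.
    by have := root_neq em (al X (rt X)); rewrite -e eqxx.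
  by rewrite andbT.
have inner_K y : K y -> al X y != y.
  move=> Ky; apply/negP => fy; have : y \in set0 by rewrite -K0 inE Ky fy.
  by rewrite inE.
have : connect (gstep (sg Y) (al Y)) (i x) (rt Y) by exact: (bc_con bc).
suff closed_map y : connect (gstep (sg Y) (al Y)) (i x) y -> exists2 z, y = i z & K z.
  by case/closed_map => z e _; have := root_neq em z; rewrite e eqxx.
move=> /connectP[p]; have : exists2 z, i x = i z & K z by exists x => //; exact: connect0.
elim: p (i x) => [|u p IH] v vz /=; first by move=> _ ->.
case/andP => st pu; apply: IH => //; have [z ez Kz] := vz; move: st; rewrite ez => /orP[]/eqP ->.
  by exists (sg X z); rewrite ?(em_sg em) ?Ksg.
by exists (al X z); rewrite ?Kal // (em_al em) // inner_K.
Qed.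

(** [Y] has one vertex and three edges more than [X]. Its Euler formula, the Euler bound for [X] and
    [faces_le] leave room for equality only. *)
Lemma emb_faces : (#|porbits (al Y * sg Y)%g| = #|porbits (al X * sg X)%g| + 2)%N
  /\ (#|porbits (sg X)| + #|porbits (al X * sg X)%g| = nedges (blk X) (al X) + 2)%N.
Proof.
have [n1 n2 n3] := root_distinct cuY.
have le := faces_le em cuY innerY (bc_rblk bc) (fun y => erefl (rdart Y y)) n1 n2 n3.
have ge := euler_le (cu_inv cuX) (cu_bip cuX) emb_connected.
have := bc_euler bc; rewrite (emb_vertices em) (emb_edges em cuY innerY (bc_rblk bc) emb_white).
move: le ge; move: #|porbits (al Y * sg Y)%g| #|porbits (al X * sg X)%g| #|porbits (sg X)| => u v w.
by move: (nedges _ _) => e; lia.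
Qed.

Lemma rdart_perm3 ra rb rc : rdart Y ra -> rdart Y rb -> rdart Y rc ->
    ra != rb -> ra != rc -> rb != rc ->
  forall y, rdart Y y = [|| y == ra, y == rb | y == rc].
Proof.
move=> ra_ rb_ rc_ nab nac nbc y.
have : [set ra; rb; rc] == [set y | rdart Y y].
  rewrite eqEcard (card_rdart cuY) setUC cardsU1 cards2 !inE nab.
  rewrite ![rc == _]eq_sym (negPf nac) (negPf nbc) andbT; apply/subsetP => z.
  by rewrite !inE => /orP[/eqP->|/orP[]/eqP->].
by move/eqP/setP/(_ y); rewrite !inE => <-; rewrite orbA.
Qed.

Lemma third_rdart ra rb : rdart Y ra -> rdart Y rb -> ra != rb ->
  exists rc, [/\ rdart Y rc, ra != rc & rb != rc].
Proof.
move=> ra_ rb_ nab; have : (0 < #|[set y | rdart Y y] :\: [set ra; rb]|)%N.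
  rewrite cardsD (card_rdart cuY) subn_gt0; apply: leq_ltn_trans (_ : 2 < 3)%N => //.
  by apply: leq_trans (subset_leq_card (subsetIr _ _)) _; rewrite cards2 nab.
case/card_gt0P => rc; rewrite !inE negb_or => /andP[/andP[ca cb] rc_].
by exists rc; split=> //; rewrite eq_sym.
Qed.

(** Any of the three root darts can take the place of [ra] in [faces_split]. *)
Lemma rdart_face_neq r : rdart Y r -> r \notin porbit (al Y * sg Y)%g (al Y r).
Proof.
move=> rr; have r1 : rdart Y (sg Y r) by rewrite rdart_sg.
have n1 : r != sg Y r by rewrite eq_sym (cu_neq cuY).
have [rc [rc_ na nb]] := third_rdart rr r1 n1.
have [h _] := faces_split em cuY innerY (bc_rblk bc) (rdart_perm3 rr r1 rc_ n1 na nb) n1 na nb emb_faces.1.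
exact: h.
Qed.

Lemma emb_tmap : tmap X /\ nhp_darts X = set0.
Proof.
have fr : al X (rt X) = rt X.
  apply/eqP; apply: contraT => nx; have := em_al em nx; rewrite -(em_root em) alK => e.
  by have := root_neq em (al X (rt X)); rewrite -e eqxx.
split.
  split=> //.
  - exact: emb_connected.
  - exact: emb_white.
  - exact: emb_fixed_card.
  - move=> x fx; have [->|xr] := eqVneq x (rt X); first exact: porbit_id.
    have rx := em_leaf em fx; have r0 : rdart Y (rt Y) by rewrite /rdart eqxx.
    have nrx : al Y (i x) != rt Y.
      apply: contra xr => /eqP e; have := em_root em; rewrite -e alK => /inj ->; exact: eqxx.
    have [rc [rc_ na nb]] := third_rdart rx r0 nrx.
    apply: (faces_same em cuY innerY (bc_rblk bc) (rdart_perm3 rc_ rx r0 _ _ nrx) _ _ nrx emb_faces.1);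
      by rewrite ?alK ?(em_root em) // eq_sym.
  - exact: emb_faces.2.
apply/setP => x; rewrite !inE; apply/negP => /and3P[bx nx]; rewrite /HP -!(em_occ em) -(em_al em nx).
by rewrite -[~~ _]/(~~ HP Y (i x)) (bc_hp bc).
Qed.

End RootRemoval.

Lemma fpath_next (T : eqType) (f : T -> T) x s z y :
  fpath f x (rcons s z) -> y \in x :: s -> f y \in rcons s z.
Proof.
elim: s x => [|w s IH] x /= /andP[/eqP fx p].
  by rewrite !inE => /eqP->; rewrite fx.
rewrite inE => /orP[/eqP->|ys]; first by rewrite fx mem_head.
by rewrite inE (IH w) ?orbT.
Qed.

(** * The cyclic order of the three root leaves *)

Section RootLeaves.
Variable T : finType.
Implicit Types X : dstruct T.

(* The three root leaves [l1], [l2], [rt X] in the cyclic order of the face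
   containing them, with the stretches of that face between them. *)
Record root_leaves X l1 l2 (A1 A2 A3 : seq T) : Prop := RootLeaves {
  rl_uniq : uniq (rcons A1 l1 ++ rcons A2 l2 ++ rcons A3 (rt X));
  rl_path1 : fpath (face_step (sg X) (al X)) (rt X) (rcons A1 l1);
  rl_path2 : fpath (face_step (sg X) (al X)) l1 (rcons A2 l2);
  rl_path3 : fpath (face_step (sg X) (al X)) l2 (rcons A3 (rt X));
  rl_fix1 : al X l1 = l1;
  rl_fix2 : al X l2 = l2;
  rl_inner : forall y, y \in A1 ++ A2 ++ A3 -> al X y != y;
  rl_all : forall y, al X y = y -> [|| y == l1, y == l2 | y == rt X] }.

Lemma tmap_root_leaves X : tmap X -> exists l1 l2 A1 A2 A3, root_leaves X l1 l2 A1 A2 A3.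
Proof.
move=> tm; have ep := tmap_edge_perm tm; have [L o] := tmap_opens tm.
have op := opensP ep o; pose p y := al X y == y.
have sz : size (filter p L) = 3%N.
  by rewrite (size_filter_fix (op_uniq op) (op_fix op)) (tm_fix3 tm).
have ls : last (rt X) (filter p L) = rt X.
  case/lastP: (L) (op_root op) (op_last op) => // L' z _; rewrite last_rcons => ->.
  by rewrite filter_rcons /p (tm_root tm) eqxx last_rcons.
case eF: (filter p L) sz ls => [|l1 [|l2 [|l3 [|? ?]]]] //= _ e3; rewrite e3 in eF.
have [A1 [A2 [B [eL fA fB nA2]]]] := @filter_split _ p L [::] _ _ _ eF.
have [A3 eB] : exists A3, B = rcons A3 (rt X).
  move: (op_last op); rewrite eL last_cat /= last_cat.
  case/lastP: (B) fB => // A3 z _; rewrite !last_rcons => ->; by exists A3.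
have rp : p (rt X) by rewrite /p (tm_root tm).
have fA3 : filter p A3 = [::].
  by move: fB; rewrite eB filter_rcons rp; case: (filter p A3) => // a [].
have uL := op_uniq op; rewrite eL eB -cat_rcons in uL.
have : fcycle (face_step (sg X) (al X)) (rcons (rcons A1 l1 ++ rcons A2 l2 ++ A3) (rt X)).
  by have := op_cycle op; rewrite eL eB -cat_rcons rcons_cat rcons_cat.
rewrite -cats1 fcycle_rotate /= !rcons_cat !cat_path !last_rcons => /and3P[p1 p2 p3].
have nofix s y : filter p s = [::] -> y \in s -> al X y != y.
  move=> fs ys; apply/negP => py; have : y \in filter p s by rewrite mem_filter /p py.
  by rewrite fs.
have pl y : y \in [:: l1; l2; rt X] -> al X y = y.
  by rewrite -eF mem_filter => /andP[/eqP].
exists l1, l2, A1, A2, A3; split=> //.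
- by apply: pl; rewrite mem_head.
- by apply: pl; rewrite !inE eqxx orbT.
- by move=> y; rewrite !mem_cat => /or3P[/(nofix _ _ fA)|/nA2|/(nofix _ _ fA3)].
- move=> y fy; have : y \in filter p L by rewrite mem_filter /p fy eqxx (op_fix op).
  by rewrite eF !inE.
Qed.

Lemma root_leaves_relabel q X l1 l2 A1 A2 A3 : root_leaves X l1 l2 A1 A2 A3 ->
  root_leaves (relabel q X) (q l1) (q l2) (map q A1) (map q A2) (map q A3).
Proof.
have fp x s : fpath (face_step (sg X) (al X)) x s ->
    fpath (face_step (sg (relabel q X)) (al (relabel q X))) (q x) (map q s).
  rewrite path_map; apply: sub_path => a b /= /eqP <-.
  by rewrite /face_step !relabelE.
case=> u p1 p2 p3 f1 f2 ni all3.
split; rewrite ?rt_relabel -?map_rcons.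
- by rewrite -!map_cat map_inj_uniq //; exact: perm_inj.
- exact: fp.
- exact: fp.
- exact: fp.
- by rewrite al_relabel f1.
- by rewrite al_relabel f2.
- move=> y; rewrite -!map_cat => /mapP[x xI ->]; rewrite al_relabel (inj_eq perm_inj); exact: ni.
- apply: (perm_forall (p := q)) => x; rewrite al_relabel => /perm_inj/all3.
  by rewrite !(inj_eq perm_inj).
Qed.

End RootLeaves.

Section Order.
Variables (T T' : finType) (i : T -> T') (X : dstruct T) (Y : dstruct T').
Hypotheses (em : emb i X Y) (bc : bicubic Y).
Let cuY := bc_cubic bc.
Let alK := cu_inv cuY.
Let inj := em_inj em.
Let phiY := (al Y * sg Y)%g.

Let segment x s z : fpath (face_step (sg X) (al X)) x (rcons s z) ->
  (forall y, y \in x :: s -> al X y != y) -> i z \in porbit phiY (i x).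
Proof.
elim: s x => [|w s IH] x /= /andP[/eqP fx p] inn.
all: have e : phiY (i x) = i (face_step (sg X) (al X) x).
1,3: by rewrite permM (em_al em) ?inn ?mem_head // -(em_sg em).
  by rewrite -fx -e; exact: (mem_porbit _ 1).
apply: (@porbit_trans _ _ _ (i w)); first by rewrite -fx -e; exact: (mem_porbit _ 1).
by apply: IH => // y ys; apply: inn; rewrite inE ys orbT.
Qed.

Let segment_leaf l s z : fpath (face_step (sg X) (al X)) l (rcons s z) -> al X l = l ->
  (forall y, y \in s -> al X y != y) -> i z \in porbit phiY (al Y (i l)).
Proof.
move=> p fl inn; have e : phiY (al Y (i l)) = i (face_step (sg X) (al X) l).
  by rewrite permM alK -(em_sg em) /face_step fl.
case: s p inn => [|w s] /= /andP[/eqP fx p] inn.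
  by rewrite -fx -e; exact: (mem_porbit _ 1).
apply: (@porbit_trans _ _ _ (i w)); first by rewrite -fx -e; exact: (mem_porbit _ 1).
exact: segment p inn.
Qed.

(** Around the root vertex the edges follow in the order opposite to that of the leaves along the
    outer face. The other order would put the same face on both sides of a root edge, against
    [rdart_face_neq]. *)
Lemma root_order l1 l2 A1 A2 A3 : root_leaves X l1 l2 A1 A2 A3 ->
  al Y (i l1) = sg Y (sg Y (rt Y)) /\ al Y (i l2) = sg Y (rt Y).
Proof.
case=> u p1 p2 p3 f1 f2 ni all3.
have [tm _] := emb_tmap em bc; have fr := tm_root tm.
have r1 := em_leaf em f1; have r2 := em_leaf em f2.
have neq_al a b : a != b -> al Y (i a) != al Y (i b) by rewrite (inj_eq perm_inj) (inj_eq inj).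
have er : al Y (i (rt X)) = rt Y by rewrite -(em_root em) alK.
have n12 : l1 != l2.
  apply/eqP => e; move: u; rewrite e catA cat_uniq => /and3P[+ _ _].
  by rewrite cat_uniq => /and3P[_ /hasPn/(_ l2)]; rewrite /= !mem_rcons !mem_head => /(_ isT).
have n1r : l1 != rt X.
  apply/eqP => e; move: u; rewrite e cat_uniq => /and3P[_ /hasPn/(_ (rt X))].
  by rewrite /= mem_cat !mem_rcons !mem_head orbT => /(_ isT).
have n2r : l2 != rt X.
  apply/eqP => e; move: u; rewrite e catA cat_uniq => /and3P[_ /hasPn/(_ (rt X))].
  by rewrite /= mem_cat !mem_rcons !mem_head orbT => /(_ isT).
have s1 : i l1 \in porbit phiY (rt Y).
  by rewrite -er; apply: (segment_leaf p1 fr) => y yI; apply: ni; rewrite mem_cat yI.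
have s2 : i l2 \in porbit phiY (al Y (i l1)).
  by apply: (segment_leaf p2 f1) => y yI; apply: ni; rewrite !mem_cat yI orbT.
have pm y : sg Y (al Y y) \in porbit phiY y by rewrite -[sg Y _]permM; exact: (mem_porbit _ 1).
have := neq_al _ _ n12; have := neq_al _ _ n1r; have := neq_al _ _ n2r; rewrite er.
move: (r1) (r2); rewrite /rdart => /or3P[]/eqP e1 /or3P[]/eqP e2; rewrite e1 e2 ?eqxx //.
(* Only the wrong order is left: from the mate of [i l1] the face passes [i l2] and [rt Y] and comes
   to [i l1]. *)
move=> _ _ _; case/negP: (rdart_face_neq em bc r1); rewrite alK.
rewrite porbit_sym; apply: (@porbit_trans _ _ _ (rt Y)) s1.
apply: porbit_trans s2 _; rewrite -{1}(cu_three cuY (rt Y)) -e2; exact: pm.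
Qed.

End Order.

Lemma bij_of_card (A B : finType) : #|A| = #|B| ->
  exists (h : A -> B) (g : B -> A), cancel h g /\ cancel g h.
Proof.
move=> e; exists (fun a => enum_val (cast_ord e (enum_rank a))).
exists (fun b => enum_val (cast_ord (esym e) (enum_rank b))).
by split=> u; rewrite enum_valK ?cast_ordK ?cast_ordKV enum_rankK.
Qed.

(** * Isomorphisms and the removal of the root vertex *)

Section Transfer.
Variables (T T' : finType).
Implicit Types (X : dstruct T) (Y : dstruct T') (i : T -> T').

Lemma emb_iso_down i i2 X X2 Y Y2 : emb i X Y -> emb i2 X2 Y2 -> iso Y Y2 -> iso X X2.
Proof.
move=> em em2 /isoP[q eY2]; subst Y2.
have rq y : rdart (relabel q Y) (q y) = rdart Y y.
  by rewrite /rdart rt_relabel !sg_relabel !(inj_eq perm_inj).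
have ex x : {z | q (i x) = i2 z}.
  case: (pickP (fun z => q (i x) == i2 z)) => [z /eqP|h]; first by exists z.
  suff : False by []; have : ~~ rdart (relabel q Y) (q (i x)) by rewrite rq (em_nroot em).
  by case/(em_cover em2) => z e; have := h z; rewrite e eqxx.
pose f x := sval (ex x); have fE x : i2 (f x) = q (i x) by rewrite /f; case: (ex x).
have finj : injective f.
  by move=> x y e; apply: (em_inj em); apply: (@perm_inj _ q); rewrite -!fE e.
apply/existsP; exists (perm finj); apply/andP; split; last first.
  rewrite permE; apply/eqP/(em_inj em2).
  by rewrite fE -(em_root em2) rt_relabel al_relabel (em_root em).
apply/forallP => x; rewrite !permE; apply/and4P; split; apply/eqP.
- by apply: (em_inj em2); rewrite fE (em_sg em2) fE sg_relabel (em_sg em).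
- have al2 : al (relabel q Y) (i2 (f x)) = q (al Y (i x)) by rewrite fE al_relabel.
  have [fx|nx] := eqVneq (al X x) x.
    rewrite fx; apply/esym/eqP; apply: contraT => /(em_al em2); rewrite al2 => e.
    by have := em_leaf em fx; rewrite -rq e (negPf (em_nroot em2 _)).
  apply: (em_inj em2); rewrite fE -(em_al em nx) -al2; apply: (em_al em2).
  apply/eqP => /(em_leaf em2); rewrite al2 rq (em_al em nx).
  exact/negP/(em_nroot em).
- by rewrite -(em_blk em2) fE blk_relabel (em_blk em).
- by rewrite -(em_occ em2) fE occ_relabel (em_occ em).
Qed.

(** [X] does not record which root dart each leaf was attached to; [root_order] recovers it on both
    sides, so the isomorphism extends to the root darts. *)
Lemma emb_iso_up i i2 X X2 Y Y2 : emb i X Y -> emb i2 X2 Y2 -> bicubic Y -> bicubic Y2 ->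
  iso X X2 -> iso Y Y2.
Proof.
move=> em em2 bc bc2 /isoP[p eX2]; subst X2.
have [tm _] := emb_tmap em bc.
have [l1 [l2 [A1 [A2 [A3 rl]]]]] := tmap_root_leaves tm.
have [o1 o2] := root_order em bc rl.
have [o1' o2'] := root_order em2 bc2 (root_leaves_relabel p rl).
have cuY := bc_cubic bc; have cuY2 := bc_cubic bc2; have alK := cu_inv cuY; have alK2 := cu_inv cuY2.
have [n1 n2 n3] := root_distinct cuY; have [m1 m2 m3] := root_distinct cuY2.
pose f y := if [pick x | i x == y] is Some x then i2 (p x)
            else if y == rt Y then rt Y2
            else if y == sg Y (rt Y) then sg Y2 (rt Y2) else sg Y2 (sg Y2 (rt Y2)).
have fi x : f (i x) = i2 (p x).
  by rewrite /f; case: pickP => [z /eqP/(em_inj em)->//|/(_ x)]; rewrite eqxx.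
have fr y : rdart Y y -> [pick x | i x == y] = None.
  by move=> ry; case: pickP => // z /eqP e; move: ry; rewrite -e (negPf (em_nroot em z)).
have r0 : rdart Y (rt Y) by rewrite /rdart eqxx.
have r1 : rdart Y (sg Y (rt Y)) by rewrite rdart_sg.
have r2 : rdart Y (sg Y (sg Y (rt Y))) by rewrite !rdart_sg.
have f0 : f (rt Y) = rt Y2 by rewrite /f fr // eqxx.
have f1 : f (sg Y (rt Y)) = sg Y2 (rt Y2) by rewrite /f fr // eq_sym (negPf n1) eqxx.
have f2 : f (sg Y (sg Y (rt Y))) = sg Y2 (sg Y2 (rt Y2)).
  by rewrite /f fr // eq_sym (negPf n2) eq_sym (negPf n3).
have frd y : rdart Y y -> rdart Y2 (f y).
  by case/or3P => /eqP->; rewrite ?f0 ?f1 ?f2 ?rdart_sg // /rdart eqxx.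
have finj : injective f.
  move=> y z; have [ry|/(em_cover em)[x ->]] := boolP (rdart Y y).
    have [rz|/(em_cover em)[x ->]] := boolP (rdart Y z); last first.
      by move=> e; have := frd y ry; rewrite e fi (negPf (em_nroot em2 _)).
    move: ry rz => /or3P[]/eqP-> /or3P[]/eqP->; rewrite ?f0 ?f1 ?f2 // => /eqP;
      by rewrite ?(negPf m1) ?(negPf m2) ?(negPf m3) // eq_sym ?(negPf m1) ?(negPf m2) ?(negPf m3).
  have [rz|/(em_cover em)[x' ->]] := boolP (rdart Y z).
    by move=> e; have := frd z rz; rewrite -e fi (negPf (em_nroot em2 _)).
  by rewrite !fi => /(em_inj em2)/perm_inj->.
have al_leaf x : al X x = x -> f (al Y (i x)) = al Y2 (i2 (p x)).
  case/(rl_all rl)/or3P => /eqP->; first by rewrite o1 o1' f2.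
    by rewrite o2 o2' f1.
  by rewrite -(em_root em) alK -[p _]rt_relabel -(em_root em2) alK2 f0.
apply/existsP; exists (perm finj); rewrite permE f0 eqxx andbT.
apply/forallP => y; rewrite !permE; have [ry|/(em_cover em)[x ->]] := boolP (rdart Y y).
  have [b_y o_y] := rdart_blk cuY ry; have [b_fy o_fy] := rdart_blk cuY2 (frd y ry).
  apply/and4P; split; apply/eqP.
  - by case/or3P: ry => /eqP->; rewrite ?(cu_three cuY) ?f0 ?f1 ?f2 ?(cu_three cuY2).
  - have [x fx e] := rdart_mate em cuY (bc_inner bc) (bc_rblk bc) ry.
    by have := al_leaf x fx; rewrite e fi -e alK => ->; rewrite alK2.
  - by rewrite b_y b_fy !bc_rblk.
  - by rewrite o_y o_fy (negPf (bc_rocc bc)) (negPf (bc_rocc bc2)).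
rewrite fi -(em_sg em) fi; apply/and4P; split; apply/eqP.
- by rewrite -(em_sg em2) sg_relabel.
- have [fx|nx] := eqVneq (al X x) x; first exact: al_leaf.
  rewrite (em_al em nx) fi (em_al em2) al_relabel // (inj_eq perm_inj) //.
- by rewrite (em_blk em2) blk_relabel (em_blk em).
- by rewrite (em_occ em2) occ_relabel (em_occ em).
Qed.

Lemma emb_exists_down Y : bicubic Y -> #|T'| = (#|T| + 3)%N -> exists i X, emb i X Y.
Proof.
move=> bc cT; have cuY := bc_cubic bc; have alK := cu_inv cuY.
pose D := {y | ~~ rdart Y y}.
have cD : #|T| = #|{: D}|.
  rewrite card_sig; have := cardsC [set y | rdart Y y]; rewrite (card_rdart cuY) cT.
  have -> : #|~: [set y | rdart Y y]| = #|[pred y | ~~ rdart Y y]|.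
    by apply: eq_card => y; rewrite !inE.
  by rewrite addnC => /addIn.
have [h [g [hK gK]]] := bij_of_card cD.
pose i x := val (h x).
have iinj : injective i by move=> x y /val_inj/(can_inj hK).
have nr x : ~~ rdart Y (i x) := valP (h x).
(* The default [h x] is taken exactly when [y] is a root dart: the rotation never meets this case,
   and an edge to the root becomes a fixed point. *)
pose back x y := g (insubd (h x) y).
have backE x y : i (back x y) = if rdart Y y then i x else y.
  by rewrite /i /back gK val_insubd; case: (rdart Y y).
have sinj : injective (fun x => back x (sg Y (i x))).
  move=> x y e; apply: iinj; apply: (@perm_inj _ (sg Y)).
  by have := congr1 i e; rewrite !backE !rdart_sg // (negPf (nr x)) (negPf (nr y)).
pose af x := back x (al Y (i x)).
have afK : involutive af.
  move=> x; apply: iinj; rewrite /af backE; have := backE x (al Y (i x)); case: ifP => rx e.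
    by rewrite e rx.
  by rewrite e alK (negPf (nr x)).
have nrt : ~~ rdart Y (al Y (rt Y)).
  apply/negP => /(rdart_blk cuY)[+ _].
  by rewrite (cu_bip cuY) ?(bc_inner bc) // (bc_rblk bc).
exists i, (perm sinj, perm (inv_inj afK), [ffun x => blk Y (i x)], [ffun x => occ Y (i x)],
           g (exist (fun y => ~~ rdart Y y) _ nrt)).
have alE x : i (perm (inv_inj afK) x) = if rdart Y (al Y (i x)) then i x else al Y (i x).
  by rewrite permE /af backE.
split=> //.
- by move=> y ny; exists (g (exist (fun y => ~~ rdart Y y) y ny)); rewrite /i gK.
- by move=> x; rewrite [sg _]/= permE backE rdart_sg // (negPf (nr x)).
- by move=> x; rewrite ffunE.
- by move=> x; rewrite ffunE.
- by move=> x; rewrite -(inj_eq iinj) alE; case: ifP; rewrite ?eqxx.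
- move=> x /(congr1 i); rewrite alE; case: ifP => // _ /eqP.
  by rewrite (negPf (bc_inner bc _)).
- by rewrite /i gK.
Qed.

Lemma emb_vcounts i X Y a b c d : emb i X Y -> cubic Y -> blk Y (rt Y) -> ~~ occ Y (rt Y) ->
  vcounts Y a.+1 b c d = vcounts X a b c d.
Proof.
move=> em cuY rb ro; rewrite /vcounts.
rewrite (vcount_extend (i := i) (s := sg X) (r := rt Y) (P := fun x => blk X x && ~~ occ X x)).
- rewrite eqSS; congr (_ && _).
  have vE P' P : (forall x, P' (i x) = P x) -> ~~ P' (rt Y) -> (forall y, P' (sg Y y) = P' y) ->
      vcount (sg Y) P' = vcount (sg X) P.
    move=> PE nP sP; apply: (vcount_image (i := i)) PE _; [exact: em_inj em | exact: em_sg em|].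
    move=> y Py; apply: (em_cover em); apply: contraTN Py.
    by case/or3P => /eqP->; rewrite ?sP.
  by do 2?congr (_ && _); congr (_ == _); apply: vE => [x||y];
    rewrite ?(em_blk em) ?(em_occ em) ?(cu_blk cuY) ?(cu_occ cuY) // rb ?(negPf ro).
- exact: em_inj em.
- exact: em_sg em.
- by move=> x; rewrite (em_blk em) (em_occ em).
- by rewrite rb.
- exact: root_neq em.
- exact: emb_dichotomy em.
Qed.

End Transfer.

(** * Putting the root vertex back *)

Section AddRoot.
Variables (T T' : finType) (X : dstruct T).
Hypotheses (tm : tmap X) (hp : nhp_darts X = set0) (cT : #|T'| = (#|T| + 3)%N).

Lemma emb_exists_up : exists i (Y : dstruct T'), emb i X Y /\ bicubic Y.
Proof.
have [l1 [l2 [A1 [A2 [A3 rl]]]]] := tmap_root_leaves tm.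
have cuX := tm_cubic tm; have alXK := cu_inv cuX; have fr := tm_root tm.
have f1 := rl_fix1 rl; have f2 := rl_fix2 rl.
have /and3P[uA1 /hasPn d1 u23] : [&& uniq (rcons A1 l1),
   ~~ has (mem (rcons A1 l1)) (rcons A2 l2 ++ rcons A3 (rt X))
   & uniq (rcons A2 l2 ++ rcons A3 (rt X))] by rewrite -cat_uniq; exact: rl_uniq rl.
have /and3P[uA2 /hasPn d2 uA3] : [&& uniq (rcons A2 l2),
   ~~ has (mem (rcons A2 l2)) (rcons A3 (rt X)) & uniq (rcons A3 (rt X))].
  by rewrite -cat_uniq.
have n21 : l2 \notin rcons A1 l1 by apply: d1; rewrite mem_cat mem_rcons mem_head.
have nr1 : rt X \notin rcons A1 l1 by apply: d1; rewrite mem_cat [in X in _ || X]mem_rcons mem_head orbT.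
have nr2 : rt X \notin rcons A2 l2 by apply: d2; rewrite mem_rcons mem_head.
have n12 : (l1 == l2) = false.
  by apply/negP => /eqP e; rewrite -e mem_rcons mem_head in n21.
have n1r : (l1 == rt X) = false.
  by apply/negP => /eqP e; rewrite -e mem_rcons mem_head in nr1.
have n2r : (l2 == rt X) = false.
  by apply/negP => /eqP e; rewrite -e mem_rcons mem_head in nr2.
have n23 : l2 \notin rcons A3 (rt X).
  by apply/negP => h; have := d2 _ h; rewrite /= mem_rcons mem_head.
(* [None] is the root dart, [Some false] and [Some true] are its first and second images under the
   rotation. The leaves are attached to them in the order that [root_order] forces. *)
pose U := (T + option bool)%type.
have cU : #|{: U}| = #|T'| by rewrite card_sum card_option card_bool cT.
have [h [g [hK gK]]] := bij_of_card cU.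
pose sU (u : U) : U := match u with
  | inl x => inl (sg X x) | inr None => inr (Some false)
  | inr (Some false) => inr (Some true) | inr (Some true) => inr None end.
pose aU (u : U) : U := match u with
  | inl x => if al X x == x
             then inr (if x == rt X then None else Some (x != l2))
             else inl (al X x)
  | inr None => inl (rt X) | inr (Some false) => inl l2 | inr (Some true) => inl l1 end.
have sU3 u : sU (sU (sU u)) = u by case: u => [x|[[]|]] //=; rewrite (cu_three cuX).
have aUK : involutive aU.
  case=> [x|[[]|]] /=.
  - case: eqP => [fx|nx] /=; last by rewrite alXK ifF // eq_sym; apply/eqP.
    have := rl_all rl fx; have [->//|xr] := eqVneq x (rt X).
    rewrite orbF; have [->//|x2 /=] := eqVneq x l2.
    by rewrite orbF => /eqP->.
  - by rewrite f1 eqxx n1r n12.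
  - by rewrite f2 eqxx n2r ?eqxx.
  - by rewrite fr !eqxx.
have hinj : injective h := can_inj hK; have ginj : injective g := can_inj gK.
have sinj : injective (fun y => h (sU (g y))).
  by move=> y z /hinj e; apply: ginj; rewrite -[g y]sU3 e sU3.
have ainj : injective (fun y => h (aU (g y))) by move=> y z /hinj/(inv_inj aUK)/ginj.
pose Y : dstruct T' := (perm sinj, perm ainj,
  [ffun y => if g y is inl x then blk X x else true],
  [ffun y => if g y is inl x then occ X x else false], h (inr None)).
have sE u : sg Y (h u) = h (sU u) by rewrite permE hK.
have aE u : al Y (h u) = h (aU u) by rewrite permE hK.
have bE u : blk Y (h u) = if u is inl x then blk X x else true by rewrite ffunE hK.
have oE u : occ Y (h u) = if u is inl x then occ X x else false by rewrite ffunE hK.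
have rE : rt Y = h (inr None) by [].
clearbody Y.
have all_h (P : T' -> Prop) : (forall u, P (h u)) -> forall y, P y.
  by move=> hP y; rewrite -(gK y).
have rdE u : rdart Y (h u) = if u is inl _ then false else true.
  rewrite /rdart rE !sE !(inj_eq hinj) /=.
  by case: u => [x|[[]|]].
have wX x : al X x = x -> blk X x = false by move=> /(tm_white tm)/negPf.
have cuY : cubic Y.
  split; apply: all_h => u.
  - rewrite sE (inj_eq hinj); case: u => [x|[[]|]] //=.
    by apply/eqP => -[/eqP]; rewrite (negPf (cu_neq cuX x)).
  - by rewrite !sE sU3.
  - by rewrite !aE aUK.
  - by rewrite sE !bE; case: u => [x|[[]|]] //=; rewrite (cu_blk cuX).
  - by rewrite sE !oE; case: u => [x|[[]|]] //=; rewrite (cu_occ cuX).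
  - move=> _; rewrite aE !bE; case: u => [x|[[]|]] /=.
    + by case: eqP => [/wX->//|/eqP nx]; rewrite (cu_bip cuX).
    + by rewrite wX.
    + by rewrite wX.
    + by rewrite wX.
have innerY : forall y, al Y y != y.
  apply: all_h => u; rewrite aE (inj_eq hinj); case: u => [x|[[]|]] //=.
  by case: (eqVneq (al X x) x) => [//|nx]; apply/eqP => -[e]; rewrite e eqxx in nx.
pose i x := h (inl x).
have em : emb i X Y.
  split.
  - by move=> x y /hinj[].
  - by move=> x; rewrite rdE.
  - by apply: all_h => -[x|k]; rewrite rdE // => _; exists x.
  - by move=> x; rewrite sE.
  - by move=> x; rewrite bE.
  - by move=> x; rewrite oE.
  - by move=> x nx; rewrite aE /= (negPf nx).
  - by move=> x fx; rewrite aE /= fx eqxx rdE.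
  - by rewrite rE aE.
exists i, Y; split=> //.
have rb : blk Y (rt Y) by rewrite rE bE.
have conY : gconnected (sg Y) (al Y).
  have sym := gconnect_sym (sg Y) (cu_inv cuY).
  suff c y : connect (gstep (sg Y) (al Y)) (rt Y) y.
    by move=> y z; apply: connect_trans (c z); rewrite sym.
  have st a b : b = sg Y a \/ b = al Y a -> connect (gstep (sg Y) (al Y)) a b.
    by move=> e; apply: connect1; rewrite /gstep; case: e => ->; rewrite eqxx ?orbT.
  have [/rdart_porbit|/(em_cover em)[x ->]] := boolP (rdart Y y).
    by move=> /porbitP[k ->]; rewrite permX; elim: k => //= k IH; apply: connect_trans IH (st _ _ (or_introl erefl)).
  apply: (@connect_trans _ _ (i (rt X))); first by apply: st; right; rewrite (em_root em).
  have /connectP[p] := tm_con tm (rt X) x.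
  elim: p (rt X) => [|z p IH] w /=; first by move=> _ ->.
  case/andP => wz pz e; apply: connect_trans (IH z pz e).
  case/orP: wz => /eqP ->; first by apply: st; left; rewrite (em_sg em).
  have [->//|nw] := eqVneq (al X w) w.
  by apply: st; right; rewrite (em_al em).
have [m1 m2 m3] := root_distinct cuY.
have phY u : (al Y * sg Y)%g (h u) = h (sU (aU u)) by rewrite permM aE sE.
have i_rt : al Y (rt Y) = i (rt X) by exact: em_root em.
have rs1 : sg Y (rt Y) = h (inr (Some false)) by rewrite rE sE.
split=> //.
- apply: all_h => u; rewrite /HP aE !oE; case: u => [x|[[]|]] //=.
    case: eqP => [_|/eqP nx]; first by rewrite andbF.
    have hpb z : blk X z -> al X z != z -> ~~ (occ X z && occ X (al X z)).
      by move=> bz az; have /setP/(_ z) := hp; rewrite !inE bz az /= => /negbFE.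
    have [bx|wx] := boolP (blk X x); first exact: hpb.
    by rewrite andbC -{2}[x]alXK; apply: hpb; [rewrite (cu_bip cuX) | rewrite alXK eq_sym].
- suff fe : (#|porbits (al Y * sg Y)%g| = #|porbits (al X * sg X)%g| + 2)%N.
    have := tm_euler tm; rewrite fe (emb_vertices em) (emb_edges em cuY innerY rb (tm_white tm)).
    move: #|porbits (sg X)| #|porbits (al X * sg X)%g| (nedges (blk X) (al X)) => a b c.
    by clear; lia.
  apply: (faces_eq em cuY innerY rb (fun y => erefl (rdart Y y)) m1 m2 m3).
    rewrite porbit_sym; apply/negP => hin.
    (* The face of the root dart runs along the first stretch up to [l1] and returns to the root;
       the leaf [rt X], on the other side of the root edge, is not met. *)
    pose Z y := (y == rt Y) || [exists x, (y == i x) && (x \in rcons A1 l1)].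
    have Zi x : x \in rcons A1 l1 -> Z (i x).
      by move=> xI; apply/orP; right; apply/existsP; exists x; rewrite eqxx.
    have : Z (al Y (rt Y)).
      apply: (porbit_closed (P := Z)) hin; last by rewrite /Z eqxx.
      move=> z /orP[/eqP->|/existsP[x /andP[/eqP-> xI]]].
        rewrite permM i_rt -(em_sg em); apply: Zi.
        have := fpath_next (rl_path1 rl) (mem_head _ _).
        by rewrite /face_step fr.
      move: xI; rewrite mem_rcons inE => /orP[/eqP->|xI].
        by rewrite /i phY /= f1 eqxx n1r n12 /= /Z rE eqxx.
      have nx : al X x != x by apply: (rl_inner rl); rewrite mem_cat xI.
      rewrite permM (em_al em nx) -(em_sg em); apply: Zi.
      by apply: (fpath_next (rl_path1 rl)); rewrite inE xI orbT.
    rewrite i_rt /Z rE (inj_eq hinj) /= => /existsP[x /andP[/eqP/(em_inj em)<-]].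
    by rewrite (negPf nr1).
  rewrite porbit_sym; apply/negP => hin.
  (* With the root edge cut, the face of [sg Y (rt Y)] consists of the third and the first stretch;
     the leaf [l2] is on neither. *)
  pose L := rcons A3 (rt X) ++ rcons A1 l1.
  pose Z y := [|| y == rt Y, y == sg Y (rt Y) | [exists x, (y == i x) && (x \in L)]].
  have Zi x : x \in L -> Z (i x).
    by move=> xI; apply/or3P; constructor 3; apply/existsP; exists x; rewrite eqxx.
  have cE := cutE (rt Y) (cu_inv cuY).
  have e1 : al Y (sg Y (rt Y)) = i l2 by rewrite rs1 aE.
  have : Z (al Y (sg Y (rt Y))).
    apply: (porbit_closed (P := Z)) hin; last by rewrite /Z eqxx orbT.
    move=> z; rewrite permM cE => /or3P[/eqP->|/eqP->|/existsP[x /andP[/eqP-> xI]]].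
    - by rewrite eqxx /= /Z eqxx orbT.
    - rewrite ifF; last first.
        by rewrite eq_sym (negPf m1) /= i_rt rs1 (inj_eq hinj).
      rewrite e1 -(em_sg em); apply: Zi; rewrite mem_cat; apply/orP; left.
      by have := fpath_next (rl_path3 rl) (mem_head _ _); rewrite /face_step f2.
    rewrite i_rt (inj_eq (em_inj em)) eq_sym (negPf (root_neq em x)) /=.
    have [->|xr] := eqVneq x (rt X).
      rewrite -(em_sg em); apply: Zi; rewrite mem_cat; apply/orP; right.
      by have := fpath_next (rl_path1 rl) (mem_head _ _); rewrite /face_step fr.
    have [->|x1] := eqVneq x l1.
      by rewrite /i aE sE /= f1 eqxx n1r n12 /= /Z rE eqxx.
    move: xI; rewrite mem_cat !mem_rcons !inE (negPf xr) (negPf x1) /= => xI.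
    have nx : al X x != x.
      by apply: (rl_inner rl); rewrite !mem_cat; case/orP: xI => ->; rewrite ?orbT.
    rewrite (em_al em nx) -(em_sg em); apply: Zi; rewrite mem_cat; apply/orP.
    case/orP: xI => xI; [left; apply: (fpath_next (rl_path3 rl)) | right; apply: (fpath_next (rl_path1 rl))];
      by rewrite inE xI orbT.
  rewrite e1 /Z rs1 rE /i !(inj_eq hinj) /= => /existsP[x /andP[/eqP/hinj[<-]]].
  by rewrite mem_cat (negPf n23) (negPf n21).
- by rewrite rE oE.
Qed.

End AddRoot.

(** A relation takes the place of a function because removing or adding the root vertex involves a
    choice of labels; it only has to be injective up to isomorphism. *)
Lemma class_le (T1 T2 : finType) (P : pred (dstruct T1)) (Q : pred (dstruct T2))
    (R : dstruct T1 -> dstruct T2 -> Prop) :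
    (forall X, P X -> exists2 Y, Q Y & R X Y) ->
    (forall X1 X2 Y1 Y2, P X1 -> P X2 -> Q Y1 -> Q Y2 -> R X1 Y1 -> R X2 Y2 ->
       iso Y1 Y2 -> iso X1 X2) ->
  (#|iso_classes P| <= #|iso_classes Q|)%N.
Proof.
move=> ex inj; pose I := {C | C \in iso_classes P}.
have isoE (T : finType) (S : pred (dstruct T)) X1 X2 : S X1 -> S X2 ->
    ([set Y | S Y && iso X1 Y] == [set Y | S Y && iso X2 Y]) = iso X1 X2.
  move=> S1 S2; apply/eqP/idP => [/setP/(_ X2)|/isoP[p ->]].
    rewrite !inE S2 /= => ->; apply/isoP; exists 1%g; exact/esym/relabel1.
  apply/setP => Y; rewrite !inE; case: (S Y) => //=; apply/isoP/isoP => -[q ->].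
    by exists (p^-1 * q)%g; rewrite relabelM mulKVg.
  by exists (p * q)%g; rewrite relabelM.
have [f fP] : exists f : I -> {set dstruct T2}, forall C, exists X Y,
    [/\ P X, Q Y, R X Y, val C = [set Z | P Z && iso X Z] & f C = [set Z | Q Z && iso Y Z]].
  apply: (fin_all_exists (P := fun C D => exists X Y, [/\ P X, Q Y, R X Y,
    val C = [set Z | P Z && iso X Z] & D = [set Z | Q Z && iso Y Z]])) => -[C CP].
  have /imsetP[X] := CP; rewrite inE => PX eC; have [Y QY RXY] := ex X PX.
  by exists [set Z | Q Z && iso Y Z], X, Y.
have finj : injective f.
  move=> C1 C2 e; have [X1 [Y1 [P1 Q1 R1 v1 e1]]] := fP C1; have [X2 [Y2 [P2 Q2 R2 v2 e2]]] := fP C2.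
  apply: val_inj; rewrite v1 v2; apply/eqP; rewrite isoE //.
  apply: inj R1 R2 _ => //; rewrite -(isoE _ Q) // -e1 -e2; exact/eqP.
have -> : #|iso_classes P| = #|{: I}| by rewrite card_sig; apply: eq_card => C; rewrite !inE.
rewrite -(card_imset _ finj); apply: subset_leq_card; apply/subsetP => D /imsetP[C _ ->].
have [X [Y [_ QY _ _ ->]]] := fP C.
by apply/imsetP; exists Y; rewrite ?inE.
Qed.

Lemma bicubic_classes nb nw nbo nwo :
  #|iso_classes (bicubic_map nb nw nbo nwo)| = #|iso_classes (@hp_tmap_v nb nw nbo nwo)|.
Proof.
have cT : #|{: map_darts nb nw nbo nwo}| = (#|{: tree_darts nb nw nbo nwo}| + 3)%N.
  by rewrite !card_ord; lia.
apply/eqP; rewrite eqn_leq; apply/andP; split.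
  apply: (class_le (R := fun Y X => exists i, emb i X Y)).
    move=> Y /andP[/bicubicP bc vY]; have [i [X em]] := emb_exists_down bc cT.
    have [tm n0] := emb_tmap em bc; exists X; last by exists i.
    rewrite /hp_tmap_v /hp_tmap n0 eqxx andbT; apply/andP; split; first exact/tmapP.
    by rewrite -(emb_vcounts _ _ _ _ em (bc_cubic bc) (bc_rblk bc) (bc_rocc bc)).
  move=> Y1 Y2 X1 X2 /andP[/bicubicP bc1 _] /andP[/bicubicP bc2 _] _ _ [i1 em1] [i2 em2].
  exact: emb_iso_up em1 em2 bc1 bc2.
apply: (class_le (R := fun X Y => exists i, emb i X Y)).
  move=> X /andP[/andP[/tmapP tm /eqP n0] vX].
  have [i [Y [em bc]]] := emb_exists_up tm n0 cT; exists Y; last by exists i.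
  rewrite /bicubic_map (introT (bicubicP Y) bc) /=.
  by rewrite (emb_vcounts _ _ _ _ em (bc_cubic bc) (bc_rblk bc) (bc_rocc bc)).
by move=> X1 X2 Y1 Y2 _ _ _ _ [i1 em1] [i2 em2]; exact: emb_iso_down em1 em2.
Qed.

Theorem mainTheorem1 (nb nw nbo nwo : nat) :
  \sum_(C in iso_classes (adm_tree nb nw nbo nwo)) class_sign C
    = (#|iso_classes (bicubic_map nb nw nbo nwo)| : int)
  /\ #|iso_classes (bicubic_map nb nw nbo nwo)| = #|iso_classes (good_tree nb nw nbo nwo)|.
Proof.
by rewrite admissible_classes tmap_classes bicubic_classes.
Qed.
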